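(* Let $V\subset\mathbb{R}^N$ be the algebraic set $V=\{(x_1,\ldots,x_N)\in\mathbb{R}^N : x_k^d=Q_0(y)+Q_1(y)x_k+\cdots+Q_{d-1}(y)x_k^{d-1}\}$, where $y=(x_1,\ldots,x_{k-1},x_{k+1},\ldots,x_N)$ and $Q_0,\ldots,Q_{d-1}$ are polynomials in $y$. If $E$ is a $C^{\infty}_V$ determining compact subset of $V$, then the following statements are equivalent: (i) ($\mathcal{P}(y)\otimes\mathcal{P}_{d-1}(x_k)$-Markov inequality) There exist positive constants $M$ and $r$ such that for each polynomial $P\in\mathcal{P}(y)\otimes\mathcal{P}_{d-1}(x_k)$ and each $\alpha\in\mathbb{Z}^N_{+}$, $$\|D^{\alpha}P\|_E\le M(\deg P)^{r|\alpha|}\|P\|_E .$$ (ii) There exist positive constants $M$ and $r$ such that for every $n=1,2,\ldots$ and every $P\in\mathcal{P}(y)\otimes\mathcal{P}_{d-1}(x_k)$ of degree at most $n$, $$|P(x)|\le M\|P\|_E\quad\text{if}\quad x\in E_n:=\{x\in\mathbb{R}^N : \operatorname{dist}(x,E)\le 1/n^r\}.$$ (iii) (Bernstein's theorem) For every function $f:E\to\mathbb{R}$, if the sequence $\{\operatorname{dist}_E(f,\mathcal{P}_l(y)\otimes\mathcal{P}_{d-1}(x_k))\}_l$ is rapidly decreasing, then there is a function $\tilde f\in C^{\infty}_V(\mathbb{R}^N)$ such that $\tilde f_{|E}=f$. (iv) The space $(C^{\infty}_V(E),\tau_J)$ is complete and $C^{\infty}_V(E)=C^{\infty}(E)$. (v)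 The topologies $\tau_J$ and $\tau_Q$ for $C^{\infty}_V(E)$ coincide.
   Context: Fix integers $N\ge 2$, $1\le k\le N$, $d\ge 1$, and write $y=(x_1,\ldots,x_{k-1},x_{k+1},\ldots,x_N)\in\mathbb{R}^{N-1}$. All polynomials and functions are real-valued. $\mathbb{Z}_+$ is the set of nonnegative integers, and for $\alpha\in\mathbb{Z}_+^N$, $D^\alpha$ is the corresponding partial derivative in $\mathbb{R}^N$ and $|\alpha|=\alpha_1+\cdots+\alpha_N$. $\deg P$ is the total degree of $P$ (with $0^0=1$ in expressions such as $(\deg P)^{r|\alpha|}$). $\mathcal{P}(y)$ is the space of polynomials in the variables $y$, and $\mathcal{P}_n(y)$ its subspace of polynomials of degree at most $n$. $\mathcal{P}(y)\otimes\mathcal{P}_{d-1}(x_k)$ (respectively $\mathcal{P}_n(y)\otimes\mathcal{P}_{d-1}(x_k)$) denotes the space of polynomials on $\mathbb{R}^N$ of the form $\sum_{i=0}^{d-1}G_i(y)x_k^i$ with all $G_i\in\mathcal{P}(y)$ (respectively $G_i\in\mathcal{P}_n(y)$). For a compact set $K\subset\mathbb{R}^N$, $\|\cdot\|_K$ is the sup norm on $K$, and for a function $f$ on $K$ and a set $\mathcal{F}$ of polynomials, $\operatorname{dist}_K(f,\mathcal{F})=\inf\{\|f-p\|_K : p\in\mathcal{F}\}$. For $x\in\mathbb{R}^N$, $\operatorname{dist}(x,E)$ is the Euclidean distance from $x$ to $E$. A sequence $\{a_l\}$ is rapidly decreasing if $\lim_{l\to\infty}l^s a_l=0$ for every $s>0$.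 $C^{\infty}_V(\mathbb{R}^N)$ is the set of all $f\in C(\mathbb{R}^N)$ such that for every compact cube $I$ in $\mathbb{R}^N$ and every $r>0$, $\lim_{n\to\infty}n^r\operatorname{dist}_I(f,\mathcal{P}_n(y)\otimes\mathcal{P}_{d-1}(x_k))=0$. One has $C^\infty_V(\mathbb{R}^N)\subset C^\infty(\mathbb{R}^N)$. A set $E\subset V$ is $C^{\infty}_V$ determining if for each $f\in C^{\infty}_V(\mathbb{R}^N)$, $f_{|E}=0$ implies $D^{\alpha}f_{|E}=0$ for all $\alpha\in\mathbb{Z}^N_+$. For a compact set $E\subset V$, $C^{\infty}_V(E)$ is the space of functions $f$ on $E$ for which there is $\tilde f\in C^{\infty}_V(\mathbb{R}^N)$ with $\tilde f_{|E}=f$; $C^\infty(E)$ is the space of restrictions to $E$ of functions in $C^\infty(\mathbb{R}^N)$. $\tau_J$ is the topology on $C^{\infty}_V(E)$ determined by the seminorms $\delta_{-1}(f)=\|f\|_E$, $\delta_0(f)=\operatorname{dist}_E(f,\mathcal{P}_0(y)\otimes\mathcal{P}_{d-1}(x_k))$ and $\delta_\nu(f)=\sup_{l\ge 1}l^\nu\operatorname{dist}_E(f,\mathcal{P}_l(y)\otimes\mathcal{P}_{d-1}(x_k))$ for $\nu=1,2,\ldots$. $\tau_Q$ is the topology on $C^{\infty}_V(E)$ determined by the seminorms $q_{K,\nu}(f)=\inf\{|\tilde f|^\nu_K : \tilde f\in C^{\infty}_V(\mathbb{R}^N),\ \tilde f_{|E}=f\}$, for all compact $K\subset\mathbb{R}^N$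 and $\nu=0,1,\ldots$, where $|g|^\nu_K=\max_{|\alpha|\le\nu}\|D^\alpha g\|_K$. Equivalently, $\tau_Q$ is the quotient topology of $C^{\infty}_V(\mathbb{R}^N)/I(E)$, where $I(E)=\{f\in C^{\infty}_V(\mathbb{R}^N): f_{|E}=0\}$ and $C^{\infty}_V(\mathbb{R}^N)$ carries the topology given by the seminorms $|\cdot|^\nu_K$. *)

(* Defs.v *)
From HB Require Import structures.
From mathcomp Require Import all_boot all_order all_algebra.
(* The notations of [mpoly] clash with those of the analysis library. *)
From mathcomp Require Import -(notations) mpoly.
From mathcomp Require Import all_classical all_reals all_analysis.

Set Implicit Arguments.
Unset Strict Implicit.
Unset Printing Implicit Defensive.
Import Order.TTheory GRing.Theory Num.Theory.
Import numFieldNormedType.Exports.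
Local Open Scope classical_set_scope.
Local Open Scope ring_scope.

Section Polynomials.
Context {R : realType} {N : nat}.

Definition evalp (P : mpoly N R) (x : 'rV[R]_N) : R :=
  meval (x 0) P.

(* The degree of the zero polynomial is 0. *)
Definition degp (P : mpoly N R) : nat := \max_(m <- msupp P) mdeg m.

(* The [N.-1] variables of [G] are renamed to those of index different from
   [k], in increasing order. *)
Definition injy (k : 'I_N) (G : mpoly N.-1 R) : mpoly N R :=
  comp_mpoly [tuple mpolyX R (mnm1 (lift k j)) | j < N.-1] G.

End Polynomials.

Section PolynomialSpaces.
Context {R : realType} {N : nat} (k : 'I_N) (d : nat).

Definition xk : mpoly N R := mpolyX R (mnm1 k).

Definition tensor_poly : set (mpoly N R) :=
  [set P | exists G : 'I_d -> mpoly N.-1 R,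
     P = \sum_(i < d) injy k (G i) * xk ^+ i].

Definition tensor_poly_le (n : nat) : set (mpoly N R) :=
  [set P | exists2 G : 'I_d -> mpoly N.-1 R,
     (forall i, (degp (G i) <= n)%N) &
     P = \sum_(i < d) injy k (G i) * xk ^+ i].

End PolynomialSpaces.

(* [col' k x] is the vector y, i.e. x without its k-th coordinate. *)
Definition variety {R : realType} {N : nat} (k : 'I_N) (d : nat)
    (Q : 'I_d -> mpoly N.-1 R) : set 'rV[R]_N :=
  [set x : 'rV[R]_N | x 0 k ^+ d = \sum_(i < d) evalp (Q i) (col' k x) * x 0 k ^+ i].

(* A function on [K] is a function on the type of the elements of [K]; the
   restriction to [K] of [f : 'rV[R]_N -> R] is [sigL K f].  Norms and
   distances are extended reals, as the functions may be unbounded. *)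

Section Distances.
Context {R : realType} {N : nat}.

(* The 0 only matters when [K] is empty. *)
Definition supnorm (K : set 'rV[R]_N) (f : K -> R) : \bar R :=
  ereal_sup (0%E |` range (fun x : K => `|f x|%:E)).

Definition distK (K : set 'rV[R]_N) (f : K -> R)
    (F : set (mpoly N R)) : \bar R :=
  ereal_inf [set supnorm (f - sigL K (evalp P)) | P in F].

(* The norm of the library on ['rV[R]_N] is the maximum norm. *)
Definition eucl_norm (x : 'rV[R]_N) : R := Num.sqrt (\sum_i x 0 i ^+ 2).

(* Equal to +oo when [E] is empty. *)
Definition eucl_dist (x : 'rV[R]_N) (E : set 'rV[R]_N) : \bar R :=
  ereal_inf [set (eucl_norm (x - z))%:E | z in E].

End Distances.

Definition rapidly_decreasing {R : realType} (a : nat -> \bar R) : Prop :=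
  forall s : R, 0 < s -> ((l%:R `^ s)%:E * a l)%E @[l --> \oo] --> 0%E.

Section Derivatives.
Context {R : realType} {N : nat}.

(* [partials [:: i_1; ...; i_m] f] is D_{i_1} ... D_{i_m} f. *)
Definition partials (s : seq 'I_N) (f : 'rV[R]_N -> R) : 'rV[R]_N -> R :=
  foldr (fun i g x => 'D_'e_i g x) f s.

Definition absm (alpha : {ffun 'I_N -> nat}) : nat := (\sum_i alpha i)%N.

Definition Dalpha (alpha : {ffun 'I_N -> nat}) :
    ('rV[R]_N -> R) -> 'rV[R]_N -> R :=
  partials (flatten [seq nseq (alpha i) i | i <- enum 'I_N]).

Definition smooth (f : 'rV[R]_N -> R) : Prop :=
  forall s : seq 'I_N, continuous (partials s f) /\
    forall (i : 'I_N) (x : 'rV[R]_N), derivable (partials s f) x 'e_i.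

Definition Cnorm (K : set 'rV[R]_N) (nu : nat) (g : 'rV[R]_N -> R) : \bar R :=
  ereal_sup [set supnorm (sigL K (Dalpha alpha g)) |
    alpha in [set alpha | (absm alpha <= nu)%N]].

End Derivatives.

Section CVSpaces.
Context {R : realType} {N : nat} (k : 'I_N) (d : nat).

Definition cube (c : 'rV[R]_N) (h : R) : set 'rV[R]_N :=
  [set x : 'rV[R]_N | forall i, c 0 i <= x 0 i <= c 0 i + h].

Definition CV (f : 'rV[R]_N -> R) : Prop :=
  continuous f /\
  forall (c : 'rV[R]_N) (h : R), 0 < h ->
  forall r : R, 0 < r ->
    ((n%:R `^ r)%:E * distK (sigL (cube c h) f) (tensor_poly_le k d n))%E
      @[n --> \oo] --> 0%E.

Definition CV_determining (E : set 'rV[R]_N) : Prop :=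
  forall f : 'rV[R]_N -> R, CV f -> (forall x, E x -> f x = 0) ->
  forall (alpha : {ffun 'I_N -> nat}) x, E x -> Dalpha alpha f x = 0.

Definition CV_on (E : set 'rV[R]_N) : set (E -> R) :=
  [set sigL E f | f in CV].

Definition Cinf_on (E : set 'rV[R]_N) : set (E -> R) :=
  [set sigL E f | f in smooth].

Definition J_seminorms (E : set 'rV[R]_N) : set ((E -> R) -> \bar R) :=
  [set @supnorm R N E;
       (fun f => distK f (tensor_poly_le k d 0))] `|`
  [set (fun f => ereal_sup [set ((l%:R ^+ nu)%:E *
           distK f (tensor_poly_le k d l))%E | l in [set l | (0 < l)%N]])
   | nu in [set nu | (0 < nu)%N]].

Definition q_seminorm (E K : set 'rV[R]_N) (nu : nat) (f : E -> R) : \bar R :=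
  ereal_inf [set Cnorm K nu g | g in [set g | CV g /\ sigL E g = f]].

Definition Q_seminorms (E : set 'rV[R]_N) : set ((E -> R) -> \bar R) :=
  [set p | exists2 K, compact K & exists nu, p = @q_seminorm E K nu].

End CVSpaces.

Arguments CV_on {R N} k d E.
Arguments Cinf_on {R N} E.
Arguments J_seminorms {R N} k d E.
Arguments Q_seminorms {R N} k d E.

(* The set [A], seen as a type and equipped with the topology determined by
   the set [S] of seminorms.  The seminorm properties are not needed for the
   sets below to form a topology. *)
Definition seminormed {R : realType} {V : zmodType} (A : set V)
  (S : set (V -> \bar R)) : Type := A.

Arguments seminormed {R V} A S.

Section SeminormTopology.
Context {R : realType} {V : zmodType} (A : set V) (S : set (V -> \bar R)).

Definition pdist (p : V -> \bar R) (f g : seminormed A S) : \bar R :=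
  p (\val f - \val g).

Definition seminorm_open (U : set (seminormed A S)) : Prop :=
  forall f, U f -> exists2 s : seq (V -> \bar R), (forall p, p \in s -> S p) &
    exists2 e : R, 0 < e &
      forall g : seminormed A S,
        (forall p, p \in s -> (pdist p g f < e%:E)%E) -> U g.

Lemma seminorm_openT : seminorm_open setT.
Proof. by move=> f _; exists [::] => //; exists 1. Qed.

Lemma seminorm_openI (U W : set (seminormed A S)) :
  seminorm_open U -> seminorm_open W -> seminorm_open (U `&` W).
Proof.
move=> oU oW f [/oU[s sS [e e0 sU]] /oW[t tS [e' e'0 tW]]].
exists (s ++ t) => [p|]; first by rewrite mem_cat => /orP[/sS|/tS].
exists (Num.min e e') => [|g stg]; first by rewrite lt_min e0.
split; [apply: sU => p ps|apply: tW => p pt].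
- by apply: (lt_le_trans (stg p _)); rewrite ?mem_cat ?ps// lee_fin ge_min lexx.
- by apply: (lt_le_trans (stg p _)); rewrite ?mem_cat ?pt ?orbT// lee_fin ge_min lexx orbT.
Qed.

Lemma seminorm_open_bigU (I : Type) (U : I -> set (seminormed A S)) :
  (forall i, seminorm_open (U i)) -> seminorm_open (\bigcup_i U i).
Proof.
move=> oU f [i _ /oU[s sS [e e0 sU]]].
by exists s => //; exists e => // g /sU Ug; exists i.
Qed.

HB.instance Definition _ := Choice.copy (seminormed A S) (set_type A).
HB.instance Definition _ := isOpenTopological.Build (seminormed A S)
  seminorm_openT seminorm_openI seminorm_open_bigU.

(* Completeness: the Cauchy condition is the one of the uniform structure
   given by the seminorms. *)
Definition seminorm_complete : Prop :=
  forall F : set_system (seminormed A S), ProperFilter F ->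
    (forall p, S p -> forall e : R, 0 < e ->
       \forall f & g \near F, (pdist p f g < e%:E)%E) ->
    exists f : seminormed A S, F --> f.

End SeminormTopology.

Arguments seminorm_complete {R V} A S.

Definition CV_tauJ {R : realType} {N : nat} (k : 'I_N) (d : nat)
    (E : set 'rV[R]_N) : topologicalType :=
  seminormed (CV_on k d E) (J_seminorms k d E).

Definition CV_tauQ {R : realType} {N : nat} (k : 'I_N) (d : nat)
    (E : set 'rV[R]_N) : topologicalType :=
  seminormed (CV_on k d E) (Q_seminorms k d E).

(* Main.v *)
Require Import Defs.
From HB Require Import structures.
From mathcomp Require Import all_boot all_order all_algebra.
From mathcomp Require Import -(notations) mpoly.
From mathcomp Require Import all_classical all_reals all_analysis.
From mathcomp Require Import ring lra zify.
Import Order.TTheory GRing.Theory Num.Theory.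
Import numFieldNormedType.Exports.
Set Implicit Arguments.
Unset Strict Implicit.
Unset Printing Implicit Defensive.
Local Open Scope classical_set_scope.
Local Open Scope ring_scope.
#[local] Arguments degp {R N} P%_ring_scope.
#[local] Arguments evalp {R N} P%_ring_scope x.

(** Why the five conditions are equivalent.

    Two approximation theorems link derivatives with distances to polynomials.
    By Bernstein's theorem (gauge_le_partials), the derivatives of a function on
    a box are bounded by a norm of the form sup |f| + sup_l l^nu dist (f, P_l) on
    a larger box; it follows from Markov's inequality on boxes (markov_box), of
    which a crude form is obtained from Chebyshev polynomials. Conversely, by
    Jackson's theorem (jackson), finitely many derivatives of a smooth function
    control such a norm; and as every polynomial agrees on V with one of degree
    less than d in x_k and comparable degree in y (varfun_evalp), Jackson's
    theorem also holds on V for the spaces of the statement (reduction_gauge).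
    Call a function on E rapidly approximable when its distances to these spaces
    decrease rapidly.

    (i) => (ii). Taylor's formula at a point of E: a displacement of size n^-r
    compensates the factors n^r of the derivatives (taylor_box).

    (ii) => (iii). If f is rapidly approximable, let P_l be a near-best
    approximant. The difference P_(l+1) - P_l is small on E, hence by (ii) up to
    a distance of E that is a negative power of l. Written as sum_i H_i(y) x_k^i, it has
    coefficients H_i that are small near the projection of E
    (coordinate_bound). There they are cut off by a function of y whose
    derivatives grow polynomially in l (cutoff), and the resulting series defines
    an extension of f in CV (bernstein_extension).

    (iii) => (iv). The limit of a Cauchy filter is rapidly approximable on E, and
    so is the restriction of a smooth function by Jackson's theorem on V; both
    extend by (iii) (J_complete, CV_on_Cinf).

    (iv) => (iii). The near-best approximants of f form a Cauchy sequence for J,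
    whose limit coincides with f (complete_extension).

    (iii) => (v). The topology J is coarser than Q by Jackson's theorem on V. For
    the converse, (iii) says that restriction to E maps CV onto the rapidly
    approximable functions, and an open mapping theorem provides extensions that
    are bounded in terms of the norms on E (controlled_lift); Bernstein's theorem
    bounds their derivatives.

    (v) => (i). The seminorm q_(E,1) is bounded by a seminorm of J, which on
    polynomials of degree n is at most a power of n times the norm on E. As E is
    determining, all extensions of a polynomial have the same derivatives on E,
    so that this is Markov's inequality for the first derivatives
    (markov_step), and it can be iterated. *)

(** * Chebyshev polynomials and Markov's inequality *)

Section Chebyshev.
Variable R : realType.
Implicit Types (p : {poly R}) (x : R) (n : nat).

(** The pairs (T_n, U_(n-1)), where T_n (cos t) = cos (n t) and
    U_(n-1) (cos t) sin t = sin (n t). *)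
Fixpoint cheb n : {poly R} * {poly R} :=
  if n is m.+1 then
    let: (T, U) := cheb m in ('X * T - (1 - 'X^2) * U, 'X * U + T)
  else (1, 0).

Definition chebT n := (cheb n).1.
Definition chebU n := (cheb n).2.

Lemma chebT0 : chebT 0 = 1. Proof. by []. Qed.

Lemma chebU0 : chebU 0 = 0. Proof. by []. Qed.

Lemma chebTS n : chebT n.+1 = 'X * chebT n - (1 - 'X^2) * chebU n.
Proof. by rewrite /chebT /chebU /=; case: (cheb n). Qed.

Lemma chebUS n : chebU n.+1 = 'X * chebU n + chebT n.
Proof. by rewrite /chebT /chebU /=; case: (cheb n). Qed.

Lemma deriv_cheb n : (chebT n)^`() = n%:R * chebU n /\
  (1 - 'X^2) * (chebU n)^`() = 'X * chebU n - n%:R * chebT n.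
Proof.
elim: n => [|n [T' U']].
  by rewrite /chebT /chebU/= derivC deriv0 !(mulr0, mul0r) subrr.
have dX2 : (1 - 'X^2 : {poly R})^`() = - ('X *+ 2).
  by rewrite derivB derivC derivXn expr1 sub0r.
rewrite chebTS chebUS derivB derivD !derivM dX2 derivX mul1r T' U'.
split; first by rewrite -natr1; ring.
by rewrite !mulrDr [(1 - 'X^2) * ('X * _)]mulrCA U' -natr1; ring.
Qed.

(** The identity cos^2 + sin^2 = 1 as an identity of polynomials: it bounds
    T_n on [-1, 1] without writing x as a cosine. *)
Lemma cheb_pell n x : (chebT n).[x] ^+ 2 + (1 - x ^+ 2) * (chebU n).[x] ^+ 2 = 1.
Proof.
elim: n => [|n ih]; first by rewrite chebT0 chebU0 horner0 hornerC; ring.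
rewrite chebTS chebUS !hornerE/=.
rewrite -[RHS]ih; ring.
Qed.

Lemma chebT_le1 n x : `|x| <= 1 -> `|(chebT n).[x]| <= 1.
Proof.
move=> x1; rewrite -(@ler_pXn2r _ 2)// ?nnegrE// expr1n -normrX ger0_norm ?sqr_ge0//.
rewrite -[leRHS](cheb_pell n x) lerDl mulr_ge0 ?sqr_ge0// subr_ge0.
by rewrite -real_normK ?num_real// expr_le1.
Qed.

Lemma chebU_le n x : `|x| <= 1 -> `|(chebU n).[x]| <= n%:R.
Proof.
move=> x1; elim: n => [|n ih]; first by rewrite /chebU/= horner0 normr0.
rewrite chebUS !hornerE (le_trans (ler_normD _ _))// -natr1 lerD ?chebT_le1//.
by rewrite normrM (le_trans _ ih)// ler_piMl.
Qed.

Lemma deriv_chebT_le n x : `|x| <= 1 -> `|(chebT n)^`().[x]| <= n%:R ^+ 2.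
Proof.
move=> x1; rewrite (deriv_cheb n).1 -polyC_natr hornerM hornerC normrM normr_nat expr2.
by rewrite ler_wpM2l ?ler0n// chebU_le.
Qed.

Lemma cheb_cos n (t : R) : (chebT n).[cos t] = cos (n%:R * t) /\
  (chebU n).[cos t] * sin t = sin (n%:R * t).
Proof.
elim: n => [|n [hT hU]].
  by rewrite chebT0 chebU0 horner0 hornerC !mul0r cos0 sin0.
have -> : n.+1%:R * t = n%:R * t + t by rewrite -natr1; ring.
rewrite chebTS chebUS sinD cosD -hT -hU !hornerE/=.
by split; last ring; rewrite -sin2cos2; ring.
Qed.

Lemma mulX_chebT n : 'X * chebT n.+1 = 2^-1 *: chebT n.+2 + 2^-1 *: chebT n.
Proof.
have e : (2 : R) *: ('X * chebT n.+1) = chebT n.+2 + chebT n.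
  by rewrite scaler_nat !chebTS chebUS; ring.
by rewrite -scalerDr -e scalerA mulVf ?pnatr_eq0// scale1r.
Qed.

Lemma cheb_span n p : (size p <= n)%N ->
  exists a : nat -> R, p = \sum_(j < n) a j *: chebT j.
Proof.
pose S n p := exists a : nat -> R, p = \sum_(j < n) a j *: chebT j.
have SD m p1 p2 : S m p1 -> S m p2 -> S m (p1 + p2).
  move=> [a ->] [b ->]; exists (fun j => a j + b j).
  by rewrite -big_split/=; apply: eq_bigr => j _; rewrite scalerDl.
have SZ m c p1 : S m p1 -> S m (c *: p1).
  move=> [a ->]; exists (fun j => c * a j).
  by rewrite scaler_sumr; apply: eq_bigr => j _; rewrite scalerA.
have ST m j : (j < m)%N -> S m (chebT j).
  move=> jm; exists (fun i => (i == j)%:R).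
  rewrite (bigD1 (Ordinal jm))//= eqxx scale1r big1 ?addr0// => i ij.
  by rewrite (_ : (val i == j) = false) ?scale0r//; apply/negbTE.
have SX m p1 : S m p1 -> S m.+1 ('X * p1).
  move=> [a ->]; rewrite mulr_sumr.
  apply: (big_ind (S m.+1)); [|exact: SD|].
    by exists (fun=> 0); rewrite big1// => j _; rewrite scale0r.
  move=> [[|j] jm] _ /=; rewrite -scalerAr; apply: (SZ _ (a _)).
    have -> : 'X * chebT 0 = chebT 1.
      by rewrite chebTS /chebU/= mulr0 subr0.
    exact: ST.
  rewrite mulX_chebT; apply: SD; apply: (SZ _ _ _ (ST _ _ _)) => //.
  by rewrite ltnW// ltnW.
elim: n p => [p|n ih p].
  by rewrite leqn0 size_poly_eq0 => /eqP ->; exists (fun=> 0); rewrite big_ord0.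
elim/poly_ind: p => [_|q c _ sz].
  by exists (fun=> 0); rewrite big1// => j _; rewrite scale0r.
have sq : (size q <= n)%N.
  move: sz; rewrite size_MXaddC; case: ifP => [/andP[/eqP -> _]|_ //].
  by rewrite size_poly0.
apply: SD; first by rewrite mulrC; apply/SX/ih.
have -> : c%:P = c *: chebT 0 by rewrite /chebT/= alg_polyC.
exact/SZ/ST.
Qed.

(** The angles of the zeros of T_(n+1). *)
Definition chebpt n i : R := (2 * i%:R + 1) * (pi / (2 * n.+1%:R)).

Lemma sum_cos_odd n (t : R) :
  2 * sin t * \sum_(i < n) cos ((2 * i%:R + 1) * t) = sin (2 * n%:R * t).
Proof.
elim: n => [|n ih]; first by rewrite big_ord0 !(mulr0,mul0r) sin0.
rewrite big_ord_recr/= mulrDr ih -[n.+1%:R]natr1.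
have -> : 2 * (n%:R + 1) * t = (2 * n%:R + 1) * t + t by ring.
have -> : 2 * n%:R * t = (2 * n%:R + 1) * t - t by ring.
rewrite sinB sinD; ring.
Qed.

Lemma sin_nat_pi n : sin (n%:R * pi) = 0 :> R.
Proof.
elim: n => [|n ih]; first by rewrite mul0r sin0.
by rewrite -natr1 mulrDl mul1r sinD ih sinpi mulr0 mul0r addr0.
Qed.

Lemma sum_cos_chebpt n j : (0 < j < 2 * n.+1)%N ->
  \sum_(i < n.+1) cos (j%:R * chebpt n i) = 0.
Proof.
move=> /andP[j0 jn]; pose t : R := j%:R * (pi / (2 * n.+1%:R)).
have n0 : (0 : R) < 2 * n.+1%:R by rewrite mulr_gt0// ltr0n.
have st : sin t > 0.
  apply: sin_gt0_pi; rewrite /t mulr_gt0 ?ltr0n//=; last by rewrite divr_gt0// pi_gt0.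
  rewrite mulrCA -[ltRHS]mulr1 ltr_pM2l ?pi_gt0// ltr_pdivrMr// mul1r.
  by rewrite -natrM ltr_nat.
have /eqP := sum_cos_odd n.+1 t.
have -> : 2 * n.+1%:R * t = j%:R * pi.
  by rewrite /t; field; rewrite ?pnatr_eq0// nat1r pnatr_eq0.
rewrite sin_nat_pi !mulf_eq0 pnatr_eq0/= (gt_eqF st)/= => /eqP sum0.
rewrite -[RHS]sum0; apply: eq_bigr => i _; congr cos; rewrite /t /chebpt; ring.
Qed.

(** Discrete orthogonality: in the basis of the T_j, the coefficients of a
    polynomial are twice the means over the nodes of its values times cosines, so
    that they are bounded by its norm. *)
Lemma cheb_orth n j l : (j <= n)%N -> (0 < l <= n)%N ->
  \sum_(i < n.+1) (chebT j).[cos (chebpt n i)] * cos (l%:R * chebpt n i) =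
    if j == l then n.+1%:R / 2 else 0.
Proof.
move=> jn /andP[l0 ln].
have -> : \sum_(i < n.+1) (chebT j).[cos (chebpt n i)] * cos (l%:R * chebpt n i)
    = 2^-1 * (\sum_(i < n.+1) cos ((j + l)%:R * chebpt n i)
            + \sum_(i < n.+1) cos ((maxn j l - minn j l)%:R * chebpt n i)).
  rewrite -big_split/= mulr_sumr; apply: eq_bigr => i _.
  have mm : (minn j l <= maxn j l)%N by rewrite (leq_trans (geq_minl _ _) (leq_maxl _ _)).
  rewrite (cheb_cos _ _).1 (natrB _ mm) natrD.
  rewrite maxnC minnC; case: (leqP j l) => _; rewrite mulrBl mulrDl cosB cosD; field => //.
rewrite sum_cos_chebpt ?add0r; last first.
  by rewrite addn_gt0 l0 orbT/= mul2n -addnn -addSn leq_add// ltnW.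
have [->|jl] := eqVneq j l.
  rewrite maxnn minnn subnn (eq_bigr (fun=> 1)) => [|i _]; last by rewrite mul0r cos0.
  by rewrite sumr_const card_ord mulrC.
rewrite sum_cos_chebpt ?mulr0//.
move: jl; rewrite neq_ltn => /orP[] jl;
  rewrite ?(maxn_idPr (ltnW jl)) ?(minn_idPl (ltnW jl)) ?(maxn_idPl (ltnW jl)) ?(minn_idPr (ltnW jl)) subn_gt0 jl/=.
  by rewrite (leq_ltn_trans (leq_subr _ _))// mul2n -addnn ltn_addl// ltnS.
by rewrite (leq_ltn_trans (leq_subr _ _))// mul2n -addnn ltn_addl// ltnS.
Qed.

(** Each of the n derivatives T_j' is at most n^2, and each coefficient at
    most 2 A. The classical exponent is 2; here every power of the degree is as
    good as another. *)
Lemma markov_unit n p (A : R) : (size p <= n.+1)%N ->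
  (forall x, `|x| <= 1 -> `|p.[x]| <= A) ->
  forall x, `|x| <= 1 -> `|p^`().[x]| <= 2 * n%:R ^+ 3 * A.
Proof.
move=> sp pA x x1; have [a pE] := cheb_span sp.
have A0 : 0 <= A by apply: le_trans (pA 0 _); rewrite ?normr0.
have aA l : (0 < l <= n)%N -> `|a l| <= 2 * A.
  move=> ln.
  have : \sum_(i < n.+1) p.[cos (chebpt n i)] * cos (l%:R * chebpt n i) = a l * (n.+1%:R / 2).
    rewrite pE (eq_bigr (fun i : 'I_n.+1 => \sum_(j < n.+1) a j *
        ((chebT j).[cos (chebpt n i)] * cos (l%:R * chebpt n i)))); last first.
      move=> i _; rewrite hornerE horner_sum mulr_suml; apply: eq_bigr => j _.
      by rewrite hornerZ mulrA.
    rewrite exchange_big/=; case/andP: (ln) => l0 ln'.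
    rewrite (bigD1 (Ordinal (ln' : (l < n.+1)%N)))//= [X in _ + X]big1 ?addr0.
      by rewrite -mulr_sumr cheb_orth// eqxx.
    move=> j jl; rewrite -mulr_sumr cheb_orth//; last by rewrite -ltnS.
    by rewrite (_ : (val j == l) = false) ?mulr0//; apply/negbTE.
  move=> /(congr1 Num.norm); rewrite normrM [`|n.+1%:R / 2|]ger0_norm ?divr_ge0// => e.
  have : `|a l| * (n.+1%:R / 2) <= n.+1%:R * A.
    rewrite -e (le_trans (ler_norm_sum _ _ _))//.
    have -> : n.+1%:R * A = \sum_(i < n.+1) A by rewrite sumr_const card_ord mulr_natl.
    apply: ler_sum => i _; rewrite normrM -[leRHS]mulr1.
    by apply: ler_pM; rewrite ?cos_max// pA// cos_max.
  rewrite mulrCA ler_pM2l ?ltr0n// ler_pdivrMr// mulrC; lra.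
rewrite pE raddf_sum horner_sum (le_trans (ler_norm_sum _ _ _))//.
rewrite big_ord_recl/= derivZ hornerZ normrM chebT0 derivC horner0 normr0 mulr0 add0r.
have -> : 2 * n%:R ^+ 3 * A = \sum_(i < n) (2 * A) * n%:R ^+ 2.
  by rewrite sumr_const card_ord -[RHS]mulr_natl exprS; ring.
apply: ler_sum => i _; rewrite derivZ hornerZ normrM.
apply: ler_pM => //; first by apply: aA; rewrite /= /bump/= add1n ltn_ord.
rewrite (le_trans (deriv_chebT_le _ x1))// lerXn2r ?nnegrE ?ler0n// ler_nat.
by rewrite /bump/= add1n.
Qed.

Lemma markov_poly n p (A t0 h : R) : 0 < h -> (size p <= n.+1)%N ->
  (forall t, `|t - t0| <= h -> `|p.[t]| <= A) ->
  forall t, `|t - t0| <= h -> `|p^`().[t]| <= 2 * n%:R ^+ 3 / h * A.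
Proof.
move=> h0 sp pA t tt0; pose q := p \Po (h *: 'X + t0%:P).
have qE x : q.[x] = p.[h * x + t0] by rewrite horner_comp !hornerE.
have q'E x : q^`().[x] = p^`().[h * x + t0] * h.
  by rewrite deriv_comp !hornerE horner_comp derivD derivZ derivX derivC !hornerE.
have sq : (size q <= n.+1)%N.
  have [p0|p0] := eqVneq p 0; first by rewrite /q p0 comp_poly0 size_poly0.
  have s2 : (size (h *: 'X + t0%:P)%R <= 2)%N.
    rewrite (leq_trans (size_polyD _ _))// geq_max (leq_trans (size_scale_leq _ _)) ?size_polyX//.
    by rewrite (leq_trans (size_polyC_leq1 _)).
  have := size_comp_poly_leq p (h *: 'X + t0%:P).
  move=> /leq_trans; apply; rewrite ltnS (leq_trans (leq_mul (leqnn _) (_ : _ <= 1)%N))//.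
    by rewrite -subn1 leq_subLR.
  by rewrite muln1 -ltnS prednK// lt0n size_poly_eq0.
have qA x : `|x| <= 1 -> `|q.[x]| <= A.
  move=> x1; rewrite qE pA// addrK normrM gtr0_norm//.
  by rewrite -[leRHS]mulr1 ler_pM2l.
have := @markov_unit n q A sq qA ((t - t0) / h).
rewrite normrM normfV (gtr0_norm h0) ler_pdivrMr// mul1r => /(_ tt0).
rewrite q'E (mulrC h) divfK ?gt_eqF// subrK normrM (gtr0_norm h0) -ler_pdivlMr//.
by rewrite mulrAC.
Qed.

End Chebyshev.

(** * Polynomials in several variables along coordinate lines *)

Section OneVariable.
Variable R : realType.

Lemma lipschitz_derive (g dg : R -> R) (t0 h L : R) :
  (forall t, `|t - t0| <= h -> is_derive t 1 g (dg t)) ->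
  (forall t, `|t - t0| <= h -> `|dg t| <= L) ->
  forall s t, `|s - t0| <= h -> `|t - t0| <= h -> `|g t - g s| <= L * `|t - s|.
Proof.
move=> gd dL.
have main s t : s < t -> `|s - t0| <= h -> `|t - t0| <= h -> `|g t - g s| <= L * `|t - s|.
  move=> st hs ht.
  have inI u : s <= u <= t -> `|u - t0| <= h.
    by move: hs ht; rewrite !ler_distl => /andP[s1 s2] /andP[t1 t2] /andP[su ut]; apply/andP; split; lra.
  have [||c cst ->] := @MVT R g dg s t st.
  - by move=> u; rewrite in_itv/= => /andP[su ut]; apply/gd/inI; rewrite !ltW.
  - apply: derivable_within_continuous => u; rewrite in_itv/= => /inI/gd [] //.
  - rewrite normrM ler_wpM2r//; apply/dL/inI.
    by move: cst; rewrite in_itv/= => /andP[? ?]; rewrite !ltW.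
move=> s t hs ht; have [st|ts|->] := ltgtP s t; first exact: main.
  by rewrite distrC [`|t - s|]distrC; apply: main.
by rewrite !subrr normr0 mulr0.
Qed.

End OneVariable.

Section MpolyDegree.
Variables (R : realType) (n : nat).
Implicit Types (P : mpoly n R) (x : 'rV[R]_n) (i : 'I_n).

Lemma degp_leP P m : reflect (forall a, a \in msupp P -> (mdeg a <= m)%N) (degp P <= m)%N.
Proof.
apply: (iffP (bigmax_leqP_seq _ _ _ _)) => H a aP; first exact: H.
by move=> _; exact: H.
Qed.

Lemma degp_msize P m : (degp P <= m)%N = (mmeasure mdeg P <= m.+1)%N.
Proof.
rewrite mmeasureE; apply/degp_leP/bigmax_leqP_seq => [H a aP _|H a aP]; first exact: H.
by have := H a aP isT.
Qed.

Lemma degpD P Q m : (degp P <= m)%N -> (degp Q <= m)%N -> (degp (P + Q) <= m)%N.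
Proof.
rewrite !degp_msize => hP hQ; apply: (leq_trans (msizeD_le _ _)).
by rewrite geq_max hP.
Qed.

Lemma degpZ c P m : (degp P <= m)%N -> (degp (c *: P) <= m)%N.
Proof. by rewrite !degp_msize; apply/leq_trans/msizeZ_le. Qed.

Lemma degpN P m : (degp P <= m)%N -> (degp (- P) <= m)%N.
Proof. by rewrite !degp_msize msizeN. Qed.

Lemma degpB P Q m : (degp P <= m)%N -> (degp Q <= m)%N -> (degp (P - Q) <= m)%N.
Proof. by move=> hP hQ; apply/degpD/degpN. Qed.

Lemma degpC c m : (degp (mpolyC n c : mpoly n R) <= m)%N.
Proof. by rewrite degp_msize msizeC (leq_trans (leq_b1 _)). Qed.

Lemma degp0 m : (degp (0 : mpoly n R) <= m)%N.
Proof. by rewrite -mpolyC0 degpC. Qed.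

Lemma degp_sum (I : Type) (r : seq I) (p : pred I) (F : I -> mpoly n R) m :
  (forall j, p j -> (degp (F j) <= m)%N) -> (degp (\sum_(i <- r | p i) F i) <= m)%N.
Proof. by move=> H; apply: (big_ind (fun P => (degp P <= m)%N)) => //; [exact: degp0|move=> *; exact: degpD]. Qed.

Lemma degpM P Q a b : (degp P <= a)%N -> (degp Q <= b)%N -> (degp (P * Q) <= a + b)%N.
Proof.
move=> /degp_leP hP /degp_leP hQ; apply/degp_leP => m /msuppM_le /allpairsP[[u v]/= [uP vQ ->]].
by rewrite mdegD leq_add ?hP ?hQ.
Qed.

Lemma degpX (a : multinom n) m : (mdeg a <= m)%N -> (degp (mpolyX R a) <= m)%N.
Proof. by rewrite degp_msize msizeX ltnS. Qed.

Lemma degp_exp P a k : (degp P <= a)%N -> (degp (P ^+ k) <= k * a)%N.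
Proof.
move=> hP; elim: k => [|k ih]; first by rewrite expr0 -mpolyC1 degpC.
by rewrite exprS mulSn degpM.
Qed.

Lemma degp_mderiv i P m : (degp P <= m)%N -> (degp (mderiv i P) <= m.-1)%N.
Proof.
move=> /degp_leP hP; apply/degp_leP => a.
rewrite mcoeff_msupp mcoeff_deriv => aP.
have : mnm_add a (mnm1 i) \in msupp P.
  by rewrite mcoeff_msupp; apply: contra aP => /eqP ->; rewrite mul0rn.
by move=> /hP; rewrite mdegD mdeg1 addn1; case: m {hP}.
Qed.

Lemma mderiv_degp0 i P : (degp P <= 0)%N -> mderiv i P = 0.
Proof.
rewrite degp_msize => /msize1_polyC ->; exact: mderivC.
Qed.

Lemma evalpD P Q x : evalp (P + Q) x = evalp P x + evalp Q x.
Proof. exact: mevalD. Qed.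

Lemma evalpB P Q x : evalp (P - Q) x = evalp P x - evalp Q x.
Proof. exact: mevalB. Qed.

Lemma evalpZ c P x : evalp (c *: P) x = c * evalp P x.
Proof. exact: mevalZ. Qed.

Lemma evalpM P Q x : evalp (P * Q) x = evalp P x * evalp Q x.
Proof. exact: mevalM. Qed.

Lemma evalpC c x : evalp (mpolyC n c) x = c.
Proof. exact: mevalC. Qed.

Lemma evalp0 x : evalp 0 x = 0.
Proof. exact: meval0. Qed.

Lemma evalpX i x : evalp (mpolyX R (mnm1 i)) x = x 0 i.
Proof. exact: mevalXU. Qed.

Lemma evalpXn P k x : evalp (P ^+ k) x = evalp P x ^+ k.
Proof.
elim: k => [|k ih]; first by rewrite !expr0 -mpolyC1 evalpC.
by rewrite !exprS evalpM ih.
Qed.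

Lemma evalp_sum (I : Type) (r : seq I) (p : pred I) (F : I -> mpoly n R) x :
  evalp (\sum_(j <- r | p j) F j) x = \sum_(j <- r | p j) evalp (F j) x.
Proof. by apply: (big_morph (fun P => evalp P x)) => [P Q|]; rewrite ?evalpD ?evalp0. Qed.

End MpolyDegree.

Section Lines.
Variables (R : realType) (n : nat).
Implicit Types (P : mpoly n R) (x : 'rV[R]_n) (i : 'I_n).

Definition setc x i (t : R) : 'rV[R]_n := \row_j if j == i then t else x 0 j.

Lemma setcE x i t j : setc x i t 0 j = if j == i then t else x 0 j.
Proof. by rewrite mxE. Qed.

Lemma setc_id x i : setc x i (x 0 i) = x.
Proof. by apply/rowP => j; rewrite setcE; case: eqP => // ->. Qed.

Lemma setc_setc x i s t : setc (setc x i s) i t = setc x i t.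
Proof. by apply/rowP => j; rewrite !setcE; case: eqP. Qed.

Lemma setc_shift x i h : h *: 'e_i + x = setc x i (h + x 0 i).
Proof.
apply/rowP => j; rewrite setcE !mxE/=; case: eqP => [->|_]; first by rewrite mulr1.
by rewrite mulr0 add0r.
Qed.

(** The restriction of P to the line through x parallel to the i-th axis, as a
    polynomial in the i-th coordinate. *)
Definition linep x i P : {poly R} :=
  mmap polyC (fun j => if j == i then 'X else (x 0 j)%:P) P.

Lemma linepX x i (m : multinom n) :
  linep x i (mpolyX R m) = (\prod_(j < n | j != i) x 0 j ^+ m j)%:P * 'X^(m i).
Proof.
rewrite /linep mmapX /mmap1 (bigD1 i)//= eqxx mulrC; congr (_ * _).
rewrite rmorph_prod; apply: eq_bigr => j /negbTE ->.
by rewrite rmorphXn.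
Qed.

Lemma linep_sum x i P :
  linep x i P = \sum_(m <- msupp P) mcoeff m P *: linep x i (mpolyX R m).
Proof.
rewrite /linep {1}/mmap; apply: eq_bigr => m _.
by rewrite mmapX mul_polyC.
Qed.

Lemma linepE x i t P : (linep x i P).[t] = evalp P (setc x i t).
Proof.
rewrite linep_sum horner_sum /evalp mevalE; apply: eq_bigr => m _.
rewrite hornerZ linepX hornerM hornerC hornerXn [in RHS](bigD1 i)//= setcE eqxx; congr (_ * _).
by rewrite mulrC; congr (_ * _); apply: eq_bigr => j /negbTE ji; rewrite setcE ji.
Qed.

Lemma size_linep x i P m : (degp P <= m)%N -> (size (linep x i P) <= m.+1)%N.
Proof.
move=> /degp_leP hP; rewrite linep_sum big_seq.
apply: (leq_trans (size_sum _ _ _)); apply/bigmax_leqP_seq => a _ aP.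
rewrite (leq_trans (size_scale_leq _ _))// linepX (leq_trans (size_polyMleq _ _))//.
rewrite size_polyXn addnS/= (leq_trans (leq_add (size_polyC_leq1 _) (leqnn _)))// add1n ltnS.
by rewrite (leq_trans _ (hP _ aP))// mdegE (bigD1 i)//= leq_addr.
Qed.

Lemma deriv_linep x i P : (linep x i P)^`() = linep x i (mderiv i P).
Proof.
elim/mpolyind: P => [|c m P mP c0 ih].
  by rewrite mderiv0 /linep mmap0 deriv0.
have lD P1 P2 : linep x i (P1 + P2) = linep x i P1 + linep x i P2 by exact: mmapD.
have lZ b P1 : linep x i (b *: P1) = b *: linep x i P1 by rewrite /linep mmapZ mul_polyC.
rewrite mderivD mderivZ mderivX !lD derivD ih !lZ derivZ; congr (_ *: _ + _).
rewrite !linepX derivM derivC mul0r add0r derivXn -[X in _ * X]scaler_nat -scalerAr.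
congr (_ *: (_%:P * 'X^_)).
  apply: eq_bigr => j ji; rewrite mnmBE mnm1E eq_sym (negbTE ji) subn0//.
by rewrite mnmBE mnm1E eqxx subn1.
Qed.

(** Partial derivatives are ordinary derivatives along such lines, because the
    difference quotients are the same functions. *)
Lemma line_quotient (f : 'rV[R]_n -> R) x i :
  (fun h : R => h^-1 *: ((f \o shift x) (h *: 'e_i) - f x)) =
  (fun h : R => h^-1 *: (((fun t => f (setc x i t)) \o shift (x 0 i)) (h *: 1) - f (setc x i (x 0 i)))).
Proof.
by apply/funext => h /=; rewrite setc_shift setc_id scaler1.
Qed.

Lemma derivable_line (f : 'rV[R]_n -> R) x i :
  derivable f x 'e_i <-> derivable (fun t => f (setc x i t)) (x 0 i) 1.
Proof. by rewrite /derivable line_quotient. Qed.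

Lemma derive_line (f : 'rV[R]_n -> R) x i :
  'D_'e_i f x = 'D_1 (fun t => f (setc x i t)) (x 0 i).
Proof. by rewrite /derive line_quotient. Qed.

Lemma is_derive_line (f : 'rV[R]_n -> R) x i t : derivable f (setc x i t) 'e_i ->
  is_derive t 1 (fun t => f (setc x i t)) ('D_'e_i f (setc x i t)).
Proof.
move=> fx; have ft : (setc x i t) 0 i = t by rewrite setcE eqxx.
have fe : (fun s => f (setc (setc x i t) i s)) = (fun s => f (setc x i s)).
  by apply/funext => s; rewrite setc_setc.
apply: DeriveDef; last by rewrite derive_line fe ft.
by move/derivable_line : fx; rewrite fe ft.
Qed.

Lemma derivable_evalp P x i : derivable (evalp P) x 'e_i.
Proof.
apply/derivable_line; rewrite (_ : (fun t => _) = horner (linep x i P)).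
  exact: derivable_horner.
by apply/funext => t; rewrite linepE.
Qed.

Lemma derive_evalp P i : 'D_'e_i (evalp P) = evalp (mderiv i P).
Proof.
apply/funext => x; rewrite derive_line (_ : (fun t => _) = horner (linep x i P)); last first.
  by apply/funext => t; rewrite linepE.
by rewrite derive_val deriv_linep linepE setc_id.
Qed.

Lemma derive_evalp_at P i x : 'D_'e_i (evalp P) x = evalp (mderiv i P) x.
Proof. by rewrite -derive_evalp. Qed.

Definition mderivs (s : seq 'I_n) P := foldr (@mderiv n R) P s.

Lemma partials_evalp s P : partials s (evalp P) = evalp (mderivs s P).
Proof.
elim: s => [//|i s ih] /=; rewrite /partials/= -/(partials s _) ih.
exact: derive_evalp.
Qed.

Lemma degp_mderivs s P m : (degp P <= m)%N -> (degp (mderivs s P) <= m - size s)%N.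
Proof.
move=> hP; elim: s => [|i s ih]; first by rewrite subn0.
by rewrite /= subnS; apply: degp_mderiv.
Qed.

Lemma degp_mderivs_le s P m : (degp P <= m)%N -> (degp (mderivs s P) <= m)%N.
Proof. by move=> /(degp_mderivs s) /leq_trans; apply; rewrite leq_subr. Qed.

Definition box (z : 'rV[R]_n) (h : R) : set 'rV[R]_n :=
  [set x : 'rV[R]_n | forall i, `|x 0 i - z 0 i| <= h].

Lemma box_setc z h x i t : box z h x -> `|t - z 0 i| <= h -> box z h (setc x i t).
Proof. by move=> hx ht j; rewrite setcE; case: eqP => [->|]. Qed.

Lemma box_center z h : 0 <= h -> box z h z.
Proof. by move=> h0 i; rewrite subrr normr0. Qed.

Lemma lipschitz_line (f : 'rV[R]_n -> R) (z : 'rV[R]_n) (h L : R) i :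
  (forall x, box z h x -> derivable f x 'e_i) ->
  (forall x, box z h x -> `|'D_'e_i f x| <= L) ->
  forall x s t, box z h x -> `|s - z 0 i| <= h -> `|t - z 0 i| <= h ->
  `|f (setc x i t) - f (setc x i s)| <= L * `|t - s|.
Proof.
move=> fd fL x s t zx hs ht.
apply: (@lipschitz_derive _ (fun t => f (setc x i t)) (fun t => 'D_'e_i f (setc x i t)) (z 0 i) h) => // u hu.
  exact/is_derive_line/fd/box_setc.
exact/fL/box_setc.
Qed.

Lemma markov_box m P (A : R) z h i : 0 < h -> (degp P <= m)%N ->
  (forall x, box z h x -> `|evalp P x| <= A) ->
  forall x, box z h x -> `|evalp (mderiv i P) x| <= 2 * m%:R ^+ 3 / h * A.
Proof.
move=> h0 Pm PA x zx.
have := @markov_poly R m (linep x i P) A (z 0 i) h h0 (size_linep _ _ Pm) _ (x 0 i) (zx i).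
rewrite deriv_linep linepE setc_id; apply => t tz.
by rewrite linepE; apply/PA/box_setc.
Qed.

Lemma markov_box_iter m P (A : R) z h s : 0 < h -> (degp P <= m)%N ->
  (forall x, box z h x -> `|evalp P x| <= A) ->
  forall x, box z h x -> `|evalp (mderivs s P) x| <= (2 * m%:R ^+ 3 / h) ^+ size s * A.
Proof.
move=> h0 Pm PA; elim: s => [|i s ih] x zx; first by rewrite mul1r; exact: PA.
have := markov_box i h0 (degp_mderivs_le s Pm) ih zx.
by set K := 2 * m%:R ^+ 3 / h => /le_trans; apply; rewrite /= exprS mulrA.
Qed.

End Lines.

(** * Bernstein's theorem: rapidly approximable functions are smooth *)

Section Limits.
Variable R : realType.

Lemma small_quotient (C eps : R) : 0 < eps -> exists2 n, (0 < n)%N & C / n%:R <= eps.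
Proof.
move=> eps0; have := archi_boundP (divr_ge0 (normr_ge0 C) (ltW eps0)).
set n := Num.bound _ => nC; exists n.+1 => //.
rewrite ler_pdivrMr ?ltr0n// mulrC -ler_pdivrMr//.
rewrite (le_trans (ler_norm _))// normrM normfV (gtr0_norm eps0).
by rewrite (le_trans (ltW nC))// ler_nat.
Qed.

Lemma cauchy_lim (u e : nat -> R) N :
  (forall n m, (N <= n)%N -> (n <= m)%N -> `|u m - u n| <= e n) ->
  (forall eps, 0 < eps -> exists2 n, (N <= n)%N & e n <= eps) ->
  exists l, forall n, (N <= n)%N -> `|u n - l| <= e n.
Proof.
move=> uc e0.
have cu : cvg (u @ \oo).
  apply: cauchy_cvg; apply: cauchy_exP => eps eps0.
  have [n Nn en] := e0 (eps / 2) (divr_gt0 eps0 (ltr0Sn _ _)).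
  exists (u n); exists n => // m /= nm.
  rewrite /ball/= distrC (le_lt_trans (uc _ _ Nn nm))// (le_lt_trans en)//.
  by rewrite ltr_pdivrMr// ltr_pMr// ltr1n.
exists (lim (u @ \oo)) => n Nn; apply/ler_addgt0Pr => eps eps0.
have /cvgrPdist_le/(_ _ eps0)[M _ Mu] := cu.
have := Mu (maxn M n) (leq_maxl _ _); rewrite distrC => h.
rewrite -(subrK (u (maxn M n)) (u n)) -addrA (le_trans (ler_normD _ _))// lerD//.
by rewrite distrC uc// leq_maxr.
Qed.

(** A criterion for limits of differentiable functions: G is compared with
    functions p whose derivative at t0 is close to l and whose increments there
    differ from those of G by a small multiple of the increment of the variable. *)
Lemma is_derive_approx (G : R -> R) (t0 l : R) :
  (forall eps, 0 < eps -> exists p p', [/\ is_derive t0 1 p p', `|p' - l| <= eps &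
     exists2 h, 0 < h & forall t, `|t| <= h ->
       `|(G (t0 + t) - G t0) - (p (t0 + t) - p t0)| <= eps * `|t|]) ->
  is_derive t0 1 G l.
Proof.
move=> H.
have main : (fun h => h^-1 *: ((G \o shift t0) (h *: (1 : R)) - G t0)) @ 0^' --> l.
  apply/cvgrPdist_le => eps eps0.
  have e3 : 0 < eps / 3 by rewrite divr_gt0.
  have [p [p' [[dp dpE] pl [h h0 hG]]]] := H _ e3.
  have pcvg : (fun h => h^-1 *: ((p \o shift t0) (h *: (1 : R)) - p t0)) @ 0^' --> p'.
    by rewrite -dpE; exact: dp.
  move/cvgrPdist_le : pcvg => /(_ _ e3) pcvg.
  near=> t.
  have tE : t *: (1 : R) = t by rewrite -[LHS]/(t * 1) mulr1.
  have t0' : t != 0 by near: t; exact: nbhs_dnbhs_neq.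
  have th : `|t| <= h by near: t; exact: dnbhs0_le.
  have /= pt : `|p' - t^-1 *: ((p \o shift t0) (t *: (1 : R)) - p t0)| <= eps / 3.
    by near: t.
  rewrite /= tE -[_ *: _]/(_ * _) in pt; rewrite /= tE -[_ *: _]/(_ * _).
  have Gt : `|t^-1 * (G (t + t0) - G t0) - t^-1 * (p (t + t0) - p t0)| <= eps / 3.
    rewrite -mulrBr normrM normfV mulrC ler_pdivrMr ?normr_gt0// ![t + _]addrC.
    exact: hG.
  rewrite distrC; set a := _^-1 * _ in Gt *; set b := t^-1 * _ in pt Gt.
  have -> : a - l = (a - b) + ((p' - l) - (p' - b)) by ring.
  rewrite (le_trans (ler_normD _ _))// (le_trans (lerD Gt (ler_normB _ _)))//.
  rewrite (le_trans (lerD (lexx _) (lerD pl pt)))//; lra.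
apply: DeriveDef; first by apply/cvg_ex; exists l.
exact: cvg_lim main.
Unshelve. all: by end_near. Qed.

End Limits.

Section Continuity.
Variables (R : realType) (n : nat).
Implicit Types (P : mpoly n R) (x y : 'rV[R]_n).

Lemma continuous_boxP (f : 'rV[R]_n -> R) : continuous f <->
  forall x eps, 0 < eps -> exists2 h, 0 < h & forall y, box x h y -> `|f x - f y| <= eps.
Proof.
split=> [fc x eps eps0|H x].
  have /cvgrPdist_le/(_ _ eps0) := fc x.
  move=> /nbhs_ballP[h /= h0 hf]; exists (h / 2); first by rewrite divr_gt0.
  move=> y xy; apply: hf; split => // i j.
  by rewrite ord1 /ball/= distrC (le_lt_trans (xy _))// ltr_pdivrMr// ltr_pMr// ltr1n.
apply: (cvgrPdist_le (F := nbhs (x : 'rV[R]_n)) f (f x)).2 => eps eps0.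
have [h h0 hf] := H x eps eps0.
apply/nbhs_ballP; exists h => // y [_ xy]; apply: hf => i.
by rewrite distrC ltW//; exact: xy.
Qed.

Lemma continuous_evalp P : continuous (evalp P).
Proof.
rewrite (_ : evalp P = fun x => \sum_(m <- msupp P) mcoeff m P * \prod_i x 0 i ^+ m i).
  apply: continuous_big => [|m _]; first exact: add_continuous.
  have Xc : continuous (fun x : 'rV[R]_n => \prod_i x 0 i ^+ m i).
    apply: continuous_big => [|i _]; first exact: mul_continuous.
    move=> x; apply: (@continuous_comp _ _ _ (fun x : 'rV[R]_n => x 0 i) (fun t : R => t ^+ m i)).
      exact: coord_continuous.
    exact: exprn_continuous.
  by move=> x; apply: continuousM; [exact: cst_continuous|exact: Xc].
by apply/funext => x; rewrite /evalp mevalE.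
Qed.

End Continuity.

Section Smooth.
Variables (R : realType) (n : nat).
Implicit Types (f g : 'rV[R]_n -> R).

(** A family stable under the first order partial derivatives consists of
    smooth functions as soon as its members are continuous and derivable:
    this avoids any induction on the order of the derivatives. *)
Lemma smooth_family (S : set ('rV[R]_n -> R)) :
  (forall f, S f -> continuous f /\
     forall i, (forall x, derivable f x 'e_i) /\ S (fun x => 'D_'e_i f x)) ->
  forall f, S f -> smooth f.
Proof.
move=> SD f Sf s.
have Ss : S (partials s f) by elim: s => [//|i s ih]; exact: ((SD _ ih).2 i).2.
by split; [exact: (SD _ Ss).1|move=> i x; exact: ((SD _ Ss).2 i).1].
Qed.

Lemma partials_cat s1 s2 f : partials (s1 ++ s2) f = partials s1 (partials s2 f).
Proof. exact: foldr_cat. Qed.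

Lemma smooth_partials s f : smooth f -> smooth (partials s f).
Proof. by move=> sf s'; rewrite -partials_cat. Qed.

Lemma smooth_evalp P : smooth (@evalp R n P).
Proof.
move=> s; rewrite partials_evalp; split; first exact: continuous_evalp.
by move=> i x; exact: derivable_evalp.
Qed.

End Smooth.

Section Bernstein.
Variables (R : realType) (N c : nat).
Implicit Types (g : 'rV[R]_N -> R) (A : R).

(** The factor c leaves room for polynomials of degree n + d, where only the
    degree n in the variables y is counted. *)
Definition approx (K : set 'rV[R]_N) n (a : R) g :=
  exists2 P : mpoly N R, (degp P <= c * n)%N & forall x, K x -> `|g x - evalp P x| <= a.

Definition rapid K r A g := (forall x, K x -> `|g x| <= A) /\
  forall n, (0 < n)%N -> approx K n (A / n%:R ^+ r) g.

(** Deriving a difference of consecutive approximants costs a factor n^3 by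
    Markov's inequality; the margin of 6 in the exponent leaves a summable
    series. *)
Lemma derive_tail A (Q : nat -> mpoly N R) z h r : 1 <= h ->
  (forall n, (0 < n)%N -> (degp (Q n) <= c * n)%N) ->
  (forall n x, (0 < n)%N -> box z h x -> `|evalp (Q n.+1 - Q n) x| <= 2 * A / n%:R ^+ (r + 6)) ->
  forall i n m x, (0 < n)%N -> (n <= m)%N -> box z h x ->
   `|evalp (mderiv i (Q m)) x - evalp (mderiv i (Q n)) x| <= 64 * c%:R ^+ 3 * A / n%:R ^+ r.+1.
Proof.
move=> h1 dQ QA i n m x n0 nm zx.
have A0 : 0 <= A.
  have := QA 1%N x isT zx; rewrite expr1n divr1 => /(le_trans (normr_ge0 _)); lra.
have npos k : (0 < k)%N -> 0 < k%:R :> R by rewrite ltr0n.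
have step k : (0 < k)%N ->
    `|evalp (mderiv i (Q k.+1)) x - evalp (mderiv i (Q k)) x| <= 32 * c%:R ^+ 3 * A / k%:R ^+ (r + 3).
  move=> k0; rewrite -evalpB -mderivB.
  have dk : (degp (Q k.+1 - Q k) <= c * k.+1)%N.
    by apply: degpB; rewrite ?dQ// (leq_trans (dQ _ k0))// leq_mul.
  have := markov_box i (lt_le_trans ltr01 h1) dk (fun x => QA k x k0) zx.
  move=> /le_trans; apply.
  have k2 : k.+1%:R <= 2 * k%:R :> R by rewrite -natrM ler_nat mul2n -addnn -addn1 leq_add2l.
  rewrite natrM exprMn.
  have e : 32 * c%:R ^+ 3 * A / k%:R ^+ (r + 3) = 2 * (c%:R ^+ 3 * (2 * k%:R) ^+ 3) * (2 * A / k%:R ^+ (r + 6)).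
    rewrite !exprD; field.
    have kn0 : k%:R != 0 :> R by rewrite pnatr_eq0 -lt0n.
    by rewrite kn0 expf_neq0.
  rewrite e ler_pM//.
  - by rewrite divr_ge0 ?mulr_ge0 ?exprn_ge0// (le_trans ler01).
  - by rewrite divr_ge0 ?mulr_ge0 ?exprn_ge0.
  - have X0 : 0 <= 2 * (c%:R ^+ 3 * (2 * k%:R) ^+ 3) :> R by rewrite !mulr_ge0 ?exprn_ge0 ?mulr_ge0.
    rewrite ler_pdivrMr ?(lt_le_trans ltr01)// (le_trans _ (ler_peMr X0 h1))//.
    by rewrite ler_wpM2l// ler_wpM2l ?exprn_ge0// lerXn2r// nnegrE// mulr_ge0//.
have tele (a : R) : 1 <= a -> a ^- 2 <= 2 / a - 2 / (a + 1).
  move=> a1; have a0 : 0 < a by rewrite (lt_le_trans ltr01).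
  have a10 : 0 < a + 1 by lra.
  have -> : 2 / a - 2 / (a + 1) = 2 / (a * (a + 1)) by field; rewrite (gt_eqF a0) (gt_eqF a10).
  rewrite -[_^-1]mul1r ler_pdivlMr ?mulr_gt0// mul1r mulrC ler_pdivrMr ?exprn_gt0//.
  by rewrite expr2; nra.
have main k : `|evalp (mderiv i (Q (n + k)%N)) x - evalp (mderiv i (Q n)) x| <=
    32 * c%:R ^+ 3 * A / n%:R ^+ r.+1 * (2 - 2 / (n + k)%:R).
  elim: k => [|k ih].
    rewrite addn0 subrr normr0 mulr_ge0//.
      by rewrite divr_ge0 ?mulr_ge0 ?exprn_ge0.
    by rewrite subr_ge0 ler_pdivrMr ?npos// ler_peMr// ler1n.
  rewrite addnS -(subrK (evalp (mderiv i (Q (n + k)%N)) x) (evalp _ _)) -addrA.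
  rewrite (le_trans (ler_normD _ _))//.
  have nk : (0 < n + k)%N by rewrite addn_gt0 n0.
  apply: le_trans (lerD (step _ nk) ih) _.
  set B := 32 * c%:R ^+ 3 * A.
  have B0 : 0 <= B by rewrite /B !mulr_ge0 ?exprn_ge0.
  have nkn : n%:R <= (n + k)%:R :> R by rewrite ler_nat leq_addr.
  have h2 : B / (n + k)%:R ^+ (r + 3) <= B / n%:R ^+ r.+1 * (2 / (n + k)%:R - 2 / (n + k).+1%:R).
    rewrite (_ : (r + 3 = r.+1 + 2)%N) ?addnS ?addSn ?addn0// -[X in _ ^+ X](addn2 r.+1) exprD invfM mulrA.
    apply: ler_pM.
    + by rewrite divr_ge0// exprn_ge0.
    + by rewrite invr_ge0 sqr_ge0.
    + by rewrite ler_wpM2l// lef_pV2 ?posrE ?exprn_gt0 ?npos// lerXn2r ?nnegrE.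
    + have -> : (n + k).+1%:R = (n + k)%:R + 1 :> R by rewrite -natr1.
      by apply: tele; rewrite ler1n.
  have -> : 2 - 2 / (n + k).+1%:R = (2 / (n + k)%:R - 2 / (n + k).+1%:R) + (2 - 2 / (n + k)%:R) :> R.
    by ring.
  by rewrite [leRHS]mulrDr lerD.
rewrite -(subnKC nm) (le_trans (main _))//.
rewrite (_ : 64 * _ * _ / _ = 32 * c%:R ^+ 3 * A / n%:R ^+ r.+1 * 2); last by field; rewrite expf_neq0// pnatr_eq0 -lt0n.
rewrite ler_wpM2l//; first by rewrite divr_ge0 ?mulr_ge0 ?exprn_ge0.
by rewrite gerBl divr_ge0.
Qed.

(** The derivatives of the approximants of g converge uniformly, hence to the
    derivative of g, which they approximate in their turn. The box shrinks so
    that lines can leave each of its points in both directions. *)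
Lemma bernstein_step g A z h r : 0 <= h -> rapid (box z (h + 1)) (r + 6) A g ->
  (forall i x, box z h x -> derivable g x 'e_i) /\
  forall i, rapid (box z h) r (68 * c%:R ^+ 3 * A) (fun x => 'D_'e_i g x).
Proof.
move=> h0 [gA gP].
have h1 : 1 <= h + 1 by rewrite lerDr.
have A0 : 0 <= A by rewrite (le_trans (normr_ge0 _) (gA z _))//; apply: box_center; lra.
have /choice[Q0 HQ] : forall n, exists P, (0 < n)%N -> (degp P <= c * n)%N /\
    forall x, box z (h + 1) x -> `|g x - evalp P x| <= A / n%:R ^+ (r + 6).
  move=> n; have [->|n0] := posnP n; first by exists 0.
  by have [P dP PA] := gP n n0; exists P.
have dQ n : (0 < n)%N -> (degp (Q0 n) <= c * n)%N by move=> /HQ[].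
have gQ n x : (0 < n)%N -> box z (h + 1) x -> `|g x - evalp (Q0 n) x| <= A / n%:R ^+ (r + 6).
  by move=> /HQ[_]; exact.
have QQ n x : (0 < n)%N -> box z (h + 1) x -> `|evalp (Q0 n.+1 - Q0 n) x| <= 2 * A / n%:R ^+ (r + 6).
  move=> n0 zx; rewrite evalpB.
  have -> : evalp (Q0 n.+1) x - evalp (Q0 n) x = (g x - evalp (Q0 n) x) - (g x - evalp (Q0 n.+1) x) by ring.
  rewrite (le_trans (ler_normB _ _))// (le_trans (lerD (gQ n x n0 zx) (gQ n.+1 x isT zx)))//.
  rewrite -mulrA mulr_natl mulr2n lerD2l ler_wpM2l// lef_pV2 ?posrE ?exprn_gt0 ?ltr0n//.
  by rewrite lerXn2r ?nnegrE// ler_nat.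
have tail := derive_tail h1 dQ QQ.
set B := 64 * c%:R ^+ 3 * A in tail.
have B0 : 0 <= B by rewrite /B !mulr_ge0 ?exprn_ge0.
have Bn n : (0 < n)%N -> B / n%:R ^+ r.+1 <= B / n%:R.
  move=> n0; rewrite ler_wpM2l// lef_pV2 ?posrE ?exprn_gt0 ?ltr0n//.
  by rewrite ler_eXnr// ler1n.
have small := @small_quotient R.
have lims i x : exists l, box z (h + 1) x -> forall n, (0 < n)%N ->
    `|evalp (mderiv i (Q0 n)) x - l| <= B / n%:R ^+ r.+1.
  have [zx|] := pselect (box z (h + 1) x); last by exists 0.
  have small' eps : 0 < eps -> exists2 n, (1 <= n)%N & B / n%:R ^+ r.+1 <= eps.
    move=> eps0; have [n n0 nB] := small B eps eps0; exists n => //.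
    exact: le_trans (Bn _ n0) nB.
  have [l Hl] := @cauchy_lim R (fun n => evalp (mderiv i (Q0 n)) x) _ 1
    (fun n m n0 nm => tail i n m x n0 nm zx) small'.
  by exists l.
have boxS x : box z h x -> box z (h + 1) x by move=> zx j; rewrite (le_trans (zx j))// lerDl.
have dg i x : box z h x -> exists2 l, is_derive (x 0 i) 1 (fun t => g (setc x i t)) l &
    forall n, (0 < n)%N -> `|evalp (mderiv i (Q0 n)) x - l| <= B / n%:R ^+ r.+1.
  move=> zx; have [l Hl] := lims i x; exists l; last exact/Hl/boxS.
  apply: is_derive_approx => eps eps0; have [n n0 nB] := small B eps eps0.
  exists (fun t => evalp (Q0 n) (setc x i t)), (evalp (mderiv i (Q0 n)) x); split.
  - have := is_derive_line (@derivable_evalp R N (Q0 n) (setc x i (x 0 i)) i).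
    by rewrite derive_evalp_at setc_id.
  - by rewrite (le_trans (Hl (boxS _ zx) n n0))// (le_trans (Bn _ n0)).
  exists 1 => // t t1; rewrite setc_id.
  have zt : box z (h + 1) (setc x i (x 0 i + t)).
    apply: box_setc; first exact: boxS.
    by rewrite addrAC (le_trans (ler_normD _ _))// lerD.
  apply/ler_addgt0Pr => e e0; have [m m0 mA] := small (2 * A) e e0.
  pose M := maxn m n; have M0 : (0 < M)%N by rewrite leq_max m0.
  have nM : (n <= M)%N by rewrite leq_maxr.
  have lip : `|evalp (Q0 M - Q0 n) (setc x i (x 0 i + t)) - evalp (Q0 M - Q0 n) (setc x i (x 0 i))| <=
      B / n%:R ^+ r.+1 * `|x 0 i + t - x 0 i|.
    apply: (@lipschitz_line R N _ z (h + 1)) => //.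
    - by move=> y zy; exact: derivable_evalp.
    - by move=> y zy; rewrite derive_evalp_at mderivB evalpB; apply: tail.
    - exact: boxS.
    - exact: boxS.
    - by rewrite addrAC (le_trans (ler_normD _ _))// lerD.
  rewrite addrAC subrr add0r setc_id !evalpB in lip.
  have g1 := gQ M _ M0 zt; have g2 := gQ M _ M0 (boxS _ zx).
  have AM : A / M%:R ^+ (r + 6) <= A / m%:R.
    rewrite ler_wpM2l// lef_pV2 ?posrE ?exprn_gt0 ?ltr0n//.
    rewrite (@le_trans _ _ M%:R) ?ler_nat ?leq_maxl//.
    by rewrite ler_eXnr ?addn_gt0 ?orbT// ler1n.
  have e1 : B / n%:R ^+ r.+1 * `|t| <= eps * `|t|.
    by rewrite ler_wpM2r// (le_trans (Bn _ n0)).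
  rewrite -mulrA in mA.
  move: lip g1 g2 mA AM e1; rewrite !ler_distl ?ler_norml.
  set a := evalp _ _; set b := evalp _ _; set c' := evalp _ _; set d := evalp _ _.
  move=> /andP[? ?] /andP[? ?] /andP[? ?] ? ? ?; apply/andP; split; lra.
have dgl i x : box z h x -> derivable g x 'e_i /\
    forall n, (0 < n)%N -> `|'D_'e_i g x - evalp (mderiv i (Q0 n)) x| <= B / n%:R ^+ r.+1.
  move=> zx; have [l [dl lE] Hl] := dg i x zx; split; first exact/derivable_line.
  by move=> n n0; rewrite derive_line lE distrC Hl.
split=> [i x /(dgl i)[]//|i].
have BE : 68 * c%:R ^+ 3 * A = B + 4 * c%:R ^+ 3 * A by rewrite /B; ring.
have C0 : 0 <= 4 * c%:R ^+ 3 * A by rewrite !mulr_ge0 ?exprn_ge0.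
split.
  move=> x zx; have [_ /(_ 1%N isT)] := dgl i x zx; rewrite expr1n divr1 => D1.
  have Q1 y : box z (h + 1) y -> `|evalp (Q0 1%N) y| <= 2 * A.
    move=> zy; have := gQ 1%N y isT zy; have := gA y zy; rewrite expr1n divr1.
    rewrite !ler_norml => /andP[? ?] /andP[? ?]; apply/andP; split; lra.
  have := markov_box i (lt_le_trans ltr01 h1) (dQ 1%N isT) Q1 (boxS _ zx).
  have c1 : 2 * (c * 1)%:R ^+ 3 / (h + 1) * (2 * A) <= 4 * c%:R ^+ 3 * A.
    rewrite muln1 (_ : 4 * c%:R ^+ 3 * A = 2 * c%:R ^+ 3 * (2 * A)); last by ring.
    rewrite ler_wpM2r ?mulr_ge0// ler_pdivrMr ?(lt_le_trans ltr01)//.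
    by rewrite ler_peMr// mulr_ge0 ?exprn_ge0.
  move=> /le_trans/(_ c1) M1; rewrite BE.
  by rewrite -(subrK (evalp (mderiv i (Q0 1%N)) x) ('D_'e_i g x)) (le_trans (ler_normD _ _))// lerD.
move=> n n0; exists (mderiv i (Q0 n)).
  by rewrite (leq_trans (degp_mderiv i (dQ n n0)))// leq_pred.
move=> x zx; have [_ /(_ n n0) /le_trans] := dgl i x zx; apply.
rewrite BE; apply: ler_pM => //.
- by rewrite lerDl.
- rewrite lef_pV2 ?posrE ?exprn_gt0 ?ltr0n// exprS ler_peMl ?exprn_ge0// ler1n//.
Qed.

(** The constant does not depend on g: rapid approximation bounds the
    derivatives, which is the continuity of the derivations for the topology of
    rapid approximation. *)
Lemma rapid_partials z h r s : 0 <= h -> exists2 C, 0 < C & forall g A,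
  rapid (box z (h + (size s)%:R)) (r + 6 * size s) A g ->
  rapid (box z h) r (C * A) (partials s g).
Proof.
elim: s h r => [|i s ih] h r h0.
  by exists 1 => // g A; rewrite muln0 !addn0 addr0 mul1r.
have h10 : 0 <= h + 1 by rewrite addr_ge0.
have [C C0 HC] := ih (h + 1) (r + 6)%N h10.
exists (68 * c%:R ^+ 3 * C + 1); first by rewrite ltr_wpDl// !mulr_ge0 ?exprn_ge0// ltW.
move=> g A gA.
have /HC /(bernstein_step h0)[_ /(_ i)] : rapid (box z (h + 1 + (size s)%:R)) (r + 6 + 6 * size s) A g.
  by move: gA; rewrite /= mulnS addnA -addrA nat1r.
have A0 : 0 <= A.
  by have := gA.1 z (box_center _ (addr_ge0 h0 (ler0n _ _))); apply: le_trans.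
have le : 68 * c%:R ^+ 3 * (C * A) <= (68 * c%:R ^+ 3 * C + 1) * A.
  rewrite [leRHS](_ : _ = 68 * c%:R ^+ 3 * (C * A) + A); last by ring.
  by rewrite lerDl.
move=> [D1 D2]; split=> [x zx|n n0]; first exact: le_trans (D1 x zx) le.
have [P dP PA] := D2 n n0; exists P => // x zx; apply: le_trans (PA x zx) _.
by rewrite ler_wpM2r// invr_ge0 exprn_ge0.
Qed.

Lemma rapid_smooth g : (forall h r, 0 <= h -> exists A, rapid (box 0 h) r A g) -> smooth g.
Proof.
move: g; apply: smooth_family => g Sg; split; last first.
  move=> i; split.
    move=> x; pose h := \sum_j `|x 0 j|.
    have h0 : 0 <= h by apply: sumr_ge0.
    have [A /(bernstein_step h0)[+ _]] := Sg (h + 1) (0 + 6)%N (addr_ge0 h0 ler01).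
    apply=> j; rewrite mxE subr0 /h (bigD1 j)//= lerDl; exact: sumr_ge0.
  move=> h r h0; have [A /(bernstein_step h0)[_ /(_ i)]] := Sg (h + 1) (r + 6)%N (addr_ge0 h0 ler01).
  by exists (68 * c%:R ^+ 3 * A).
apply/continuous_boxP => x eps eps0.
pose h := \sum_j `|x 0 j| + 1.
have xh y : box x 1 y -> box 0 h y.
  move=> xy j; rewrite mxE subr0 -(subrK (x 0 j) (y 0 j)) (le_trans (ler_normD _ _))//.
  rewrite /h addrC lerD// (bigD1 j)//= lerDl; exact: sumr_ge0.
have h0 : 0 <= h by rewrite addr_ge0// sumr_ge0.
have [A [_ gA]] := Sg h 1%N h0.
have e3 : 0 < eps / 3 by rewrite divr_gt0.
have [n n0 An] := small_quotient A e3.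
rewrite -[n%:R]expr1 in An.
have [P _ PA] := gA n n0.
have /continuous_boxP/(_ x _ e3)[d d0 Pd] := continuous_evalp (P := P).
exists (Num.min d 1); first by rewrite lt_min d0 ltr01.
move=> y xy.
have xy1 : box x 1 y by move=> j; rewrite (le_trans (xy j))// ge_min lexx orbT.
have xyd : box x d y by move=> j; rewrite (le_trans (xy j))// ge_min lexx.
have p1 := le_trans (PA y (xh _ xy1)) An.
have p2 := le_trans (PA x (xh _ (box_center _ ler01))) An.
have p3 := Pd y xyd.
move: p1 p2 p3; rewrite !ler_norml => /andP[? ?] /andP[? ?] /andP[? ?].
apply/andP; split; lra.
Qed.

End Bernstein.

(** * Jackson's theorem in one variable *)

Section BernsteinPolynomials.
Variable R : realType.
Implicit Types (x : R) (f : nat -> R) (p : {poly R}).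

(** The basis 'C(n, j) x^j (1 - x)^(n - j), through the recursion of Pascal's
    triangle: the moments are then computed by induction on n. *)
Fixpoint bern n (j : nat) : {poly R} :=
  if n is n'.+1 then
    (1 - 'X) * bern n' j + 'X * (if j is j'.+1 then bern n' j' else 0)
  else (j == 0%N)%:R%:P.

Lemma bern_gt n j : (n < j)%N -> bern n j = 0.
Proof.
elim: n j => [|n ih] [|j]//= nj.
by rewrite !ih ?mulr0 ?addr0// ltnW.
Qed.

Lemma size_bern n j : (size (bern n j) <= n.+1)%N.
Proof.
elim: n j => [|n ih] j /=; first by rewrite (leq_trans (size_polyC_leq1 _)).
have s1 : (size (1 - 'X : {poly R})%R <= 2)%N.
  by rewrite (leq_trans (size_polyD _ _))// size_polyN size_poly1 size_polyX.
have sM (p q : {poly R}) : (size p <= 2)%N -> (size q <= n.+1)%N -> (size (p * q)%R <= n.+2)%N.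
  move=> p2 q2; rewrite (leq_trans (size_polyMleq _ _))//.
  by rewrite -subn1 leq_subLR add1n (leq_trans (leq_add p2 q2)).
rewrite (leq_trans (size_polyD _ _))// geq_max; apply/andP; split; apply: sM => //.
  by rewrite size_polyX.
by case: j => [|j]; rewrite ?size_poly0.
Qed.

(** The Bernstein operator, for the values f j at the nodes j / n. *)
Definition bsum n f x := \sum_(j < n.+1) (bern n j).[x] * f j.

Lemma bsumS n f x :
  bsum n.+1 f x = (1 - x) * bsum n f x + x * bsum n (fun j => f j.+1) x.
Proof.
rewrite /bsum !mulr_sumr.
have -> : \sum_(j < n.+1) (1 - x) * ((bern n j).[x] * f j) =
    \sum_(j < n.+2) (1 - x) * ((bern n j).[x] * f j).
  by rewrite [RHS]big_ord_recr/= bern_gt// horner0 mul0r mulr0 addr0.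
rewrite big_ord_recl [X in _ = X + _]big_ord_recl/= -addrA -big_split/=; congr (_ + _).
  by rewrite !hornerE/=; ring.
by apply: eq_bigr => j _; rewrite /bump/= add1n !hornerE/=; ring.
Qed.

Lemma bsum0 f x : bsum 0 f x = f 0%N.
Proof. by rewrite /bsum big_ord_recl big_ord0 addr0/= hornerC mul1r. Qed.

Lemma bsum_sqr n a x :
  bsum n (fun j => (j%:R - a) ^+ 2) x = n%:R * x * (1 - x) + (n%:R * x - a) ^+ 2.
Proof.
elim: n a => [|n ih] a; first by rewrite bsum0; ring.
rewrite bsumS ih (_ : bsum n _ x = bsum n (fun j => (j%:R - (a - 1)) ^+ 2) x).
  by rewrite ih -natr1; ring.
by apply: eq_bigr => j _; rewrite -natr1; congr (_ * _ ^+ 2); ring.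
Qed.

Lemma bsum1 n x : bsum n (fun=> 1) x = 1.
Proof. by elim: n => [|n ih]; rewrite ?bsum0// bsumS ih; ring. Qed.

Lemma bsumC n (c : R) x : bsum n (fun=> c) x = c.
Proof.
rewrite -[RHS]mul1r -[in RHS](bsum1 n x) /bsum mulr_suml.
by apply: eq_bigr => j _; rewrite mulr1.
Qed.

Lemma bern_ge0 n j x : 0 <= x <= 1 -> 0 <= (bern n j).[x].
Proof.
move=> /andP[x0 x1]; elim: n j => [|n ih] j /=; first by rewrite hornerC.
have h1 : 0 <= 1 - x by rewrite subr_ge0.
by case: j => [|j]; rewrite !hornerE/= ?addr_ge0 ?mulr_ge0.
Qed.

(** With m^2 + 1 nodes the Bernstein operator approximates an L-Lipschitz
    function within L / m: the mean of |x - j / m^2| is bounded through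
    2 |u| <= 1 / m + m u^2 and the variance x (1 - x) / m^2. *)
Lemma bern_approx m (u : R -> R) (L : R) : (0 < m)%N ->
  (forall s t, 0 <= s <= 1 -> 0 <= t <= 1 -> `|u t - u s| <= L * `|t - s|) ->
  forall x, 0 <= x <= 1 ->
  `|u x - bsum (m ^ 2) (fun j => u (j%:R / (m ^ 2)%:R)) x| <= L / m%:R.
Proof.
move=> m0 uL x x01.
have L0 : 0 <= L.
  by have := uL 0 1; rewrite !lexx ler01 subr0 normr1 mulr1 => /(_ isT isT)/(le_trans _)->.
have mR : 0 < m%:R :> R by rewrite ltr0n.
set n := (m ^ 2)%N; have n0 : 0 < n%:R :> R by rewrite ltr0n expn_gt0 m0.
have nm : n%:R = m%:R ^+ 2 :> R by rewrite natrX.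
have node j : (j < n.+1)%N -> 0 <= (j%:R / n%:R : R) <= 1.
  by move=> jn; rewrite divr_ge0//= ler_pdivrMr// mul1r ler_nat.
have -> : u x - bsum n (fun j => u (j%:R / n%:R)) x =
    bsum n (fun j => u x - u (j%:R / n%:R)) x.
  rewrite -[u x in LHS]mulr1 -(bsum1 n x) /bsum mulr_sumr -sumrB.
  by apply: eq_bigr => j _; ring.
apply: (@le_trans _ _ (bsum n (fun j => L / 2 * (m%:R^-1 + m%:R / n%:R ^+ 2 * (j%:R - n%:R * x) ^+ 2)) x)).
  rewrite (le_trans (ler_norm_sum _ _ _))//; apply: ler_sum => j _.
  rewrite normrM ger0_norm ?bern_ge0// ler_wpM2l ?bern_ge0//.
  rewrite (le_trans (uL _ _ (node _ (ltn_ord j)) x01))// -mulrA ler_wpM2l//.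
  have -> : (j%:R - n%:R * x) ^+ 2 = n%:R ^+ 2 * `|x - j%:R / n%:R| ^+ 2.
    by rewrite real_normK ?num_real//; field; rewrite gt_eqF.
  rewrite mulrA divfK ?expf_neq0 ?gt_eqF//; set a := `|_|.
  have -> : 2^-1 * (m%:R^-1 + m%:R * a ^+ 2) = a + (m%:R * a - 1) ^+ 2 / (2 * m%:R).
    by field; rewrite gt_eqF.
  by rewrite lerDl divr_ge0 ?sqr_ge0 ?mulr_ge0.
have -> : bsum n (fun j => L / 2 * (m%:R^-1 + m%:R / n%:R ^+ 2 * (j%:R - n%:R * x) ^+ 2)) x =
    L / 2 * (m%:R^-1 * bsum n (fun=> 1) x + m%:R / n%:R ^+ 2 * bsum n (fun j => (j%:R - n%:R * x) ^+ 2) x).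
  rewrite /bsum mulrDr !mulr_sumr -big_split/=; apply: eq_bigr => j _; ring.
rewrite bsum1 bsum_sqr subrr expr0n/= addr0 mulr1 -mulrA ler_wpM2l// nm.
have -> : m%:R / (m%:R ^+ 2) ^+ 2 * (m%:R ^+ 2 * x * (1 - x)) = m%:R^-1 * (x * (1 - x)) :> R.
  by field; rewrite gt_eqF.
rewrite -[X in X + _]mulr1 -mulrDr mulrCA -[leRHS]mulr1 ler_wpM2l ?invr_ge0//.
by nra.
Qed.

(** The antiderivative that vanishes at 0. *)
Definition prim p : {poly R} := \poly_(i < (size p).+1) (p`_i.-1 / i%:R).

Lemma size_prim p : (size (prim p) <= (size p).+1)%N.
Proof. exact: size_poly. Qed.

Lemma deriv_prim p : (prim p)^`() = p.
Proof.
apply/polyP => i; rewrite coef_deriv coef_poly ltnS; case: ltnP => [ip|pi].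
  by rewrite /= -[LHS]mulr_natr divfK// pnatr_eq0.
by rewrite mul0rn nth_default.
Qed.

Lemma prim0 p : (prim p).[0] = 0.
Proof. by rewrite horner_coef0 coef_poly/= invr0 mulr0. Qed.

Lemma unit_itv x : (0 <= x <= 1) = (`|x - 2^-1| <= 2^-1).
Proof. by rewrite ler_distl; apply/idP/idP => /andP[? ?]; apply/andP; split; lra. Qed.

Lemma prim_le p (A : R) : (forall x, 0 <= x <= 1 -> `|p.[x]| <= A) ->
  forall x, 0 <= x <= 1 -> `|(prim p).[x]| <= A.
Proof.
move=> pA x x01.
have A0 : 0 <= A by apply: le_trans (pA 0 _); rewrite ?normr_ge0// lexx ler01.
have := @lipschitz_derive R (horner (prim p)) (horner p) 2^-1 2^-1 A _ _ 0 x.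
rewrite prim0 !subr0 -!unit_itv lexx ler01 x01 => h.
rewrite (le_trans (h _ _ isT isT))//.
- by move=> t _; rewrite -{2}(deriv_prim p); exact: is_derive_poly.
- by move=> t; rewrite -unit_itv => /pA.
- by case/andP: x01 => x0 x1; rewrite (ger0_norm x0) ler_piMr.
Qed.

(** Iterating the Bernstein operator: if h' is approximated by J h' then
    B (h - prim (J h')) + prim (J h') approximates h with one more factor
    1 / m. Unfolded, this is a combination of the values at the nodes of the
    derivatives of h of order less than r, with coefficients that do not depend on h. *)
Lemma jackson_unit r m : (0 < m)%N -> exists l : nat -> nat -> {poly R},
  [/\ forall s j, (size (l s j) <= m ^ 2 + r.+1)%N,
      forall s j x, 0 <= x <= 1 -> `|(l s j).[x]| <= 2 ^+ s &
      forall (h : nat -> R -> R) A,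
        (forall s x, (s < r)%N -> 0 <= x <= 1 -> is_derive x 1 (h s) (h s.+1 x)) ->
        (forall x, 0 <= x <= 1 -> `|h r x| <= A) ->
        forall x, 0 <= x <= 1 ->
        `|h 0%N x - \sum_(s < r) \sum_(j < (m ^ 2).+1) h s (j%:R / (m ^ 2)%:R) * (l s j).[x]|
          <= A / m%:R ^+ r].
Proof.
move=> m0; set n := (m ^ 2)%N.
have n0 : 0 < n%:R :> R by rewrite ltr0n expn_gt0 m0.
have node j : (j < n.+1)%N -> 0 <= (j%:R / n%:R : R) <= 1.
  by move=> jn; rewrite divr_ge0//= ler_pdivrMr// mul1r ler_nat.
elim: r => [|r [l [sl lb lA]]].
  exists (fun _ _ => 0); split.
  - by move=> s j; rewrite size_poly0.
  - by move=> s j x _; rewrite horner0 normr0 exprn_ge0.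
  - by move=> h A _ hA x x01; rewrite big_ord0 subr0 expr0 divr1 hA.
pose B p : {poly R} := \sum_(j < n.+1) p.[j%:R / n%:R] *: bern n j.
have BE p x : (B p).[x] = bsum n (fun j => p.[j%:R / n%:R]) x.
  by rewrite horner_sum; apply: eq_bigr => j _; rewrite hornerZ mulrC.
exists (fun s j => if s is s'.+1 then prim (l s' j) - B (prim (l s' j)) else bern n j); split.
- case=> [|s] j; first by rewrite (leq_trans (size_bern _ _))// -addn1 leq_add2l.
  rewrite (leq_trans (size_polyD _ _))// size_polyN geq_max; apply/andP; split.
    by rewrite (leq_trans (size_prim _))// [in leqRHS]addnS ltnS sl.
  rewrite (leq_trans (size_sum _ _ _))//; apply/bigmax_leqP => i _.
  by rewrite (leq_trans (size_scale_leq _ _))// (leq_trans (size_bern _ _))// -addn1 leq_add2l.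
- case=> [|s] j x x01.
    rewrite ger0_norm ?bern_ge0// expr0.
    have [jn|jn] := leqP j n; last by rewrite bern_gt// horner0.
    rewrite -[leRHS](bsum1 n x) /bsum (bigD1 (Ordinal (jn : (j < n.+1)%N)))//= mulr1 lerDl.
    by apply: sumr_ge0 => i _; rewrite mulr1 bern_ge0.
  rewrite hornerD hornerN (le_trans (ler_normB _ _))// exprS mulr_natl mulr2n lerD//.
    by apply: prim_le => // y; exact: lb.
  rewrite BE (le_trans (ler_norm_sum _ _ _))//.
  rewrite -[leRHS](bsumC n _ x); apply: ler_sum => i _.
  rewrite normrM ger0_norm ?bern_ge0// ler_wpM2l ?bern_ge0//.
  by apply: prim_le; [move=> y; exact: lb|exact: node].
move=> h A hd hA x x01.
pose w y := h 0%N y - \sum_(s < r) \sum_(j < n.+1) h s.+1 (j%:R / n%:R) * (prim (l s j)).[y].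
pose w' y := h 1%N y - \sum_(s < r) \sum_(j < n.+1) h s.+1 (j%:R / n%:R) * (l s j).[y].
have w'A (y : R) : 0 <= y <= 1 -> `|w' y| <= A / m%:R ^+ r.
  by apply: (lA (fun s => h s.+1)) => // s z sr; exact: hd.
have wd (y : R) : 0 <= y <= 1 -> is_derive y 1 w (w' y).
  move=> y01.
  pose q : {poly R} := \sum_(s < r) \sum_(j < n.+1) h s.+1 (j%:R / n%:R) *: prim (l s j).
  have qE : w = h 0%N - horner q.
    apply/funext => z; rewrite -[RHS]/(h 0%N z - q.[z]) /w /q horner_sum; congr (_ - _).
    apply: eq_bigr => s _; rewrite horner_sum; apply: eq_bigr => j _.
    by rewrite hornerZ.
  have ds k (F : 'I_k -> {poly R}) : (\sum_(i < k) F i)^`() = \sum_(i < k) (F i)^`().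
    exact: raddf_sum.
  have q'E : w' y = h 1%N y - q^`().[y].
    rewrite /w' /q ds horner_sum; congr (_ - _).
    apply: eq_bigr => s _; rewrite ds horner_sum; apply: eq_bigr => j _.
    by rewrite /= derivZ deriv_prim hornerZ.
  rewrite qE q'E; apply: is_deriveB; exact: hd.
have := @bern_approx m w (A / m%:R ^+ r) m0 _ x x01.
rewrite exprSr invfM mulrA -/n => H.
apply: le_trans (H _).
  rewrite le_eqVlt; apply/orP; left; apply/eqP; congr Num.norm.
  rewrite big_ord_recl/= /bsum /w opprD addrA -/n.
  have -> : \sum_(j < n.+1) (bern n j).[x] * (h 0%N (j%:R / n%:R) -
       \sum_(s < r) \sum_(j0 < n.+1) h s.+1 (j0%:R / n%:R) * (prim (l s j0)).[j%:R / n%:R]) =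
     \sum_(j < n.+1) h 0%N (j%:R / n%:R) * (bern n j).[x] -
     \sum_(s < r) \sum_(j0 < n.+1) h s.+1 (j0%:R / n%:R) * (B (prim (l s j0))).[x].
    have -> : \sum_(s < r) \sum_(j0 < n.+1) h s.+1 (j0%:R / n%:R) * (B (prim (l s j0))).[x] =
        \sum_(s < r) \sum_(j < n.+1) \sum_(j0 < n.+1)
          h s.+1 (j0%:R / n%:R) * ((bern n j).[x] * (prim (l s j0)).[j%:R / n%:R]).
      apply: eq_bigr => s _; rewrite exchange_big/=; apply: eq_bigr => j0 _.
      by rewrite BE /bsum mulr_sumr.
    rewrite exchange_big/= -sumrB; apply: eq_bigr => j _.
    rewrite mulrBr mulrC; congr (_ - _).
    rewrite mulr_sumr; apply: eq_bigr => s _; rewrite mulr_sumr; apply: eq_bigr => j0 _; ring.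
  have -> : \sum_(i < r) \sum_(j < n.+1) h (bump 0 i) (j%:R / n%:R) * (prim (l i j) - B (prim (l i j))).[x] =
     \sum_(s < r) \sum_(j < n.+1) h s.+1 (j%:R / n%:R) * (prim (l s j)).[x] -
     \sum_(s < r) \sum_(j < n.+1) h s.+1 (j%:R / n%:R) * (B (prim (l s j))).[x].
    rewrite -sumrB; apply: eq_bigr => s _; rewrite -sumrB; apply: eq_bigr => j _.
    by rewrite hornerD hornerN mulrBr.
  by ring.
move=> s t; rewrite !unit_itv => hs ht; apply: (@lipschitz_derive _ w w' _ _ _ _ _ _ _ hs ht).
  by move=> y; rewrite -unit_itv; exact: wd.
by move=> y; rewrite -unit_itv; exact: w'A.
Qed.

(** The bound of the coefficients does not depend on m: the values h s (t j)
    may thus be replaced by approximations of them. *)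
Lemma jackson_itv (rho : R) r m : 0 < rho -> (0 < m)%N ->
  exists (t : nat -> R) (l : nat -> nat -> {poly R}),
  [/\ forall j, (j < (m ^ 2).+1)%N -> `|t j| <= rho,
      forall s j, (size (l s j) <= m ^ 2 + r.+1)%N,
      forall s j x, (s < r)%N -> `|x| <= rho -> `|(l s j).[x]| <= (4 * rho + 1) ^+ r &
      forall (h : nat -> R -> R) A,
        (forall s x, (s < r)%N -> `|x| <= rho -> is_derive x 1 (h s) (h s.+1 x)) ->
        (forall x, `|x| <= rho -> `|h r x| <= A) ->
        forall x, `|x| <= rho ->
        `|h 0%N x - \sum_(s < r) \sum_(j < (m ^ 2).+1) h s (t j) * (l s j).[x]|
          <= (2 * rho) ^+ r * A / m%:R ^+ r].
Proof.
move=> rho0 m0; have [l [sl lb lA]] := jackson_unit r m0.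
have r2 : 0 < 2 * rho by rewrite mulr_gt0.
pose a (y : R) := 2 * rho * y - rho.
have aK y : 2 * rho * (((y + rho) / (2 * rho))) - rho = y by rewrite mulrC divfK ?gt_eqF// addrK.
have a01 (y : R) : 0 <= y <= 1 -> `|a y| <= rho.
  move=> /andP[y0 y1]; rewrite /a ler_norml; apply/andP; split; nra.
have b01 (y : R) : `|y| <= rho -> 0 <= (y + rho) / (2 * rho) <= 1.
  rewrite ler_norml => /andP[y0 y1]; apply/andP; split.
    by rewrite divr_ge0 ?(ltW r2)//; lra.
  by rewrite ler_pdivrMr// mul1r; lra.
pose l' s j := (2 * rho) ^+ s *: (l s j \Po ((2 * rho)^-1 *: 'X + 2^-1%:P)).
have l'E s j x : (l' s j).[x] = (2 * rho) ^+ s * (l s j).[(x + rho) / (2 * rho)].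
  rewrite hornerZ horner_comp !hornerE; congr (_ * _.[_]).
  by field; rewrite gt_eqF.
exists (fun j => a (j%:R / (m ^ 2)%:R)), l'; split.
- move=> j jm; apply: a01; rewrite divr_ge0//= ler_pdivrMr ?ltr0n ?expn_gt0 ?m0//.
  by rewrite mul1r ler_nat.
- move=> s j; rewrite (leq_trans (size_scale_leq _ _))//.
  have s2 : (size ((2 * rho)^-1 *: 'X + 2^-1%:P : {poly R})%R <= 2)%N.
    rewrite (leq_trans (size_polyD _ _))// geq_max (leq_trans (size_scale_leq _ _)) ?size_polyX//.
    by rewrite (leq_trans (size_polyC_leq1 _)).
  apply: leq_trans (size_comp_poly_leq _ _) _.
  rewrite addnS ltnS (leq_trans (leq_mul (leqnn _) (_ : _ <= 1)%N))//.
    by rewrite -subn1 leq_subLR.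
  by rewrite muln1 -subn1 leq_subLR add1n -addnS.
- move=> s j x sr xr; rewrite l'E normrM (ger0_norm (exprn_ge0 s (ltW r2))).
  apply: (@le_trans _ _ ((2 * rho) ^+ s * 2 ^+ s)).
    by rewrite ler_wpM2l ?(exprn_ge0 s (ltW r2))// lb// b01.
  rewrite -exprMn (_ : 2 * rho * 2 = 4 * rho); last by ring.
  have h1 : 1 <= 4 * rho + 1 by rewrite lerDr mulr_ge0// (ltW rho0).
  apply: (@le_trans _ _ ((4 * rho + 1) ^+ s)).
    by rewrite lerXn2r ?nnegrE ?lerDl// ?addr_ge0// mulr_ge0// (ltW rho0).
  by rewrite ler_weXn2l// ltnW.
move=> h A hd hA x xr.
have := lA (fun s y => (2 * rho) ^+ s * h s (a y)) ((2 * rho) ^+ r * A) _ _ ((x + rho) / (2 * rho)) (b01 _ xr).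
rewrite expr0 mul1r /a aK => H; apply: le_trans (H _ _).
- rewrite le_eqVlt; apply/orP; left; apply/eqP; congr (`| _ - _ |).
  apply: eq_bigr => s _; apply: eq_bigr => j _; rewrite l'E; ring.
- move=> s y sr y01; have dh := hd s (a y) sr (a01 _ y01).
  have da : is_derive y 1 a (2 * rho).
    rewrite (_ : a = horner ((2 * rho) *: 'X - rho%:P)).
      by apply: trigger_derive; rewrite derivB derivZ derivX derivC subr0 hornerZ hornerC mulr1.
    by apply/funext => z; rewrite /a !hornerE.
  have dc := @is_derive1_comp R (h s) a y _ _ dh da.
  have -> : (fun y => (2 * rho) ^+ s * h s (a y)) = (2 * rho) ^+ s *: (h s \o a) by [].
  apply: is_derive_eq; rewrite -[LHS]/(_ * _); rewrite /GRing.scale/= exprS; ring.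
- move=> y y01; rewrite normrM (ger0_norm (exprn_ge0 r (ltW r2))) ler_wpM2l ?(exprn_ge0 r (ltW r2))//.
  exact/hA/a01.
Qed.

End BernsteinPolynomials.

(** * Jackson's theorem in several variables *)

Section Substitution.
Variables (R : realType) (N : nat).
Implicit Types (P : mpoly N R) (x : 'rV[R]_N).

Definition substp (k : 'I_N) (t : R) P : mpoly N R :=
  comp_mpoly [tuple if j == k then mpolyC N t else mpolyX R (mnm1 j) | j < N] P.

Lemma evalp_comp (M : nat) (lq : N.-tuple (mpoly M R)) P (x : 'rV[R]_M) :
  evalp (comp_mpoly lq P) x = evalp P (\row_j evalp (tnth lq j) x).
Proof.
by rewrite /evalp comp_mpoly_meval; apply: meval_eq => j; rewrite mxE.
Qed.

Lemma degp_comp (M : nat) (lq : N.-tuple (mpoly M R)) P c m :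
  (forall j, (degp (tnth lq j) <= c)%N) -> (degp P <= m)%N ->
  (degp (comp_mpoly lq P) <= m * c)%N.
Proof.
move=> lqc /degp_leP hP; rewrite comp_mpolyEX big_seq; apply: degp_sum => a aP.
apply: degpZ; rewrite comp_mpolyX.
apply: (@leq_trans (mdeg a * c)); last by rewrite leq_mul// hP.
rewrite mdegE big_distrl/=.
elim/big_ind2: _ => [|u v p q hu hv|j _]; first by rewrite -mpolyC1 degpC.
  exact: degpM.
exact: degp_exp.
Qed.

Lemma evalp_substp k t P x : evalp (substp k t P) x = evalp P (setc x k t).
Proof.
rewrite evalp_comp; congr evalp; apply/rowP => j; rewrite !mxE tnth_mktuple.
by case: eqP => _; rewrite ?evalpC ?evalpX.
Qed.

Lemma degp_substp k t P m : (degp P <= m)%N -> (degp (substp k t P) <= m)%N.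
Proof.
move=> hP; rewrite -[m]muln1; apply: degp_comp hP => j; rewrite tnth_mktuple.
by case: eqP => _; rewrite ?degpC// degpX ?mdeg1.
Qed.

Definition polyk (k : 'I_N) (p : {poly R}) : mpoly N R :=
  \sum_(a < size p) p`_a *: mpolyX R (mnm1 k) ^+ a.

Lemma evalp_polyk k p x : evalp (polyk k p) x = p.[x 0 k].
Proof.
rewrite evalp_sum horner_coef; apply: eq_bigr => a _.
by rewrite evalpZ evalpXn evalpX.
Qed.

Lemma degp_polyk k (p : {poly R}) m : (size p <= m.+1)%N -> (degp (polyk k p) <= m)%N.
Proof.
move=> sp; apply: degp_sum => a _; apply: degpZ.
have := @degp_exp R N (mpolyX R (mnm1 k)) 1 a; rewrite muln1 => h.
apply: leq_trans (h _) _; first by rewrite degpX ?mdeg1.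
by rewrite -ltnS (leq_trans (ltn_ord a)).
Qed.

End Substitution.

Section Jackson.
Variables (R : realType) (N : nat) (rho : R).
Hypothesis rho0 : 0 < rho.
Implicit Types (f : 'rV[R]_N -> R) (A : R).

(** The partial derivatives taken in increasing order of the coordinates are the
    D^alpha, in terms of which the seminorms are defined. *)
Definition bounded_partials (i mu : nat) A f := forall s : seq 'I_N,
  sorted (fun j k : 'I_N => (j <= k)%N) s -> all (fun j : 'I_N => (j < i)%N) s -> (size s <= mu)%N ->
  forall x, box 0 rho x -> `|partials s f x| <= A.

(** The variables are treated one at a time, the coordinates of index at
    least i being fixed. In the variable i the one-dimensional formula uses the
    derivatives of f at the nodes, which are functions of the previous variables
    and are approximated by induction. *)
Lemma jackson_partial i r : (i <= N)%N -> exists (C : R) (mu c : nat), 0 <= C /\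
  forall f A, smooth f -> bounded_partials i mu A f ->
  forall m, (0 < m)%N -> forall z, box 0 rho z -> exists2 P : mpoly N R,
    (degp P <= c * m ^ 2)%N &
    forall x, box 0 rho x -> (forall j : 'I_N, (i <= j)%N -> x 0 j = z 0 j) ->
      `|f x - evalp P x| <= C * A / m%:R ^+ r.
Proof.
elim: i r => [|i ih] r iN.
  exists 0, 0%N, 0%N; split => // f A _ _ m m0 z zr; exists (mpolyC N (f z)); first exact: degpC.
  move=> x xr xz; have -> : x = z by apply/rowP => j; exact: xz.
  by rewrite evalpC subrr normr0 !mul0r.
have [C [mu [c [C0 H]]]] := ih (r + 2)%N (ltnW iN).
pose k : 'I_N := Ordinal iN.
pose Cl := (4 * rho + 1) ^+ r : R.
have Cl0 : 0 <= Cl by rewrite exprn_ge0// addr_ge0// mulr_ge0// ltW.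
exists ((2 * rho) ^+ r + 2 * r%:R * C * Cl), (r + mu)%N, (c + 1 + r)%N; split.
  by rewrite addr_ge0 ?exprn_ge0 ?mulr_ge0// ltW.
move=> f A sf fA m m0 z zr.
have m20 : (0 < m ^ 2)%N by rewrite expn_gt0 m0.
have [t [l [tr sl lb lA]]] := jackson_itv r rho0 m0.
have zk j : (j < (m ^ 2).+1)%N -> box 0 rho (setc z k (t j)).
  by move=> jm; apply: box_setc => //; rewrite mxE subr0 tr.
have /choice[P0 HP0] : forall sj : nat * nat, exists P : mpoly N R, (sj.1 < r)%N -> (sj.2 < (m ^ 2).+1)%N ->
    (degp P <= c * m ^ 2)%N /\
    forall x, box 0 rho x -> (forall j : 'I_N, (i <= j)%N -> x 0 j = setc z k (t sj.2) 0 j) ->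
      `|partials (nseq sj.1 k) f x - evalp P x| <= C * A / m%:R ^+ (r + 2).
  move=> [s j]/=; have [sr|] := pselect ((s < r)%N /\ (j < (m ^ 2).+1)%N); last first.
    by move=> h; exists 0 => sr jm; case: h.
  suff bp : bounded_partials i mu A (partials (nseq s k) f).
    have [P dP PA] := H _ A (smooth_partials _ sf) bp m m0 _ (zk j sr.2).
    by exists P.
  move=> s' so al sz x xr; rewrite -partials_cat; apply: fA => //.
  - move: so al; elim: s' {sz} => [_ _|a s' ihs] /=.
      by case: s sr => [//|s] _; elim: s => //= s ->; rewrite leqnn.
    rewrite (path_sortedE (fun a b c h1 h2 => leq_trans h1 h2))//.
    rewrite (path_sortedE (fun a b c h1 h2 => leq_trans h1 h2))//.
    move=> /andP[a1 a2] /andP[a3 a4]; rewrite ihs// andbT all_cat a1/=.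
    by apply/allP => b /nseqP[-> _] /=; rewrite ltnW.
  - rewrite all_cat; apply/andP; split.
      by apply: sub_all al => b /= /leqW.
    by apply/allP => b /nseqP[-> _] /=.
  - by rewrite size_cat size_nseq addnC leq_add// ltnW//; case: sr.
have A0 : 0 <= A.
  by have := fA [::] isT isT isT z zr; apply: le_trans.
exists (\sum_(s < r) \sum_(j < (m ^ 2).+1) substp k (t j) (P0 (val s, val j)) * polyk k (l s j)).
  apply: degp_sum => s _; apply: degp_sum => j _.
  rewrite -addnA mulnDl; apply: degpM.
    by apply: degp_substp; case: (HP0 (val s, val j) (ltn_ord _) (ltn_ord _)).
  apply: degp_polyk; rewrite (leq_trans (sl _ _))// addnS ltnS mulnDl mul1n leq_add2l.
  by rewrite leq_pmulr.
move=> x xr xz.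
have xk : `|x 0 k| <= rho by have := xr k; rewrite mxE subr0.
have e1 := lA (fun s u => partials (nseq s k) f (setc x k u)) A.
have {e1} : `|partials (nseq 0 k) f (setc x k (x 0 k)) -
    \sum_(s < r) \sum_(j < (m ^ 2).+1) partials (nseq s k) f (setc x k (t j)) * (l s j).[x 0 k]| <=
    (2 * rho) ^+ r * A / m%:R ^+ r.
  apply: e1 => //.
  - move=> s u sr ur; exact: is_derive_line ((sf (nseq s k)).2 k (setc x k u)).
  - move=> u ur; apply: fA.
    + by case: (r) => [//|r']; elim: r' => //= r' ->; rewrite leqnn.
    + by apply/allP => b /nseqP[-> _] /=.
    + by rewrite size_nseq leq_addr.
    + by apply: box_setc => //; rewrite mxE subr0.
rewrite setc_id [partials (nseq 0 k) f x]/= => e1.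
set S1 := \sum_(s < r) _ in e1.
have e2 : `|S1 - evalp (\sum_(s < r) \sum_(j < (m ^ 2).+1) substp k (t j) (P0 (val s, val j)) * polyk k (l s j)) x|
    <= 2 * r%:R * C * Cl * A / m%:R ^+ r.
  rewrite evalp_sum /S1 -sumrB (le_trans (ler_norm_sum _ _ _))//.
  apply: (@le_trans _ _ (\sum_(s < r) \sum_(j < (m ^ 2).+1) C * A / m%:R ^+ (r + 2) * Cl)).
    apply: ler_sum => s _; rewrite evalp_sum -sumrB (le_trans (ler_norm_sum _ _ _))//.
    apply: ler_sum => j _; rewrite evalpM evalp_substp evalp_polyk -mulrBl normrM.
    apply: ler_pM => //; last exact: lb.
    have [_ h] := HP0 (val s, val j) (ltn_ord _) (ltn_ord _).
    apply: h.
      by apply: box_setc => //; rewrite mxE subr0 tr.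
    move=> a ia; rewrite !setcE; case: eqP => // ak; apply: xz.
    by rewrite ltn_neqAle ia andbT; apply/eqP => e; apply: ak; apply/val_inj.
  rewrite !sumr_const !card_ord -mulrnA -[leLHS]mulr_natl natrM -[(m ^ 2).+1%:R]natr1 natrX.
  set a := m%:R; have a1 : 1 <= a by rewrite ler1n.
  have a0 : a != 0 by rewrite gt_eqF// (lt_le_trans ltr01).
  rewrite exprD.
  have -> : (a ^+ 2 + 1) * r%:R * (C * A / (a ^+ r * a ^+ 2) * Cl) =
     r%:R * C * Cl * A / a ^+ r * (1 + a ^- 2) by field; rewrite a0 expf_neq0.
  have -> : 2 * r%:R * C * Cl * A / a ^+ r = r%:R * C * Cl * A / a ^+ r * 2.
    by field; rewrite expf_neq0.
  have B0 : 0 <= r%:R * C * Cl * A / a ^+ r.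
    by apply: divr_ge0; [rewrite mulr_ge0// mulr_ge0// mulr_ge0|rewrite exprn_ge0].
  rewrite ler_wpM2l//.
  by rewrite (_ : 2 = 1 + 1)// lerD2l invf_le1 ?exprn_gt0 ?(lt_le_trans ltr01)// exprn_ege1.
rewrite -(subrK S1 (f x)) -addrA (le_trans (ler_normD _ _))//.
by rewrite (le_trans (lerD e1 e2))// -mulrDl -mulrDl.
Qed.

(** The degree is at most c m^2, whence the exponent 2 r and the choice of the
    largest m with (c + 1) m^2 <= n. *)
Lemma jackson r : exists (C : R) (mu : nat), 0 <= C /\
  forall f A, smooth f -> bounded_partials N mu A f ->
  forall n, (0 < n)%N -> exists2 P : mpoly N R,
    (degp P <= n)%N & forall x, box 0 rho x -> `|f x - evalp P x| <= C * A / n%:R ^+ r.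
Proof.
have [C [mu [c [C0 H]]]] := jackson_partial (2 * r) (leqnn N).
pose c1 := c.+1.
exists ((4 * c1%:R) ^+ r * (C + 1)), mu; split.
  by rewrite mulr_ge0 ?exprn_ge0 ?mulr_ge0 ?addr_ge0.
move=> f A sf fA n n0.
have z0 : box 0 rho (0 : 'rV[R]_N) by apply: box_center; exact: ltW.
have A0 : 0 <= A by apply: le_trans (fA [::] isT isT isT 0 z0).
have nR : 0 < n%:R :> R by rewrite ltr0n.
have [nc|nc] := ltnP n c1.
  exists 0; first exact: degp0.
  move=> x xr; rewrite evalp0 subr0 (le_trans (fA [::] isT isT isT x xr))//.
  rewrite ler_pdivlMr ?exprn_gt0// mulrC ler_wpM2r//.
  apply: (@le_trans _ _ ((4 * c1%:R) ^+ r * 1)); last first.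
    by rewrite ler_wpM2l ?exprn_ge0 ?mulr_ge0// lerDr.
  rewrite mulr1 lerXn2r ?nnegrE ?mulr_ge0//.
  by rewrite -natrM ler_nat (leq_trans (ltnW nc))// leq_pmull.
have ex1 : exists m, (c1 * m ^ 2 <= n)%N by exists 0%N; rewrite exp0n// muln0.
have bd m : (c1 * m ^ 2 <= n)%N -> (m <= n)%N.
  move=> h; apply: leq_trans h; apply: (@leq_trans (m ^ 2)%N); last by rewrite leq_pmull.
  by case: m => // m; rewrite -[X in (X <= _)%N]expn1 leq_pexp2l.
case: (ex_maxnP ex1 bd) => m cm mmax.
have m0 : (0 < m)%N by apply: mmax; rewrite exp1n muln1.
have nm : (n <= 4 * c1 * m ^ 2)%N.
  apply: ltnW; rewrite ltnNge; apply/negP => h.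
  have := mmax (2 * m)%N; rewrite expnMn mulnA [(c1 * _)%N]mulnC => /(_ h).
  by rewrite mul2n -addnn -[X in (_ <= X)%N -> _]addn0 leq_add2l leqNgt m0.
have [P dP PA] := H f A sf fA m m0 0 z0.
exists P.
  by rewrite (leq_trans dP)// (leq_trans _ cm)// leq_mul.
move=> x xr; apply: le_trans (PA x xr _) _; first by move=> j; rewrite leqNgt ltn_ord.
have mR : 0 < m%:R :> R by rewrite ltr0n.
rewrite ler_pdivrMr ?exprn_gt0// mulrAC ler_pdivlMr ?exprn_gt0// exprM.
have h1 : n%:R ^+ r <= (4 * c1%:R) ^+ r * (m%:R ^+ 2) ^+ r :> R.
  by rewrite -exprMn lerXn2r ?nnegrE ?mulr_ge0 ?exprn_ge0// -natrX -!natrM ler_nat.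
have -> : (4 * c1%:R) ^+ r * (C + 1) * A * (m%:R ^+ 2) ^+ r =
   (C + 1) * A * ((4 * c1%:R) ^+ r * (m%:R ^+ 2) ^+ r) by ring.
apply: ler_pM => //; first by rewrite mulr_ge0.
by rewrite ler_wpM2r// lerDl.
Qed.

End Jackson.

(** * A smooth bump function *)

Section Bump.
Variable R : realType.
Implicit Types (f g : R -> R) (t : R).

Fixpoint diffn n f : Prop :=
  if n is m.+1 then (forall t, derivable f t 1) /\ diffn m (fun t => 'D_1 f t) else True.

Lemma diffn_intro n f (f' : R -> R) :
  (forall t, is_derive t 1 f (f' t)) -> diffn n f' -> diffn n.+1 f.
Proof.
move=> ff' f'n; split; first by move=> t; case: (ff' t).
by rewrite (_ : (fun t => _) = f')//; apply/funext => t; case: (ff' t).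
Qed.

Lemma diffn_is_derive n f : diffn n.+1 f -> forall t, is_derive t 1 f ('D_1 f t).
Proof. by move=> [df _] t; apply: DeriveDef. Qed.

Lemma diffnW n f : diffn n.+1 f -> diffn n f.
Proof. by elim: n f => // n ih f [df dn]; split => //; exact: ih. Qed.

Lemma diffn_cst n (c : R) : diffn n (fun=> c).
Proof.
by elim: n c => // n ih c; apply: (@diffn_intro _ _ (fun=> 0)).
Qed.

Lemma diffnD n f g : diffn n f -> diffn n g -> diffn n (fun t => f t + g t).
Proof.
elim: n f g => // n ih f g fn gn.
apply: (@diffn_intro _ _ (fun t => 'D_1 f t + 'D_1 g t)); last by apply: ih; [case: fn|case: gn].
by move=> t; exact: (is_deriveD (diffn_is_derive fn t) (diffn_is_derive gn t)).
Qed.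

Lemma diffnM n f g : diffn n f -> diffn n g -> diffn n (fun t => f t * g t).
Proof.
elim: n f g => // n ih f g fn gn.
apply: (@diffn_intro _ _ (fun t => f t * 'D_1 g t + g t * 'D_1 f t)).
  by move=> t; exact: (is_deriveM (diffn_is_derive fn t) (diffn_is_derive gn t)).
by apply: diffnD; apply: ih; [exact: diffnW|case: gn|exact: diffnW|case: fn].
Qed.

Lemma diffnV n f : (forall t, f t != 0) -> diffn n f -> diffn n (fun t => (f t)^-1).
Proof.
move=> f0; elim: n f f0 => // n ih f f0 fn.
apply: (@diffn_intro n (fun t => (f t)^-1) (fun t => (-1 * 'D_1 f t) * ((f t)^-1 * (f t)^-1))).
  move=> t; have d := is_deriveV (f0 t) (diffn_is_derive fn t).
  by apply: (is_derive_eq d); rewrite /GRing.scale/= expr2 invfM; ring.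
apply: diffnM; first by apply: diffnM; [exact: diffn_cst|case: fn].
by apply: diffnM; apply: ih => //; exact: diffnW.
Qed.

Lemma is_derive_affine a b t : is_derive t 1 (fun t => a * t + b) (a : R).
Proof.
rewrite (_ : (fun t => _) = horner (a *: 'X + b%:P)).
  by apply: trigger_derive; rewrite derivD derivZ derivX derivC addr0 hornerZ hornerC mulr1.
by apply/funext => z; rewrite !hornerE.
Qed.

Lemma diffn_affine n f (a b : R) : diffn n f -> diffn n (fun t => f (a * t + b)).
Proof.
elim: n f => // n ih f fn.
apply: (@diffn_intro _ _ (fun t => a * 'D_1 f (a * t + b))); last first.
  by apply: diffnM; [exact: diffn_cst|apply: (ih (fun t => 'D_1 f t)); case: fn].
move=> t; have d := @is_derive1_comp R f (fun t => a * t + b) t _ _ (diffn_is_derive fn (a * t + b)) (is_derive_affine a b t).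
by apply: (is_derive_eq d); rewrite /GRing.scale/= mulrC.
Qed.

(** The flat function exp (- 1 / t) and the functions p (1 / t) exp (- 1 / t),
    a class stable by derivation. *)
Definition flat (p : {poly R}) t : R := if 0 < t then p.[t^-1] * expR (- t^-1) else 0.

Lemma poly_le_expR (p : {poly R}) : exists2 C, 0 <= C & forall u, 0 <= u -> `|p.[u]| <= C * expR u.
Proof.
exists (\sum_(i < size p) `|p`_i| * i`!%:R); first by apply: sumr_ge0 => i _; rewrite mulr_ge0.
move=> u u0; rewrite horner_coef mulr_suml (le_trans (ler_norm_sum _ _ _))//.
apply: ler_sum => i _; rewrite normrM -mulrA ler_wpM2l// normrX (ger0_norm u0).
case: (nat_of_ord i) => [|j].
  by rewrite expr0 fact0 mul1r (le_trans _ (expR_ge1Dx u))// lerDl.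
have f0 : 0 < (j.+1)`!%:R :> R by rewrite ltr0n fact_gt0.
rewrite mulrC -ler_pdivrMr//.
by rewrite (le_trans _ (expR_ge1Dxn j u0))// lerDr.
Qed.

Lemma is_derive_flat (p : {poly R}) t :
  is_derive t 1 (flat p) (flat ('X^2 * (p - p^`())) t).
Proof.
have [t0|t0|->] := ltgtP t 0.
- apply: is_derive_approx => eps eps0; exists (fun=> 0), 0; split.
  + exact: is_derive_cst.
  + by rewrite /flat ltNge (ltW t0) subrr normr0 ltW.
  exists (- t); first by rewrite oppr_gt0.
  move=> h; rewrite ler_norml opprK => /andP[_ ht].
  rewrite /flat !ltNge (ltW t0)/= (_ : t + h <= 0)/=; last by rewrite -lerBrDl sub0r.
  by rewrite !subrr normr0 mulr_ge0// ltW.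
- apply: is_derive_approx => eps eps0.
  exists (fun t => p.[t^-1] * expR (- t^-1)), (flat ('X^2 * (p - p^`())) t); split.
  + have tn0 : t != 0 by rewrite gt_eqF.
    have dV : is_derive t 1 (fun t : R => t^-1) (- t ^- 2).
      have := @is_deriveV R id t 1 1 tn0 (is_derive_id t 1).
      by rewrite /GRing.scale/= mulr1.
    have dN : is_derive t 1 (fun t : R => - t^-1) (t ^- 2).
      have := is_deriveN dV; by rewrite opprK.
    have d1 := is_derive1_comp (is_derive_poly p t^-1) dV.
    have d2 := @is_derive1_comp R expR (fun t => - t^-1) t _ _ (is_derive_expR (- t^-1)) dN.
    have d3 := is_deriveM d1 d2.
    apply: (is_derive_eq d3).
    rewrite /flat t0 /GRing.scale/= !hornerE/= -exprVn; ring.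
  + by rewrite subrr normr0 ltW.
  exists (t / 2); first by rewrite divr_gt0.
  move=> h; rewrite ler_norml => /andP[ht _].
  rewrite /flat t0 (_ : 0 < t + h); last by lra.
  by rewrite subrr normr0 mulr_ge0// ltW.
have [C C0 HC] := poly_le_expR ('X^2 * p).
apply: is_derive_approx => eps eps0; exists (fun=> 0), 0; split.
- exact: is_derive_cst.
- by rewrite /flat ltxx subrr normr0 ltW.
have C1 : 0 < C + 1 by rewrite ltr_wpDl.
exists (eps / (C + 1)); first by rewrite divr_gt0.
move=> h he; rewrite add0r /flat ltxx !subr0.
case: ifPn => [h0|_]; last by rewrite normr0 mulr_ge0// ltW.
have hn0 : h != 0 by rewrite gt_eqF.
have := HC h^-1 _; rewrite !hornerE/= normrM => /(_ (ltW _)).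
rewrite invr_gt0 h0 => /(_ isT) H.
rewrite normrM [`|expR _|]ger0_norm ?expR_ge0// expRN.
rewrite ler_pdivrMr ?expR_gt0//.
have h2 : `|p.[h^-1]| <= C * h ^+ 2 * expR h^-1.
  move: H; rewrite normrX normfV (gtr0_norm h0) exprVn mulrC.
  rewrite ler_pdivrMr ?exprn_gt0// => /le_trans; apply.
  by rewrite mulrAC.
apply: (le_trans h2); rewrite ler_wpM2r ?expR_ge0// (gtr0_norm h0).
rewrite expr2 mulrA ler_wpM2r ?(ltW h0)//.
rewrite (gtr0_norm h0) ler_pdivlMr// in he.
by apply: le_trans he; rewrite mulrC ler_wpM2l ?(ltW h0)// lerDl.
Qed.

Lemma diffn_flat n p : diffn n (flat p).
Proof.
elim: n p => // n ih p; apply: diffn_intro (ih _) => t; exact: is_derive_flat.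
Qed.

Lemma flat1_ge0 t : 0 <= flat 1 t.
Proof. by rewrite /flat; case: ifP => // _; rewrite hornerC mul1r expR_ge0. Qed.

Lemma flat1_gt0 t : 0 < t -> 0 < flat 1 t.
Proof. by rewrite /flat => ->; rewrite hornerC mul1r expR_gt0. Qed.

Lemma flat1_eq0 t : t <= 0 -> flat 1 t = 0.
Proof. by rewrite /flat ltNge => ->. Qed.

Definition step t : R := flat 1 t * (flat 1 t + flat 1 (-1 * t + 1))^-1.

Lemma step_den t : 0 < flat 1 t + flat 1 (-1 * t + 1).
Proof.
have [t0|t0] := ltP 0 t; first by rewrite ltr_pwDl ?flat1_gt0 ?flat1_ge0.
by rewrite ltr_wpDl ?flat1_ge0 ?flat1_gt0//; lra.
Qed.

Lemma diffn_step n : diffn n step.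
Proof.
apply: diffnM; first exact: diffn_flat.
apply: diffnV => [t|]; first by rewrite gt_eqF ?step_den.
by apply: diffnD; [exact: diffn_flat|apply: (@diffn_affine _ (flat 1)); exact: diffn_flat].
Qed.

Lemma step_le0 t : t <= 0 -> step t = 0.
Proof. by move=> t0; rewrite /step flat1_eq0// mul0r. Qed.

Lemma step_ge1 t : 1 <= t -> step t = 1.
Proof.
move=> t1; rewrite /step [flat 1 (_ + _)]flat1_eq0 ?addr0; last lra.
by rewrite divff// gt_eqF// flat1_gt0// (lt_le_trans ltr01).
Qed.

(** A difference of two translates of the step, so that the sum of the integer
    translates telescopes to 1. *)
Definition bump0 t : R := step t + -1 * step (1 * t + -1).

Lemma diffn_bump0 n : diffn n bump0.
Proof.
apply: diffnD; first exact: diffn_step.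
apply: diffnM; first exact: diffn_cst.
by apply: (@diffn_affine _ step); exact: diffn_step.
Qed.

Lemma sum_bump0 L t : 1 <= t <= L%:R -> \sum_(a < L) bump0 (t - a%:R) = 1.
Proof.
move=> /andP[t1 tL].
have -> : \sum_(a < L) bump0 (t - a%:R) = step t - step (t - L%:R).
  elim: L {tL} => [|L ih]; first by rewrite big_ord0 subr0 subrr.
  rewrite big_ord_recr/= ih /bump0 mulN1r addrA subrK -natr1.
  by congr (_ - step _); ring.
by rewrite step_ge1// step_le0 ?subr0// subr_le0.
Qed.

Definition bumpd n : R -> R := iter n (fun f t => 'D_1 f t) bump0.

Lemma diffn_bump n k : diffn k (bumpd n).
Proof.
have : diffn (n + k) bump0 by exact: diffn_bump0.
rewrite /bumpd; elim: n k => // n ih k h.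
have := ih k.+1; rewrite addnS -addSn => /(_ h) [] //.
Qed.

Lemma is_derive_bump n t : is_derive t 1 (bumpd n) (bumpd n.+1 t).
Proof. exact: diffn_is_derive (diffn_bump n 1) t. Qed.

Lemma bump_out n t : ~~ (0 <= t <= 2) -> bumpd n t = 0.
Proof.
elim: n t => [|n ih] t.
  rewrite negb_and -!ltNge => /orP[t0|t2]; rewrite /bumpd/= /bump0.
    by rewrite !step_le0//; lra.
  by rewrite !step_ge1//; lra.
move=> t02; suff : is_derive t 1 (bumpd n) 0 by case.
apply: is_derive_approx => eps eps0; exists (fun=> 0), 0; split.
- exact: is_derive_cst.
- by rewrite subrr normr0 ltW.
have tout : t < 0 \/ 2 < t by move: t02; rewrite negb_and -!ltNge => /orP.
exists (if t < 0 then - t / 2 else (t - 2) / 2).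
  case: ifPn => [h|/negbTE h]; first lra.
  by case: tout; rewrite ?h// => ?; lra.
move=> h ht; rewrite !ih//.
  by rewrite !subrr normr0 mulr_ge0// ltW.
rewrite negb_and -!ltNge; move: ht; rewrite ler_norml.
case: ifPn => [h0 /andP[? ?]|/negbTE h0 /andP[? ?]]; first by apply/orP; left; lra.
by apply/orP; right; case: tout; rewrite ?h0// => ?; lra.
Qed.

Lemma bump_bounded n : exists2 C, 0 <= C & forall t, `|bumpd n t| <= C.
Proof.
have c : {within `[0, 2], continuous (fun t => `|bumpd n t|)}.
  apply: continuous_subspaceT => t.
  apply: (@continuous_comp _ _ _ (bumpd n) (fun u : R => `|u|)); last exact: norm_continuous.
  apply: differentiable_continuous; apply/derivable1_diffP.
  by case: (is_derive_bump n t).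
have [c0 _ Hc] := EVT_max (ler0n R 2) c.
exists `|bumpd n c0| => // t; have [t02|/bump_out ->] := boolP (0 <= t <= 2).
  by apply: Hc; rewrite in_itv.
by rewrite normr0.
Qed.

End Bump.

(** * Cutting off a polynomial near a set *)

Section SmoothAlgebra.
Variables (R : realType) (n : nat).
Implicit Types (f g : 'rV[R]_n -> R) (x : 'rV[R]_n).

(** The closure of the smooth functions under sums and products is stable by
    derivation, so that smooth_family applies to it. *)
Inductive smooth_alg : ('rV[R]_n -> R) -> Prop :=
| Smooth_base f : smooth f -> smooth_alg f
| Smooth_add f g : smooth_alg f -> smooth_alg g -> smooth_alg (fun x => f x + g x)
| Smooth_mul f g : smooth_alg f -> smooth_alg g -> smooth_alg (fun x => f x * g x).

Lemma derive_add f g i x : derivable f x 'e_i -> derivable g x 'e_i ->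
  derivable (fun x => f x + g x) x 'e_i /\
  'D_'e_i (fun x => f x + g x) x = 'D_'e_i f x + 'D_'e_i g x.
Proof. by move=> df dg; split; [exact: (derivableD df dg)|exact: (deriveD df dg)]. Qed.

Lemma derive_mul f g i x : derivable f x 'e_i -> derivable g x 'e_i ->
  derivable (fun x => f x * g x) x 'e_i /\
  'D_'e_i (fun x => f x * g x) x = f x * 'D_'e_i g x + g x * 'D_'e_i f x.
Proof. by move=> df dg; split; [exact: (derivableM df dg)|exact: (deriveM df dg)]. Qed.

Lemma smooth_alg_smooth f : smooth_alg f -> smooth f.
Proof.
move: f; apply: smooth_family => f; elim=> {f} [f sf|f g sf [cf df] sg [cg dg]|f g sf [cf df] sg [cg dg]].
- split; first by case: (sf [::]).
  move=> i; split; first by move=> x; case: (sf [::]).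
  by apply: Smooth_base; exact: (smooth_partials [:: i] sf).
- split; first by move=> x; apply: continuousD; [exact: cf|exact: cg].
  move=> i; split; first by move=> x; apply: (derive_add ((df i).1 x) ((dg i).1 x)).1.
  rewrite (_ : (fun x => _) = (fun x => 'D_'e_i f x + 'D_'e_i g x)).
    by apply: Smooth_add; [case: (df i)|case: (dg i)].
  by apply/funext => x; exact: (derive_add ((df i).1 x) ((dg i).1 x)).2.
- split; first by move=> x; apply: continuousM; [exact: cf|exact: cg].
  move=> i; split; first by move=> x; apply: (derive_mul ((df i).1 x) ((dg i).1 x)).1.
  rewrite (_ : (fun x => _) = (fun x => f x * 'D_'e_i g x + g x * 'D_'e_i f x)).
    by apply: Smooth_add; apply: Smooth_mul => //; [case: (dg i)|case: (df i)].
  by apply/funext => x; exact: (derive_mul ((df i).1 x) ((dg i).1 x)).2.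
Qed.

Lemma smoothD f g : smooth f -> smooth g -> smooth (fun x => f x + g x).
Proof. by move=> sf sg; apply/smooth_alg_smooth/Smooth_add; apply: Smooth_base. Qed.

Lemma smoothM f g : smooth f -> smooth g -> smooth (fun x => f x * g x).
Proof. by move=> sf sg; apply/smooth_alg_smooth/Smooth_mul; apply: Smooth_base. Qed.

Lemma partials_cst s (c : R) :
  partials s (fun _ : 'rV[R]_n => c) = fun=> if s is [::] then c else 0.
Proof.
elim: s => [//|i s ih]; apply/funext => x /=; rewrite ih.
by case: s {ih} => [|j s]; rewrite derive_cst.
Qed.

Lemma smooth_cst (c : R) : smooth (fun _ : 'rV[R]_n => c).
Proof.
move=> s; rewrite partials_cst; split; first by move=> x; exact: cst_continuous.
by move=> i x; exact: derivable_cst.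
Qed.

Lemma smooth_sum (I : Type) (r : seq I) (F : I -> 'rV[R]_n -> R) :
  (forall i, smooth (F i)) -> smooth (fun x => \sum_(i <- r) F i x).
Proof.
move=> sF; elim: r => [|i r ih].
  by rewrite (_ : (fun x => _) = fun=> 0); [exact: smooth_cst|apply/funext => x; rewrite big_nil].
rewrite (_ : (fun x => _) = fun x => F i x + \sum_(i <- r) F i x); first exact: (smoothD (sF i) ih).
by apply/funext => x; rewrite big_cons.
Qed.

Lemma smooth_prod (I : Type) (r : seq I) (F : I -> 'rV[R]_n -> R) :
  (forall i, smooth (F i)) -> smooth (fun x => \prod_(i <- r) F i x).
Proof.
move=> sF; elim: r => [|i r ih].
  by rewrite (_ : (fun x => _) = fun=> 1); [exact: smooth_cst|apply/funext => x; rewrite big_nil].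
rewrite (_ : (fun x => _) = fun x => F i x * \prod_(i <- r) F i x); first exact: (smoothM (sF i) ih).
by apply/funext => x; rewrite big_cons.
Qed.

Lemma partialsD s f g : smooth f -> smooth g ->
  partials s (fun x => f x + g x) = fun x => partials s f x + partials s g x.
Proof.
move=> sf sg; elim: s => [//|i s ih]; apply/funext => x /=; rewrite ih.
by rewrite (derive_add ((sf s).2 i x) ((sg s).2 i x)).2.
Qed.

Lemma partials_sum s (I : Type) (r : seq I) (F : I -> 'rV[R]_n -> R) :
  (forall i, smooth (F i)) ->
  partials s (fun x => \sum_(i <- r) F i x) = fun x => \sum_(i <- r) partials s (F i) x.
Proof.
move=> sF; elim: r => [|i r ih].
  rewrite (_ : (fun x => _) = fun=> 0); last by apply/funext => x; rewrite big_nil.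
  by rewrite partials_cst; apply/funext => x; rewrite big_nil; case: s.
rewrite (_ : (fun x => _) = fun x => F i x + \sum_(i <- r) F i x); last first.
  by apply/funext => x; rewrite big_cons.
rewrite partialsD//; last exact: smooth_sum.
by rewrite ih; apply/funext => x; rewrite big_cons.
Qed.

Lemma partials_rcons s i f : partials (rcons s i) f = partials s (fun x => 'D_'e_i f x).
Proof. by rewrite -cats1 partials_cat. Qed.

(** A crude Leibniz rule, by induction on the derivation that is applied
    first. *)
Lemma partials_mul_le s f g (a b : R) x : smooth f -> smooth g ->
  (forall s', (size s' <= size s)%N -> `|partials s' f x| <= a) ->
  (forall s', (size s' <= size s)%N -> `|partials s' g x| <= b) ->
  `|partials s (fun x => f x * g x) x| <= 2 ^+ size s * (a * b).
Proof.
elim/last_ind: s f g a b => [|s i ih] f g a b sf sg fa gb.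
  by rewrite /= mul1r normrM ler_pM//; [exact: (fa [::])|exact: (gb [::])].
have df : smooth (fun x => 'D_'e_i f x) by exact: (smooth_partials [:: i] sf).
have dg : smooth (fun x => 'D_'e_i g x) by exact: (smooth_partials [:: i] sg).
rewrite partials_rcons.
rewrite (_ : (fun x => 'D_'e_i _ x) = fun x => f x * 'D_'e_i g x + g x * 'D_'e_i f x); last first.
  by apply/funext => y; exact: (derive_mul ((sf [::]).2 i y) ((sg [::]).2 i y)).2.
rewrite partialsD; [|exact: smoothM|exact: smoothM].
rewrite (le_trans (ler_normD _ _))//.
have E : 2 ^+ size (rcons s i) * (a * b) = 2 ^+ size s * (a * b) + 2 ^+ size s * (b * a).
  by rewrite size_rcons exprS; ring.
rewrite E lerD//; apply: ih => // s' ss'; rewrite -?partials_rcons.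
- by apply: fa; rewrite size_rcons leqW.
- by apply: gb; rewrite !size_rcons.
- by apply: gb; rewrite size_rcons leqW.
- by apply: fa; rewrite !size_rcons.
Qed.

Lemma partials_prod_le mu (I : Type) (l : seq I) (F : I -> 'rV[R]_n -> R) (B : I -> R) x :
  (forall i, smooth (F i)) ->
  (forall i s, (size s <= mu)%N -> `|partials s (F i) x| <= B i) ->
  forall s, (size s <= mu)%N ->
  `|partials s (fun x => \prod_(i <- l) F i x) x| <= (2 ^+ mu) ^+ size l * \prod_(i <- l) B i.
Proof.
move=> sF FB; elim: l => [|i l ih] s smu.
  rewrite (_ : (fun x => _) = fun=> 1); last by apply/funext => y; rewrite big_nil.
  by rewrite partials_cst big_nil mulr1 expr0; case: s {smu} => [|? ?]; rewrite ?normr1 ?normr0.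
rewrite (_ : (fun x => _) = fun x => F i x * \prod_(i <- l) F i x); last first.
  by apply/funext => y; rewrite big_cons.
have B0 : 0 <= B i by exact: le_trans (FB i [::] isT).
have p0 := le_trans (normr_ge0 _) (ih [::] isT).
apply: (@le_trans _ _ (2 ^+ size s * (B i * ((2 ^+ mu) ^+ size l * \prod_(i <- l) B i)))).
  apply: partials_mul_le => //; first exact: smooth_prod.
  - by move=> s' s's; apply: FB; rewrite (leq_trans s's).
  - by move=> s' s's; apply: ih; rewrite (leq_trans s's).
rewrite big_cons /= exprS (_ : 2 ^+ mu * _ * _ = 2 ^+ mu * (B i * ((2 ^+ mu) ^+ size l * \prod_(i <- l) B i))); last by ring.
by rewrite ler_wpM2r ?(mulr_ge0 B0 p0)// ler_weXn2l// ler1n.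
Qed.

Lemma lists_bounded mu (F : seq 'I_n -> R) :
  exists b, forall s, (size s <= mu)%N -> F s <= b.
Proof.
elim: mu F => [|mu ih] F; first by exists (F [::]) => -[].
have /choice[b Hb] : forall i, exists b, forall s, (size s <= mu)%N -> F (i :: s) <= b.
  by move=> i; exact: ih.
exists (`|F [::]| + \sum_i `|b i|) => -[_|i s] /=.
  by rewrite (le_trans (ler_norm _))// lerDl sumr_ge0.
rewrite ltnS => /Hb/le_trans; apply; rewrite (le_trans (ler_norm _))//.
by rewrite ler_wpDl// (bigD1 i)//= lerDl sumr_ge0.
Qed.

(** A class of functions of one coordinate that is stable by derivation; a
    derivation in another coordinate gives c = 0. *)
Definition coordbump (c D a : R) (q : nat) (i : 'I_n) x : R := c * @bumpd R q (D * x 0 i + a).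

Lemma continuous_bump q : continuous (@bumpd R q).
Proof.
move=> t; apply: differentiable_continuous; apply/derivable1_diffP.
by case: (@is_derive_bump R q t).
Qed.

Lemma derive_coordbump c D a q i j x :
  derivable (coordbump c D a q i) x 'e_j /\
  'D_'e_j (coordbump c D a q i) x = coordbump (if j == i then c * D else 0) D a q.+1 i x.
Proof.
suff [d1 d2] : is_derive (x 0 j) 1 (fun t => coordbump c D a q i (setc x j t))
    (coordbump (if j == i then c * D else 0) D a q.+1 i x).
  by split; [exact/derivable_line|rewrite derive_line].
have [->|ji] := eqVneq j i.
  rewrite (_ : (fun t => _) = fun t => c * @bumpd R q (D * t + a)); last first.
    by apply/funext => t; rewrite /coordbump setcE eqxx.
  have d := @is_derive1_comp R (@bumpd R q) (fun t => D * t + a) (x 0 i) _ _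
    (@is_derive_bump R q (D * x 0 i + a)) (is_derive_affine D a (x 0 i)).
  have d' := is_deriveZ c d.
  by apply: (is_derive_eq d'); rewrite /coordbump /GRing.scale/=; ring.
rewrite (_ : (fun t => _) = fun=> coordbump c D a q i x); last first.
  by apply/funext => t; rewrite /coordbump setcE eq_sym (negbTE ji).
by rewrite {2}/coordbump mul0r; exact: is_derive_cst.
Qed.

Lemma continuous_coordbump c D a q i : continuous (coordbump c D a q i).
Proof.
have h : continuous (fun x : 'rV[R]_n => D * x 0 i + a).
  move=> x; apply: (continuousD (f := fun x : 'rV[R]_n => D * x 0 i) (g := cst a)); last exact: cst_continuous.
  by apply: continuousM; [exact: cst_continuous|exact: coord_continuous].
move=> x; apply: (continuousM (s := cst c) (t := fun x : 'rV[R]_n => bumpd q (D * x 0 i + a))).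
  exact: cst_continuous.
apply: (@continuous_comp _ _ _ (fun x : 'rV[R]_n => D * x 0 i + a) (@bumpd R q)); first exact: h.
exact: continuous_bump.
Qed.

Lemma smooth_coordbump c D a q i : smooth (coordbump c D a q i).
Proof.
apply: (@smooth_family R n [set f | exists c q, f = coordbump c D a q i]); last by exists c, q.
move=> _ [c' [q' ->]]; split; first exact: continuous_coordbump.
move=> j; split; first by move=> x; case: (derive_coordbump c' D a q' i j x).
exists (if j == i then c' * D else 0), q'.+1; apply/funext => x.
by case: (derive_coordbump c' D a q' i j x).
Qed.

Lemma partials_coordbump s c D a q i : 0 <= D -> exists2 c', `|c'| <= `|c| * D ^+ size s &
  partials s (coordbump c D a q i) = coordbump c' D a (q + size s) i.
Proof.
move=> D0; elim: s => [|j s [c' c'c ih]]; first by exists c; rewrite ?mulr1 ?addn0.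
exists (if j == i then c' * D else 0).
  case: eqP => _; last by rewrite normr0 mulr_ge0 ?exprn_ge0.
  by rewrite normrM (ger0_norm D0) /= exprSr mulrA ler_wpM2r.
rewrite /= ih addnS; apply/funext => x.
by case: (derive_coordbump c' D a (q + size s) i j x).
Qed.

End SmoothAlgebra.

Section Cutoff.
Variables (R : realType) (m : nat).
Implicit Types (y : 'rV[R]_m).

(** The bumps of a grid of mesh 1 / D, which form a partition of unity where
    the grid is large enough. *)
Definition cell (L : nat) (D : R) (a : {ffun 'I_m -> 'I_(2 * L).+1}) y : R :=
  \prod_i coordbump 1 D (L%:R - (a i)%:R) 0 i y.

Lemma smooth_cell L D a : smooth (@cell L D a).
Proof. by apply: smooth_prod => i; exact: smooth_coordbump. Qed.

Lemma sum_cell L D y : (forall i, `|D * y 0 i| + 1 <= L%:R) -> \sum_a @cell L D a y = 1.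
Proof.
move=> yL; rewrite /cell.
rewrite -(bigA_distr_bigA (fun i (b : 'I_(2 * L).+1) => coordbump 1 D (L%:R - b%:R) 0 i y)) /=.
rewrite big1// => i _.
rewrite -[RHS](@sum_bump0 R (2 * L).+1 (D * y 0 i + L%:R)).
  by apply: eq_bigr => b _; rewrite /coordbump mul1r /bumpd/=; congr bump0; ring.
have := yL i; rewrite -natr1 natrM => h.
have : `|D * y 0 i| <= L%:R - 1 by lra.
by rewrite ler_norml => /andP[? ?]; apply/andP; split; lra.
Qed.

Lemma bumps_bounded mu : exists2 C, 0 <= C & forall q t, (q <= mu)%N -> `|@bumpd R q t| <= C.
Proof.
have /choice[b Hb] : forall q, exists b, 0 <= b /\ forall t, `|@bumpd R q t| <= b.
  by move=> q; have [b b0 Hb] := @bump_bounded R q; exists b.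
exists (\sum_(q < mu.+1) b q); first by apply: sumr_ge0 => q _; case: (Hb q).
move=> q t qmu; rewrite (le_trans ((Hb q).2 t))//.
rewrite (bigD1 (Ordinal (qmu : (q < mu.+1)%N)))//= lerDl sumr_ge0// => j _.
by case: (Hb j).
Qed.

Lemma partials_cell_le mu : exists2 C, 0 <= C & forall L (D : R) a y s, 1 <= D -> (size s <= mu)%N ->
  `|partials s (@cell L D a) y| <=
    if [forall i, 0 <= D * y 0 i + (L%:R - (a i)%:R) <= 2] then C * (D ^+ mu) ^+ m else 0.
Proof.
have [C C0 HC] := bumps_bounded mu.
exists ((2 ^+ mu) ^+ m * C ^+ m); first by rewrite mulr_ge0 ?exprn_ge0.
move=> L D a y s D1 smu; have D0 : 0 <= D := le_trans ler01 D1.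
pose B i : R := if 0 <= D * y 0 i + (L%:R - (a i)%:R) <= 2 then C * D ^+ mu else 0.
have := @partials_prod_le R m mu _ (index_enum 'I_m) (fun i => coordbump 1 D (L%:R - (a i)%:R) 0 i) B y _ _ s smu.
have -> : size (index_enum 'I_m) = m by rewrite -[RHS]card_ord cardE enumT [index_enum _]unlock.
move=> H; apply: le_trans (H _ _) _.
- by move=> i; exact: smooth_coordbump.
- move=> i s' s'mu; have [c' c'D ->] := partials_coordbump s' 1 (L%:R - (a i)%:R) 0 i D0.
  rewrite normr1 mul1r in c'D; rewrite /coordbump normrM add0n /B.
  case: ifPn => [_|/bump_out ->]; last by rewrite normr0 mulr0.
  rewrite mulrC ler_pM// ?HC//.
  by rewrite (le_trans c'D)// ler_weXn2l.
case: ifPn => [/forallP yin|].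
  rewrite (eq_bigr (fun=> C * D ^+ mu)) => [|i _]; last by rewrite /B yin.
  by rewrite prodr_const card_ord exprMn mulrA.
rewrite negb_forall => /existsP[i yi].
by rewrite (bigD1 i)//= {1}/B (negbTE yi) mul0r mulr0.
Qed.

(** Only the cells that meet F are kept. Such a cell stays within 2 / D of a
    point of F, where H is at most A and Markov's inequality bounds its
    derivatives; each derivative of a cell costs a factor D, and the number of
    cells is at most a power of D. *)
Lemma cutoff (rho : nat) : exists2 C : nat -> R, forall mu, 0 <= C mu &
  forall (F : set 'rV[R]_m) (D n : nat) A (H : mpoly m R), (0 < D)%N -> (0 < n)%N ->
  F `<=` box 0 rho%:R -> (degp H <= n)%N -> 0 <= A ->
  (forall y0 y, F y0 -> box y0 (2 / D%:R) y -> `|evalp H y| <= A) ->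
  exists h, [/\ smooth h, forall y, F y -> h y = evalp H y &
    forall mu s y, (size s <= mu)%N ->
      `|partials s h y| <= C mu * (n * D)%:R ^+ (m + m * mu + 3 * mu) * A].
Proof.
have /choice[K HK] : forall mu, exists C, 0 <= C /\ forall L (D : R) a y s, 1 <= D -> (size s <= mu)%N ->
  `|partials s (@cell L D a) y| <=
    if [forall i, 0 <= D * y 0 i + (L%:R - (a i)%:R) <= 2] then C * (D ^+ mu) ^+ m else 0.
  by move=> mu; have [C C0 HC] := partials_cell_le mu; exists C.
exists (fun mu => (2 * rho + 3)%:R ^+ m * 2 ^+ mu * K mu).
  by move=> mu; rewrite !mulr_ge0 ?exprn_ge0//; case: (HK mu).
move=> F D n A H D0 n0 Frho dH A0 HA.
have DR : 1 <= D%:R :> R by rewrite ler1n.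
have DR0 : 0 < D%:R :> R by rewrite ltr0n.
have nR : 1 <= n%:R :> R by rewrite ler1n.
pose L := (D * rho).+1.
pose near (a : {ffun 'I_m -> 'I_(2 * L).+1}) y := [forall i, 0 <= D%:R * y 0 i + (L%:R - (a i)%:R) <= 2].
pose J (a : {ffun 'I_m -> 'I_(2 * L).+1}) : bool := `[< exists2 y0, F y0 & near a y0 >].
pose h y := \sum_a (J a)%:R * @cell L D%:R a y * evalp H y.
have sp a : smooth (fun y => (J a)%:R * @cell L D%:R a y * evalp H y).
  apply: smoothM; last exact: smooth_evalp.
  by apply: smoothM; [exact: smooth_cst|exact: smooth_cell].
exists h; split.
- exact: smooth_sum.
- move=> y Fy; rewrite /h -mulr_suml -[RHS]mul1r; congr (_ * _).
  rewrite -[RHS](@sum_cell L D%:R y).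
    apply: eq_bigr => a _; rewrite /J; case: asboolP => [_|nJ]; first by rewrite mul1r.
    rewrite mul0r; apply/esym/eqP; rewrite -normr_le0.
    have [_ HK0] := HK 0%N; have := HK0 L D%:R a y [::] DR isT.
    by case: ifPn => // ny; case: nJ; exists y.
  move=> i; rewrite normrM ger0_norm// -natr1 lerD2r natrM ler_wpM2l//.
  by have := Frho _ Fy i; rewrite mxE subr0.
move=> mu s y smu; have [K0 HKmu] := HK mu.
rewrite /h partials_sum//.
have [b Hb] := lists_bounded mu (fun s' => `|partials s' (@evalp R m H) y|).
pose M : R := (n * D)%:R ^+ (3 * mu).
have M0 : 0 <= M by rewrite exprn_ge0.
pose B1 : R := 2 ^+ mu * (K mu * (D%:R ^+ mu) ^+ m * (M * A)).
have B10 : 0 <= B1 by rewrite !mulr_ge0 ?exprn_ge0.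
have term a : `|partials s (fun y => (J a)%:R * @cell L D%:R a y * evalp H y) y| <= B1.
  rewrite /J; case: asboolP => [[y0 Fy0 ny0]|_]; last first.
    rewrite (_ : (fun y => _) = fun=> 0); last by apply/funext => z; rewrite !mul0r.
    by rewrite partials_cst; case: (s) => [|? ?]; rewrite normr0.
  rewrite (_ : (fun y => _) = fun y => @cell L D%:R a y * evalp H y); last first.
    by apply/funext => z; rewrite mul1r.
  case: (boolP (near a y)) => [ny|nny]; last first.
    apply: (@le_trans _ _ (2 ^+ size s * (0 * b))); last by rewrite mul0r mulr0.
    apply: partials_mul_le; [exact: smooth_cell|exact: smooth_evalp| |].
      move=> s' s's; have := HKmu L D%:R a y s' DR (leq_trans s's smu).
      by rewrite -/(near a y) (negbTE nny).
    by move=> s' s's; apply: Hb; rewrite (leq_trans s's).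
  apply: (@le_trans _ _ (2 ^+ size s * (K mu * (D%:R ^+ mu) ^+ m * (M * A)))); last first.
    by rewrite ler_wpM2r ?mulr_ge0 ?exprn_ge0// ler_weXn2l// ler1n.
  apply: partials_mul_le; [exact: smooth_cell|exact: smooth_evalp| |].
    move=> s' s's; have := HKmu L D%:R a y s' DR (leq_trans s's smu).
    by rewrite -/(near a y) ny.
  move=> s' s's; rewrite partials_evalp.
  have y0y : box y0 (2 / D%:R) y.
    move=> i; move/forallP/(_ i)/andP: ny => [y1 y2]; move/forallP/(_ i)/andP: ny0 => [z1 z2].
    rewrite ler_pdivlMr// -[X in _ * X](ger0_norm (ler0n R D)) -normrM ler_norml.
    by apply/andP; split; nra.
  have := markov_box_iter s' (divr_gt0 (ltr0Sn R 1) DR0) dH (fun z hz => HA y0 z Fy0 hz) y0y.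
  move=> /le_trans; apply; rewrite ler_wpM2r//.
  have -> : 2 * n%:R ^+ 3 / (2 / D%:R) = n%:R ^+ 3 * D%:R :> R by field; rewrite gt_eqF.
  apply: (@le_trans _ _ ((n%:R ^+ 3 * D%:R) ^+ mu)).
    by rewrite ler_weXn2l ?(leq_trans s's)// mulr_ege1// exprn_ege1.
  rewrite /M exprM lerXn2r ?nnegrE ?mulr_ge0 ?exprn_ge0//.
  by rewrite natrM exprMn ler_wpM2l ?exprn_ge0// ler_eXnr.
rewrite (le_trans (ler_norm_sum _ _ _))//.
apply: (@le_trans _ _ (\sum_(a : {ffun 'I_m -> 'I_(2 * L).+1}) B1)); first exact: ler_sum.
rewrite sumr_const card_ffun !card_ord -[leLHS]mulr_natl natrX.
have L3 : (2 * L).+1%:R <= (2 * rho + 3)%:R * D%:R :> R.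
  by rewrite /L -[(2 * _).+1%:R]natr1 natrM -[(D * rho).+1%:R]natr1 natrD !natrM; lra.
have nD : D%:R <= (n * D)%:R :> R by rewrite ler_nat leq_pmull.
apply: (@le_trans _ _ (((2 * rho + 3)%:R * D%:R) ^+ m * B1)).
  by rewrite ler_wpM2r// lerXn2r ?nnegrE ?mulr_ge0.
have e : ((2 * rho + 3)%:R * D%:R) ^+ m * B1 =
   (2 * rho + 3)%:R ^+ m * 2 ^+ mu * K mu * (D%:R ^+ m * (D%:R ^+ mu) ^+ m * M) * A.
  by rewrite /B1 exprMn; ring.
rewrite e ler_wpM2r// ler_wpM2l ?mulr_ge0 ?exprn_ge0//.
rewrite [leRHS]exprD [X in _ <= X * _]exprD -/M ler_wpM2r// -exprM [(mu * m)%N]mulnC.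
by rewrite ler_pM ?exprn_ge0// lerXn2r ?nnegrE.
Qed.

End Cutoff.

(** * Polynomials of degree less than d in x_k, and reduction on V *)

Section TensorSpaces.
Variables (R : realType) (N : nat) (k : 'I_N) (d : nat).
Implicit Types (P : mpoly N R) (G : mpoly N.-1 R).

Definition upm (m : multinom N.-1) : multinom N :=
  Multinom [tuple (if unlift k j is Some i then m i else 0%N) | j < N].

Definition lowm (m : multinom N) : multinom N.-1 := Multinom [tuple m (lift k j) | j < N.-1].

Lemma mdeg_lowm m : mdeg m = (mdeg (lowm m) + m k)%N.
Proof.
rewrite !mdegE (bigD1_ord k)//= addnC; congr (_ + _)%N.
by apply: eq_bigr => j _; rewrite mnmE.
Qed.

Lemma lowmK m : m = mnm_add (upm (lowm m)) (mnm_muln (mnm1 k) (m k)).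
Proof.
apply/mnmP => j; rewrite mnmDE mulmnE mnm1E mnmE.
case: unliftP => [i ->|->] /=; last by rewrite eqxx mul1n.
by rewrite mnmE (negbTE (neq_lift _ _)) mul0n addn0.
Qed.

Lemma injyX m : injy k (mpolyX R m) = mpolyX R (upm m).
Proof.
rewrite /injy comp_mpolyX mpolyXE_id (bigD1_ord k)//= mnmE unlift_none expr0 mul1r.
by apply: eq_bigr => j _; rewrite tnth_mktuple mnmE liftK.
Qed.

Lemma injyZ c G : injy k (c *: G) = c *: injy k G.
Proof. exact: comp_mpolyZ. Qed.

Lemma injyD G H : injy k (G + H) = injy k G + injy k H.
Proof. exact: comp_mpolyD. Qed.

Lemma injy0 : injy k (0 : mpoly N.-1 R) = 0.
Proof. exact: comp_mpoly0. Qed.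

Lemma injy_sum (I : Type) (r : seq I) (p : pred I) (F : I -> mpoly N.-1 R) :
  injy k (\sum_(i <- r | p i) F i) = \sum_(i <- r | p i) injy k (F i).
Proof. by apply: (big_morph (injy k)); [exact: injyD|exact: injy0]. Qed.

Lemma evalp_injy G x : evalp (injy k G) x = evalp G (col' k x).
Proof.
rewrite /injy evalp_comp; congr evalp; apply/rowP => j.
by rewrite !mxE tnth_mktuple evalpX.
Qed.

Lemma xkXn i : xk k ^+ i = mpolyX R (mnm_muln (mnm1 k) i) :> mpoly N R.
Proof. by rewrite /xk mpolyXn. Qed.

Lemma mpolyX_low m : mpolyX R m = injy k (mpolyX R (lowm m)) * xk k ^+ m k.
Proof. by rewrite injyX xkXn -mpolyXD -lowmK. Qed.

(** A condition on the monomials only: membership is thereby seen to be stable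
    under the linear operations and the derivations, and to follow from the total
    degree. *)
Lemma tensor_poly_leP n P : tensor_poly_le k d n P <->
  forall m, m \in msupp P -> (m k < d)%N && (mdeg m <= n + m k)%N.
Proof.
split.
  move=> [G dG ->] m; rewrite -[m \in _]/(m \in [pred m | m \in msupp _]).
  have good Q0 Q1 : (forall m, m \in msupp Q0 -> (m k < d)%N && (mdeg m <= n + m k)%N) ->
      (forall m, m \in msupp Q1 -> (m k < d)%N && (mdeg m <= n + m k)%N) ->
      forall m, m \in msupp (Q0 + Q1 : mpoly N R) -> (m k < d)%N && (mdeg m <= n + m k)%N.
    by move=> h0 h1 a /msuppD_le; rewrite mem_cat => /orP[/h0|/h1].
  move: m; apply: (big_ind (fun Q0 => forall m, m \in msupp Q0 -> (m k < d)%N && (mdeg m <= n + m k)%N)).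
  - by move=> m; rewrite -mpolyC0 msuppC eqxx.
  - exact: good.
  move=> i _; rewrite [G i]mpolyE injy_sum mulr_suml big_seq.
  apply: (big_ind (fun Q0 => forall m, m \in msupp Q0 -> (m k < d)%N && (mdeg m <= n + m k)%N)).
  - by move=> m; rewrite -mpolyC0 msuppC eqxx.
  - exact: good.
  move=> a aG m; rewrite injyZ -scalerAl => /msuppZ_le.
  rewrite injyX xkXn -mpolyXD => /mem_msuppXP <-.
  have kE : mnm_add (upm a) (mnm_muln (mnm1 k) i) k = i.
    by rewrite mnmDE mulmnE mnm1E eqxx mnmE unlift_none mul1n.
  rewrite kE ltn_ord/= mdeg_lowm kE leq_add2r.
  have -> : lowm (mnm_add (upm a) (mnm_muln (mnm1 k) i)) = a.
    apply/mnmP => j; rewrite mnmE mnmDE mulmnE mnm1E mnmE liftK.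
    by rewrite (negbTE (neq_lift _ _)) mul0n addn0.
  by move/degp_leP: (dG i); exact.
move=> H; exists (fun i : 'I_d => \sum_(m <- msupp P | m k == i :> nat) mcoeff m P *: mpolyX R (lowm m)).
  move=> i; rewrite big_seq_cond; apply: degp_sum => m /andP[mP /eqP mi].
  by apply/degpZ/degpX; have /andP[_] := H m mP; rewrite mdeg_lowm leq_add2r.
rewrite {1}[P]mpolyE.
under [RHS]eq_bigr => i _ do rewrite injy_sum mulr_suml big_mkcond.
rewrite exchange_big/= big_seq [RHS]big_seq; apply: eq_bigr => m mP.
have /andP[md _] := H m mP.
rewrite (bigD1 (Ordinal md))//= eqxx big1 ?addr0.
  by rewrite injyZ -scalerAl -mpolyX_low.
by move=> i; case: ifP => // /eqP mi /eqP; case; apply/val_inj.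
Qed.

Lemma tensor_poly_degp P : tensor_poly k d P -> tensor_poly_le k d (degp P) P.
Proof.
move=> [G ->]; set P0 := \sum_(i < d) _.
have : tensor_poly_le k d (\max_(i < d) degp (G i)) P0.
  by exists G => // i; apply: leq_bigmax.
move=> /tensor_poly_leP H; apply/tensor_poly_leP => m mP.
have /andP[-> _] := H m mP; rewrite (leq_trans _ (leq_addr _ _))//.
by have /degp_leP/(_ m mP) := leqnn (degp P0).
Qed.

Lemma tensor_poly_leW n P : tensor_poly_le k d n P -> tensor_poly k d P.
Proof. by move=> [G _ ->]; exists G. Qed.

Lemma tensor_poly_le_mono n n' P : (n <= n')%N ->
  tensor_poly_le k d n P -> tensor_poly_le k d n' P.
Proof. by move=> nn' [G dG ->]; exists G => // i; rewrite (leq_trans (dG i)). Qed.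

Lemma tensor_le_degp n P : tensor_poly_le k d n P -> (degp P <= n + d)%N.
Proof.
move=> /tensor_poly_leP H; apply/degp_leP => m /H /andP[md mn].
by rewrite (leq_trans mn)// leq_add2l ltnW.
Qed.

Lemma tensor_le0 n : tensor_poly_le k d n (0 : mpoly N R).
Proof. by apply/tensor_poly_leP => m; rewrite -mpolyC0 msuppC eqxx. Qed.

Lemma tensor_leD n P P' : tensor_poly_le k d n P -> tensor_poly_le k d n P' ->
  tensor_poly_le k d n (P + P').
Proof.
move=> /tensor_poly_leP h0 /tensor_poly_leP h1; apply/tensor_poly_leP => m /msuppD_le.
by rewrite mem_cat => /orP[/h0|/h1].
Qed.

Lemma tensor_leZ n c P : tensor_poly_le k d n P -> tensor_poly_le k d n (c *: P).
Proof. by move=> /tensor_poly_leP h; apply/tensor_poly_leP => m /msuppZ_le /h. Qed.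

Lemma tensor_leB n P P' : tensor_poly_le k d n P -> tensor_poly_le k d n P' ->
  tensor_poly_le k d n (P - P').
Proof. by move=> hP hP'; rewrite -scaleN1r; apply/tensor_leD/tensor_leZ. Qed.

Lemma tensor_le_mderiv n i P : tensor_poly_le k d n P -> tensor_poly_le k d (n + d) (mderiv i P).
Proof.
move=> hP; have := tensor_le_degp hP; move/tensor_poly_leP : hP => h /(degp_mderiv i) /degp_leP h'.
apply/tensor_poly_leP => m mP; apply/andP; split.
  have : mnm_add m (mnm1 i) \in msupp P.
    move: mP; rewrite !mcoeff_msupp mcoeff_deriv; apply: contra => /eqP ->.
    by rewrite mul0rn.
  by move=> /h /andP[]; rewrite mnmDE => /(leq_ltn_trans (leq_addr _ _)).
by rewrite (leq_trans (h' m mP))// (leq_trans (leq_pred _))// leq_addr.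
Qed.

Lemma tensor_mderiv i P : tensor_poly k d P -> tensor_poly k d (mderiv i P).
Proof. by move=> /tensor_poly_degp /(tensor_le_mderiv i) /tensor_poly_leW. Qed.

Lemma tensor_mderivs s P : tensor_poly k d P -> tensor_poly k d (mderivs s P).
Proof. by move=> hP; elim: s => //= i s; exact: tensor_mderiv. Qed.

End TensorSpaces.

(** Every polynomial function coincides on V with an element of the tensor
    product, of comparable degree: multiplication by the k-th coordinate is
    reduced by the equation of V. *)
Section Reduction.
Variables (R : realType) (N : nat) (k : 'I_N) (d : nat).
Variable Q : 'I_d -> mpoly N.-1 R.
Hypothesis hd : (1 <= d)%N.

Definition varfun n (f : 'rV[R]_N -> R) := exists2 P, tensor_poly_le k d n P &
  forall x, variety k Q x -> f x = evalp P x.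

Definition degQ : nat := (\max_(i < d) degp (Q i)).+1.

Lemma varfun_sum (I : Type) (r : seq I) n (F : I -> 'rV[R]_N -> R) :
  (forall i, varfun n (F i)) -> varfun n (fun x => \sum_(i <- r) F i x).
Proof.
move=> HF; elim: r => [|i r [P hP PE]].
  exists 0; first exact: tensor_le0.
  by move=> x _; rewrite big_nil evalp0.
have [P' hP' PE'] := HF i; exists (P' + P); first exact: tensor_leD.
by move=> x Vx; rewrite big_cons evalpD PE// PE'.
Qed.

Lemma varfun_mono n n' f : (n <= n')%N -> varfun n f -> varfun n' f.
Proof. by move=> nn' [P hP PE]; exists P => //; apply: tensor_poly_le_mono hP. Qed.

Lemma shift_sum (e : nat -> R) (t : R) :
  t * \sum_(a < d) e a * t ^+ a =
  \sum_(a < d) (if val a is b.+1 then e b else 0) * t ^+ a + e d.-1 * t ^+ d.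
Proof.
case: d hd => // d' _; rewrite big_ord_recr [in RHS]big_ord_recl/= mul0r add0r mulrDr exprS mulrCA; congr (_ + _).
by rewrite mulr_sumr; apply: eq_bigr => a _; rewrite /bump/= add1n exprS mulrCA.
Qed.

(** The power x_k^d that may appear when j is k is replaced by the equation of
    V, which raises the degree in y by at most degQ. *)
Lemma varfunX (j : 'I_N) n f : varfun n f -> varfun (n + degQ) (fun x => x 0 j * f x).
Proof.
move=> [P [G dG ->] PE].
have [i ->|->] := unliftP k j.
  exists (\sum_(a < d) injy k (mpolyX R (mnm1 i) * G a) * xk k ^+ a).
    exists (fun a => mpolyX R (mnm1 i) * G a) => // a.
    by rewrite addnC; apply: degpM => //; rewrite degpX// mdeg1.
  move=> x Vx; rewrite PE// !evalp_sum mulr_sumr; apply: eq_bigr => a _.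
  by rewrite !evalpM !evalp_injy evalpM evalpX mxE mulrA.
pose e i := if insub i is Some a then G a else 0.
have eE (a : 'I_d) : e a = G a by rewrite /e valK.
have de i : (degp (e i) <= n)%N by rewrite /e; case: insub => [a|]; rewrite ?degp0.
exists (\sum_(a < d) injy k ((if val a is b.+1 then e b else 0) + e d.-1 * Q a) * xk k ^+ a).
  exists (fun a : 'I_d => (if val a is b.+1 then e b else 0) + e d.-1 * Q a) => // a.
  apply: degpD.
    by case: (val a) => [|b]; rewrite ?degp0// (leq_trans (de b))// leq_addr.
  by apply: degpM => //; rewrite /degQ leqW// (leq_bigmax a).
move=> x Vx; rewrite PE//.
pose t := x 0 k; pose y := col' k x.
rewrite !evalp_sum -/t.
have -> : \sum_(a < d) evalp (injy k (G a) * xk k ^+ a) x = \sum_(a < d) evalp (e a) y * t ^+ a.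
  by apply: eq_bigr => a _; rewrite evalpM evalpXn evalpX evalp_injy eE.
rewrite (shift_sum (fun a => evalp (e a) y)).
rewrite [t ^+ d](Vx : t ^+ d = \sum_(i < d) evalp (Q i) y * t ^+ i).
rewrite mulr_sumr -big_split/=; apply: eq_bigr => a _.
rewrite evalpM evalpXn evalpX evalp_injy evalpD evalpM -/y -/t.
by case: (nat_of_ord a) => [|b]; rewrite ?evalp0; ring.
Qed.

Lemma varfun_mono1 (m : multinom N) : varfun (mdeg m * degQ) (evalp (mpolyX R m)).
Proof.
move: {2}(mdeg m) (erefl (mdeg m)) => e; elim: e m => [|e ih] m me.
  exists (mpolyX R m) => //; apply/tensor_poly_leP => a /mem_msuppXP <-.
  by rewrite me leq0n andbT; move/eqP: me; rewrite mdeg_eq0 => /eqP ->; rewrite mnm0E.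
have [j mj] : exists j, m j != 0%N.
  apply/existsP; apply/negbNE/negP => /existsPn H.
  by move: me; rewrite mdegE big1// => j _; apply/eqP; have := H j; rewrite negbK.
have lej : mpoly.lem (mnm1 j) m by rewrite lep1mP.
have mE : m = mnm_add (mnm_sub m (mnm1 j)) (mnm1 j) by rewrite submK.
have me' : mdeg (mnm_sub m (mnm1 j)) = e.
  by move: me; rewrite {1}mE mdegD mdeg1 addn1 => -[].
rewrite me mulSn addnC -me'; have [P hP PE] := varfunX j (ih _ me').
exists P => // x Vx; rewrite -PE// {1}mE mpolyXD evalpM evalpX mulrC//.
Qed.

Lemma varfun_evalp n P : (degp P <= n)%N -> varfun (n * degQ) (evalp P).
Proof.
move=> /degp_leP dP.
have H (m : multinom N) : varfun (n * degQ) (fun x => if m \in msupp P then mcoeff m P * evalp (mpolyX R m) x else 0).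
  case: (boolP (m \in msupp P)) => [mP|_]; last by exists 0; [exact: tensor_le0|move=> x _; rewrite evalp0].
  have [P' hP' PE'] := varfun_mono (leq_mul (dP m mP) (leqnn degQ)) (varfun_mono1 m).
  by exists (mcoeff m P *: P'); [exact: tensor_leZ|move=> x Vx; rewrite evalpZ PE'].
have [P' hP' PE'] := varfun_sum (msupp P) H.
exists P' => // x Vx; rewrite -PE'// {1}[P]mpolyE evalp_sum big_seq [RHS]big_seq.
by apply: eq_bigr => m ->; rewrite evalpZ.
Qed.

End Reduction.

(** * Gauges of rapid approximation *)

Section RapidApproximation.
Variables (R : realType) (N : nat) (k : 'I_N) (d : nat).
Implicit Types (f g : 'rV[R]_N -> R) (K : set 'rV[R]_N) (a b : R).

Definition tensor_approx K n a f :=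
  exists2 P : mpoly N R, tensor_poly_le k d n P & forall x, K x -> `|f x - evalp P x| <= a.

(** The number a bounds a norm of order nu of f on K: the supremum of |f| and
    of l^nu times the distance to the polynomials of degree l. On E these norms
    define the topology J, and on boxes that of the space of extensions. *)
Definition gauge_le K nu a f := [/\ 0 <= a, forall x, K x -> `|f x| <= a &
  forall l, (0 < l)%N -> tensor_approx K l (a / l%:R ^+ nu) f].

Lemma tensor_approx_weaken K n a b f : a <= b -> tensor_approx K n a f -> tensor_approx K n b f.
Proof. by move=> ab [P hP PE]; exists P => // x /PE /le_trans; apply. Qed.

Lemma gauge_le_weaken K nu a b f : a <= b -> gauge_le K nu a f -> gauge_le K nu b f.
Proof.
move=> ab [a0 fa fl]; split; first exact: le_trans a0 ab.
  by move=> x /fa /le_trans; apply.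
by move=> l l0; apply: tensor_approx_weaken (fl l l0); rewrite ler_wpM2r// invr_ge0 exprn_ge0.
Qed.

Lemma gauge_le_subset K K' nu a f : K' `<=` K -> gauge_le K nu a f -> gauge_le K' nu a f.
Proof.
move=> KK' [a0 fa fl]; split => //; first by move=> x /KK' /fa.
by move=> l /fl [P hP PE]; exists P => // x /KK' /PE.
Qed.

Lemma gauge_le_order K nu nu' a f : (nu' <= nu)%N -> gauge_le K nu a f -> gauge_le K nu' a f.
Proof.
move=> nn [a0 fa fl]; split => // l l0; apply: tensor_approx_weaken (fl l l0).
rewrite ler_wpM2l// lef_pV2 ?posrE ?exprn_gt0 ?ltr0n// ler_weXn2l// ler1n//.
Qed.

Lemma gauge_le_eq K nu a f g : (forall x, K x -> f x = g x) -> gauge_le K nu a f -> gauge_le K nu a g.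
Proof.
move=> fg [a0 fa fl]; split => //; first by move=> x Kx; rewrite -fg// fa.
by move=> l /fl [P hP PE]; exists P => // x Kx; rewrite -fg// PE.
Qed.

Lemma gauge_leD K nu a b f g : gauge_le K nu a f -> gauge_le K nu b g ->
  gauge_le K nu (a + b) (fun x => f x + g x).
Proof.
move=> [a0 fa fl] [b0 gb gl]; split; first exact: addr_ge0.
  by move=> x Kx; rewrite (le_trans (ler_normD _ _))// lerD ?fa ?gb.
move=> l l0; have [P hP PE] := fl l l0; have [P' hP' PE'] := gl l l0.
exists (P + P'); first exact: tensor_leD.
move=> x Kx; rewrite evalpD opprD addrACA (le_trans (ler_normD _ _))// mulrDl.
by rewrite lerD ?PE ?PE'.
Qed.

Lemma gauge_leZ K nu a f c : gauge_le K nu a f -> gauge_le K nu (`|c| * a) (fun x => c * f x).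
Proof.
move=> [a0 fa fl]; split; first exact: mulr_ge0.
  by move=> x Kx; rewrite normrM ler_wpM2l ?fa.
move=> l l0; have [P hP PE] := fl l l0.
exists (c *: P); first exact: tensor_leZ.
by move=> x Kx; rewrite evalpZ -mulrBr normrM -mulrA ler_wpM2l ?PE.
Qed.

Lemma gauge_leB K nu a b f g : gauge_le K nu a f -> gauge_le K nu b g ->
  gauge_le K nu (a + b) (fun x => f x - g x).
Proof.
move=> hf /(gauge_leZ (-1)); rewrite normrN normr1 mul1r => hg.
by apply: gauge_le_eq (gauge_leD hf hg) => x _; rewrite mulN1r.
Qed.

Lemma gauge_le0 K nu a : 0 <= a -> gauge_le K nu a (fun=> 0).
Proof.
move=> a0; split => //; first by move=> x _; rewrite normr0.
move=> l l0; exists 0; first exact: tensor_le0.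
by move=> x _; rewrite evalp0 subrr normr0 divr_ge0// exprn_ge0.
Qed.

Lemma gauge_le_poly K nu n a P : (0 < n)%N -> tensor_poly_le k d n P -> 0 <= a ->
  (forall x, K x -> `|evalp P x| <= a) -> gauge_le K nu (n%:R ^+ nu * a) (evalp P).
Proof.
move=> n0 hP a0 Pa; have n1 : 1 <= n%:R ^+ nu :> R by rewrite exprn_ege1// ler1n.
split; first by rewrite mulr_ge0.
  by move=> x /Pa /le_trans; apply; rewrite ler_peMl.
move=> l l0; have [ln|nl] := leqP n l.
  exists P; first exact: tensor_poly_le_mono hP.
  by move=> x _; rewrite subrr normr0 divr_ge0 ?mulr_ge0.
exists 0; first exact: tensor_le0.
move=> x /Pa; rewrite evalp0 subr0 => /le_trans; apply.
rewrite ler_pdivlMr ?exprn_gt0 ?ltr0n// mulrC ler_wpM2r//.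
by rewrite lerXn2r ?nnegrE// ler_nat ltnW.
Qed.

Lemma gauge_le_eventually K nu n0 a b f : 0 <= a -> 0 <= b -> (forall x, K x -> `|f x| <= b) ->
  (forall l, (n0 <= l)%N -> (0 < l)%N -> tensor_approx K l (a / l%:R ^+ nu) f) ->
  gauge_le K nu (a + b * n0.+1%:R ^+ nu) f.
Proof.
move=> a0 b0 fb fl.
have n1 : 1 <= n0.+1%:R ^+ nu :> R by rewrite exprn_ege1// ler1n.
split; first by rewrite addr_ge0// mulr_ge0.
  by move=> x /fb /le_trans; apply; rewrite ler_wpDl// ler_peMr.
move=> l l0; have [nl|ln] := leqP n0 l.
  apply: tensor_approx_weaken (fl l nl l0); rewrite ler_wpM2r ?invr_ge0 ?exprn_ge0//.
  by rewrite lerDl mulr_ge0.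
exists 0; first exact: tensor_le0.
move=> x /fb; rewrite evalp0 subr0 => /le_trans; apply.
rewrite mulrDl ler_wpDl ?divr_ge0 ?exprn_ge0//.
rewrite ler_pdivlMr ?exprn_gt0 ?ltr0n// ler_wpM2l//.
by rewrite lerXn2r ?nnegrE// ler_nat ltnW// ltnW.
Qed.

Lemma gauge_le_telescope K nu a (u : nat -> 'rV[R]_N -> R) :
  (forall j, gauge_le K nu (a / 2 ^+ j) (fun x => u j.+1 x - u j x)) ->
  forall n m, (n <= m)%N -> gauge_le K nu (2 * a / 2 ^+ n) (fun x => u m x - u n x).
Proof.
move=> H n m nm.
have a0 : 0 <= a by case: (H 0%N); rewrite expr0 divr1.
suff main j : gauge_le K nu (2 * a / 2 ^+ n * (1 - 1 / 2 ^+ j)) (fun x => u (n + j)%N x - u n x).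
  rewrite -(subnKC nm); apply: gauge_le_weaken (main _).
  apply: ler_piMr; first by rewrite divr_ge0 ?mulr_ge0 ?exprn_ge0.
  by rewrite gerBl divr_ge0// exprn_ge0.
elim: j => [|j ih].
  rewrite addn0 expr0 divr1 subrr mulr0.
  by apply: gauge_le_eq (gauge_le0 K nu (lexx 0)) => x _; rewrite subrr.
have e : 2 * a / 2 ^+ n * (1 - 1 / 2 ^+ j.+1) = a / 2 ^+ (n + j) + 2 * a / 2 ^+ n * (1 - 1 / 2 ^+ j).
  by rewrite exprD exprS; field; rewrite !expf_neq0.
rewrite e; apply: gauge_le_eq (gauge_leD (H (n + j)%N) ih) => x _.
by rewrite addnS; ring.
Qed.

(** Completeness. For an order l, an approximant of u m - u n with m large is
    one of f - u n, at the price of a slightly larger constant. *)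
Lemma gauge_le_limit K nu a (u : nat -> 'rV[R]_N -> R) f :
  (forall j, gauge_le K nu (a / 2 ^+ j) (fun x => u j.+1 x - u j x)) ->
  (forall x eps, K x -> 0 < eps -> exists J, forall j, (J <= j)%N -> `|f x - u j x| <= eps) ->
  forall n, gauge_le K nu (3 * a / 2 ^+ n) (fun x => f x - u n x).
Proof.
move=> H flim n; have T := gauge_le_telescope H.
have a0 : 0 <= a by case: (H 0%N); rewrite expr0 divr1.
have fu m x : K x -> `|f x - u m x| <= 2 * a / 2 ^+ m.
  move=> Kx; apply/ler_addgt0Pr => eps eps0; have [J HJ] := flim x eps Kx eps0.
  have [_ uu _] := T m (maxn J m) (leq_maxr _ _).
  have -> : f x - u m x = (u (maxn J m) x - u m x) + (f x - u (maxn J m) x) by ring.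
  by rewrite (le_trans (ler_normD _ _))// lerD ?uu ?HJ ?leq_maxl.
have le23 : 2 * a / 2 ^+ n <= 3 * a / 2 ^+ n.
  by rewrite ler_wpM2r ?invr_ge0 ?exprn_ge0// ler_wpM2r// ler_nat.
split; first by rewrite divr_ge0 ?mulr_ge0 ?exprn_ge0.
  by move=> x /(fu n) /le_trans; apply.
move=> l l0.
have [an0|an0] := eqVneq a 0.
  exists 0; first exact: tensor_le0.
  by move=> x /(fu n); rewrite an0 evalp0 subr0 mulr0 mul0r => /le_trans; apply; rewrite mulr0 !mul0r.
have ap : 0 < a by rewrite lt_def an0.
have ep : 0 < a / 2 ^+ n / l%:R ^+ nu by rewrite !divr_gt0 ?exprn_gt0 ?ltr0n.
have [m m0 hm] := small_quotient (2 * a) ep.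
have [_ _ /(_ l l0)[P hP PE]] := T n (maxn m n) (leq_maxr _ _).
exists P => // x Kx.
have -> : f x - u n x - evalp P x = (f x - u (maxn m n) x) + (u (maxn m n) x - u n x - evalp P x) by ring.
have -> : 3 * a / 2 ^+ n / l%:R ^+ nu = a / 2 ^+ n / l%:R ^+ nu + 2 * a / 2 ^+ n / l%:R ^+ nu by ring.
rewrite (le_trans (ler_normD _ _))// lerD ?PE//.
apply: (le_trans (fu _ _ Kx)); apply: le_trans hm.
rewrite ler_wpM2l ?mulr_ge0// lef_pV2 ?posrE ?exprn_gt0 ?ltr0n//.
by rewrite -natrX ler_nat (leq_trans (leq_maxl m n))// ltnW// ltn_expl.
Qed.

End RapidApproximation.

(** * Distances to polynomials, and the space CV *)

Section SupNorm.
Variables (R : realType) (N : nat).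
Implicit Types (K : set 'rV[R]_N) (a b : R).

Lemma supnorm_leP K (f : K -> R) a :
  (supnorm f <= a%:E)%E <-> 0 <= a /\ forall x, `|f x| <= a.
Proof.
split=> [h|[a0 fa]].
  split=> [|x]; rewrite -lee_fin; apply: le_trans h; apply: ereal_sup_ubound.
    by left.
  by right; exists x.
by apply: ge_ereal_sup => _ [->|[x _ <-]]; rewrite lee_fin.
Qed.

Lemma supnorm_ge0 K (f : K -> R) : (0 <= supnorm f)%E.
Proof. by apply: ereal_sup_ubound; left. Qed.

Lemma supnorm_sigL K (f : 'rV[R]_N -> R) a :
  (supnorm (sigL K f) <= a%:E)%E <-> 0 <= a /\ forall x, K x -> `|f x| <= a.
Proof.
split=> [/supnorm_leP[a0 fa]|[a0 fa]]; last first.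
  by apply/supnorm_leP; split => // x; apply: fa; apply: set_valP.
by split => // x Kx; have := fa (SigSub (mem_set Kx)); rewrite sigLE.
Qed.

Lemma supnorm_fin K (f : 'rV[R]_N -> R) b : 0 <= b -> (forall x, K x -> `|f x| <= b) ->
  exists2 a, 0 <= a & supnorm (sigL K f) = a%:E.
Proof.
move=> b0 fb; have h : (supnorm (sigL K f) <= b%:E)%E by apply/supnorm_sigL.
move: h (supnorm_ge0 (sigL K f)); case: (supnorm _) => // a _; rewrite lee_fin => a0.
by exists a.
Qed.

Lemma evalp_bounded P (h : R) : exists2 A, 0 <= A & forall x : 'rV[R]_N, box 0 h x -> `|evalp P x| <= A.
Proof.
have [h0|h0] := leP 0 h; last first.
  case: N P => [|n] P.
    exists `|evalp P 0| => // x _; rewrite (_ : x = 0)//.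
    by apply/rowP => -[].
  by exists 0 => // x /(_ ord0) hx; have := le_trans (normr_ge0 _) hx; rewrite leNgt h0.
exists (\sum_(m <- msupp P) `|mcoeff m P| * \prod_i h ^+ m i).
  by apply: sumr_ge0 => m _; rewrite mulr_ge0// prodr_ge0// => i _; rewrite exprn_ge0.
move=> x hx; rewrite /evalp mevalE; apply: (le_trans (ler_norm_sum _ _ _)).
apply: ler_sum => m _; rewrite normrM ler_wpM2l// normr_prod.
apply: ler_prod => i _; rewrite normr_ge0/= normrX lerXn2r ?nnegrE//.
by have := hx i; rewrite mxE subr0.
Qed.

End SupNorm.

(** Raising the exponent trades limits for bounds, and allows integer
    exponents only. *)
Lemma rapidly_decreasingP (R : realType) (u : nat -> \bar R) : (forall n, 0 <= u n)%E ->
  rapidly_decreasing u <->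
  forall nu, exists n0, forall n, (n0 <= n)%N -> (0 < n)%N -> (u n <= (1 / n%:R ^+ nu)%:E)%E.
Proof.
move=> u0; split=> [H nu|H s s0].
  have /fine_cvgP[hf] := H nu.+1%:R (ltr0Sn _ _).
  move=> /cvgrPdist_le/(_ 1 ltr01) hl.
  have [n0 _ Hn] : \forall n \near \oo, ((n%:R `^ nu.+1%:R)%:E * u n)%E \is a fin_num /\
      `|fine ((n%:R `^ nu.+1%:R)%:E * u n)%E| <= 1.
    by near=> n; split; near: n; [exact: hf|apply: filterS hl => n; rewrite sub0r normrN].
  exists n0 => n n0n ngt0; have [] := Hn n n0n.
  have np : 0 < n%:R ^+ nu.+1 :> R by rewrite exprn_gt0 ?ltr0n.
  have n1 : n%:R ^+ nu <= n%:R ^+ nu.+1 :> R by rewrite ler_weXn2l// ler1n.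
  rewrite powR_mulrn//; move: (u0 n); case: (u n) => [r|_|//].
    rewrite lee_fin => r0 _ /=; rewrite ger0_norm ?mulr_ge0//= => h.
    rewrite lee_fin ler_pdivlMr ?exprn_gt0 ?ltr0n// mulrC; apply: le_trans h.
    by rewrite ler_wpM2r.
  by rewrite gt0_muley// lte_fin.
have hu n (x : R) : (u n <= x%:E)%E -> 0 <= x ->
    exists2 r, u n = r%:E & 0 <= r <= x.
  by move: (u0 n); case: (u n) => // r; rewrite !lee_fin => r0 rx _; exists r => //; rewrite r0.
pose nu := Num.bound s; have [n0 H0] := H nu.+1.
apply/fine_cvgP; split.
  exists n0.+1 => // n /= nn; have ngt0 : (0 < n)%N by exact: leq_trans nn.
  have [|r -> _ //] := hu n _ (H0 n (ltnW nn) ngt0).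
  by rewrite divr_ge0// exprn_ge0.
apply/cvgrPdist_le => eps eps0; have [n1 n10 hn1] := small_quotient 1 eps0.
exists (maxn n0.+1 n1) => // n /=; rewrite geq_max => /andP[nn n1n].
have ngt0 : (0 < n)%N by exact: leq_trans nn.
have [|r ur /andP[r0 rle]] := hu n _ (H0 n (ltnW nn) ngt0).
  by rewrite divr_ge0// exprn_ge0.
rewrite sub0r normrN ur /= ger0_norm ?mulr_ge0 ?powR_ge0//.
apply: le_trans hn1; apply: (@le_trans _ _ (1 / n%:R)); last first.
  by rewrite !mul1r lef_pV2 ?posrE ?ltr0n// ler_nat.
rewrite ler_pdivlMr ?ltr0n//.
have e1 : n%:R ^+ nu * (1 / n%:R ^+ nu.+1) * n%:R = 1 :> R.
  by rewrite exprS; field; rewrite pnatr_eq0 -lt0n ngt0 expf_neq0// pnatr_eq0 -lt0n.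
rewrite -[leRHS]e1 ler_wpM2r// ler_pM ?powR_ge0//.
rewrite -powR_mulrn// ler_powR ?ler1n// ltW//.
by have := archi_boundP (ltW s0).
Unshelve. all: by end_near.
Qed.


Section Distances.
Variables (R : realType) (N : nat) (k : 'I_N) (d : nat).
Implicit Types (f g : 'rV[R]_N -> R) (K : set 'rV[R]_N) (a b : R).
Local Notation T := (tensor_poly_le k d).

Lemma distK_ge0 K (f : K -> R) n : (0 <= distK f (T n))%E.
Proof. by apply: le_ereal_inf_tmp => _ [P _ <-]; exact: supnorm_ge0. Qed.

Lemma distK_lt K f n a : (distK (sigL K f) (T n) < a%:E)%E -> tensor_approx k d K n a f.
Proof.
move=> /ereal_inf_lt[_ [P hP <-]] /ltW h; exists P => //.
by have [] : 0 <= a /\ forall x, K x -> `|f x - evalp P x| <= a by apply/supnorm_sigL.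
Qed.

Lemma distK_le K f n a : 0 <= a -> tensor_approx k d K n a f -> (distK (sigL K f) (T n) <= a%:E)%E.
Proof.
move=> a0 [P hP PE]; apply: ge_ereal_inf; exists (supnorm (sigL K f - sigL K (evalp P))).
  by exists P.
by rewrite (_ : _ - _ = sigL K (fun x => f x - evalp P x))//; apply/supnorm_sigL.
Qed.

Lemma rapid_distances K f h : K `<=` box 0 h ->
  rapidly_decreasing (fun n => distK (sigL K f) (T n)) <->
  forall nu, exists a, gauge_le k d K nu a f.
Proof.
move=> Kh; rewrite rapidly_decreasingP; last by move=> n; exact: distK_ge0.
split=> H nu.
  have [n0 Hn] := H nu.
  have Ha n : (n0 <= n)%N -> (0 < n)%N -> tensor_approx k d K n (2 / n%:R ^+ nu) f.
    move=> nn n1; apply: distK_lt; apply: (le_lt_trans (Hn n nn n1)).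
    by rewrite lte_fin ltr_pM2r ?invr_gt0 ?exprn_gt0 ?ltr0n// ltr1n.
  have [P _ PE] := Ha n0.+1 (leqnSn _) isT.
  have [b b0 Pb] := evalp_bounded P h.
  exists (2 + (2 / n0.+1%:R ^+ nu + b) * n0.+1%:R ^+ nu).
  apply: gauge_le_eventually => //; first by rewrite addr_ge0// divr_ge0.
  move=> x Kx; rewrite -(subrK (evalp P x) (f x)) (le_trans (ler_normD _ _))// lerD ?PE//.
  exact/Pb/Kh.
have [a [a0 _ Ha]] := H nu.+1.
have [n0 n00 hn] := small_quotient a ltr01.
exists n0 => n nn n1; apply: (@le_trans _ _ (a / n%:R ^+ nu.+1)%:E).
  by apply: distK_le; rewrite ?divr_ge0 ?exprn_ge0//; exact: Ha.
rewrite lee_fin exprS invfM mulrA ler_wpM2r ?invr_ge0 ?exprn_ge0//.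
apply: le_trans hn; rewrite ler_wpM2l// lef_pV2 ?posrE ?ltr0n// ler_nat//.
Qed.

Lemma gauge_le_rapid K nu a f : gauge_le k d K nu a f -> rapid d.+1 K nu a f.
Proof.
move=> [a0 fa fl]; split => // l l0; have [P hP PE] := fl l l0; exists P => //.
by rewrite (leq_trans (tensor_le_degp hP))// mulSn leq_add2l leq_pmulr.
Qed.

Lemma gauge_le_smooth f : (forall h nu, exists a, gauge_le k d (box 0 h) nu a f) -> smooth f.
Proof.
move=> H; apply: (@rapid_smooth _ _ d.+1) => h nu _.
by have [a /gauge_le_rapid] := H h nu; exists a.
Qed.

Lemma box0_cube h : box 0 h = cube (const_mx (- h)) (h + h) :> set 'rV[R]_N.
Proof.
apply/seteqP; split => x hx i; have := hx i; rewrite !mxE subr0 ler_norml addrA addNr add0r//.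
Qed.

(** Boxes centred at 0 replace the cubes; continuity is a consequence of
    Bernstein's theorem. *)
Lemma CV_P f : CV k d f <-> forall h nu, exists a, gauge_le k d (box 0 h) nu a f.
Proof.
split=> [[_ H] h|H].
  have hp : 0 < `|h| + 1 by rewrite ltr_wpDl.
  have hb : (box 0 (`|h| + 1) : set 'rV[R]_N) `<=` box 0 (`|h| + 1) by [].
  suff /(rapid_distances f hb) HH : rapidly_decreasing (fun n => distK (sigL (box 0 (`|h| + 1)) f) (T n)).
    move=> nu; have [a ha] := HH nu; exists a; apply: gauge_le_subset ha => x hx i.
    by rewrite (le_trans (hx i))// (le_trans (ler_norm _))// lerDl.
  by move=> r r0; rewrite box0_cube; apply: H => //; rewrite addr_gt0.
have sf := gauge_le_smooth H; split; first by have [] := sf [::].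
move=> c h h0 r r0.
pose h' := \sum_i `|c 0 i| + h.
have ch : cube c h `<=` box 0 h'.
  move=> x hx i; rewrite mxE subr0 /h' (bigD1 i)//=.
  have -> : x 0 i = c 0 i + (x 0 i - c 0 i) by ring.
  rewrite (le_trans (ler_normD _ _))// -addrA lerD// ler_wpDl ?sumr_ge0//.
  by have /andP[h1 h2] := hx i; rewrite ger0_norm ?subr_ge0// lerBlDl.
have /(rapid_distances f ch) : forall nu, exists a, gauge_le k d (cube c h) nu a f.
  by move=> nu; have [a ha] := H h' nu; exists a; apply: gauge_le_subset ha.
exact.
Qed.

Lemma CV_smooth f : CV k d f -> smooth f.
Proof. by move=> /CV_P; exact: gauge_le_smooth. Qed.

Lemma CV_evalp (P : mpoly N R) : tensor_poly k d P -> CV k d (evalp P).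
Proof.
move=> /tensor_poly_degp hP; apply/CV_P => h nu.
have [a a0 Pa] := evalp_bounded P h; eexists.
by apply: gauge_le_poly (tensor_poly_le_mono (leqnSn _) hP) a0 Pa.
Qed.

Lemma CV_add f g : CV k d f -> CV k d g -> CV k d (fun x => f x + g x).
Proof.
move=> /CV_P hf /CV_P hg; apply/CV_P => h nu.
by have [a fa] := hf h nu; have [b gb] := hg h nu; exists (a + b); exact: gauge_leD.
Qed.

Lemma CV_scale c f : CV k d f -> CV k d (fun x => c * f x).
Proof.
move=> /CV_P hf; apply/CV_P => h nu.
by have [a fa] := hf h nu; exists (`|c| * a); exact: gauge_leZ.
Qed.

Lemma CV_sub f g : CV k d f -> CV k d g -> CV k d (fun x => f x - g x).
Proof.
move=> /CV_P hf /CV_P hg; apply/CV_P => h nu.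
by have [a fa] := hf h nu; have [b gb] := hg h nu; exists (a + b); exact: gauge_leB.
Qed.

(** Bernstein's theorem, as a continuity property of partials s. *)
Lemma gauge_le_partials h s : 0 <= h -> exists2 C, 0 < C & forall g a,
  gauge_le k d (box 0 (h + (size s)%:R)) (6 * size s) a g ->
  forall x, box 0 h x -> `|partials s g x| <= C * a.
Proof.
move=> h0; have [C C0 H] := @rapid_partials R N d.+1 0 h 0 s h0.
by exists C => // g a /gauge_le_rapid /H [].
Qed.

Lemma compact_box (E : set 'rV[R]_N) : compact E -> exists rho : nat, E `<=` box 0 rho%:R.
Proof.
move=> /compact_bounded [M [Mr HM]]; exists (Num.bound (`|M| + 1)) => x Ex i.
rewrite mxE subr0; apply: (@le_trans _ _ (`|M| + 1)); last first.
  by rewrite ltW// archi_boundP// addr_ge0.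
have : `|x| <= `|M| + 1 by apply: HM => //; rewrite (le_lt_trans (ler_norm _))// ltrDl.
by apply: le_trans; rewrite /Num.norm/= mx_normrE; apply: (le_bigmax _ _ (ord0, i)).
Qed.

End Distances.

(** * An open mapping theorem *)

(** Dependent choice with an invariant P. *)
Lemma choice_seq (T : Type) (P : nat -> T -> Prop) (S : nat -> T -> T -> Prop) x0 :
  P 0%N x0 -> (forall n x, P n x -> exists2 y, P n.+1 y & S n x y) ->
  exists u : nat -> T, [/\ u 0%N = x0, forall n, P n (u n) & forall n, S n (u n) (u n.+1)].
Proof.
move=> P0 H.
have /choice[h Hh] : forall p : nat * T, exists y, P p.1 p.2 -> P p.1.+1 y /\ S p.1 p.2 y.
  move=> [n x] /=; have [/H[y Py Sy]|nP] := pselect (P n x); first by exists y.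
  by exists x.
pose u := fix u n := if n is m.+1 then h (m, u m) else x0.
have Pu n : P n (u n) by elim: n => [//|n ih] /=; case: (Hh (n, u n) ih).
by exists u; split => // n; case: (Hh (n, u n) (Pu n)).
Qed.

Section OpenMapping.
Variables (R : realType) (N : nat) (k : 'I_N) (d : nat).
Implicit Types (f g : 'rV[R]_N -> R) (K : set 'rV[R]_N) (a b : R).

Lemma geometric_limit K (u : nat -> 'rV[R]_N -> R) :
  (forall x, K x -> exists i a, forall j, (i <= j)%N -> `|u j.+1 x - u j x| <= a / 2 ^+ j) ->
  exists f, forall x eps, K x -> 0 < eps -> exists J, forall j, (J <= j)%N -> `|f x - u j x| <= eps.
Proof.
move=> H.
have /choice[f Hf] : forall x, exists l : R, K x -> forall eps, 0 < eps ->
    exists J, forall j, (J <= j)%N -> `|l - u j x| <= eps.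
  move=> x; have [Kx|nKx] := pselect (K x); last by exists 0.
  have [i [a Ha]] := H x Kx.
  have a0 : 0 <= a.
    by have := le_trans (normr_ge0 _) (Ha i (leqnn i)); rewrite pmulr_lge0// invr_gt0 exprn_gt0.
  have small eps : 0 < eps -> exists J, forall j, (J <= j)%N -> 2 * a / 2 ^+ j <= eps.
    move=> /(small_quotient (2 * a))[J J0 hJ]; exists J => j Jj; apply: le_trans hJ.
    rewrite ler_wpM2l ?mulr_ge0// lef_pV2 ?posrE ?exprn_gt0 ?ltr0n//.
    by rewrite -natrX ler_nat (leq_trans Jj)// ltnW// ltn_expl.
  have tel p n : (i <= n)%N -> `|u (n + p)%N x - u n x| <= 2 * a / 2 ^+ n * (1 - 1 / 2 ^+ p).
    move=> hn; elim: p => [|p ih]; first by rewrite addn0 subrr normr0 expr0 divr1 subrr mulr0.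
    have -> : u (n + p.+1)%N x - u n x = (u (n + p).+1 x - u (n + p)%N x) + (u (n + p)%N x - u n x).
      by rewrite addnS; ring.
    have -> : 2 * a / 2 ^+ n * (1 - 1 / 2 ^+ p.+1) = a / 2 ^+ (n + p) + 2 * a / 2 ^+ n * (1 - 1 / 2 ^+ p).
      by rewrite exprD exprS; field; rewrite !expf_neq0.
    by rewrite (le_trans (ler_normD _ _))// lerD ?Ha// (leq_trans hn)// leq_addr.
  have tel' n m : (i <= n)%N -> (n <= m)%N -> `|u m x - u n x| <= 2 * a / 2 ^+ n.
    move=> hn nm; rewrite -(subnKC nm); apply: le_trans (tel _ _ hn) _.
    apply: ler_piMr; first by rewrite divr_ge0 ?mulr_ge0 ?exprn_ge0.
    by rewrite gerBl divr_ge0// exprn_ge0.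
  have [|l Hl] := @cauchy_lim R (u ^~ x) (fun j => 2 * a / 2 ^+ j) i tel'.
    move=> eps /small[J HJ]; exists (maxn i J); first exact: leq_maxl.
    by apply: HJ; exact: leq_maxr.
  exists l => _ eps /small[J HJ]; exists (maxn i J) => j; rewrite geq_max => /andP[ij Jj].
  by rewrite distrC; exact: le_trans (Hl j ij) (HJ j Jj).
by exists f => x eps Kx; exact: Hf.
Qed.

Variables (E : set 'rV[R]_N).
Local Notation rT := (gauge_le k d).
Definition rapidly_approximable f := forall nu, exists a, rT E nu a f.

Lemma rapidly_approximableB f g : rapidly_approximable f -> rapidly_approximable g -> rapidly_approximable (fun x => f x - g x).
Proof.
by move=> hf hg nu; have [a fa] := hf nu; have [b gb] := hg nu; exists (a + b); exact: gauge_leB.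
Qed.

Lemma CV_rapidly_approximable rho g : E `<=` box 0 rho -> CV k d g -> rapidly_approximable g.
Proof. by move=> hE /CV_P H nu; have [a ga] := H rho nu; exists a; exact: gauge_le_subset ga. Qed.

Variables (rho : R) (hE : E `<=` box 0 rho).
Hypothesis lift_ex : forall f, rapidly_approximable f -> exists2 g, CV k d g & forall x, E x -> g x = f x.

(** Baire's argument. The restrictions to E of the g of gauge at most n exhaust,
    when n varies, the rapidly approximable functions on E. If none of these sets
    were dense in some ball, a sequence of nested balls avoiding them in turn
    would shrink to a function outside all of them. *)
Lemma somewhere_dense nu : exists n f0 mu del, [/\ 0 < del, rapidly_approximable f0 &
  forall f, rapidly_approximable f -> rT E mu del (fun x => f x - f0 x) ->
  forall mu' eps, 0 < eps -> exists g, [/\ CV k d g, rT (box 0 nu%:R) nu n%:R g &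
    rT E mu' eps (fun x => f x - g x)]].
Proof.
apply: contrapT => nex.
pose far n f mu eps := forall g, CV k d g -> rT (box 0 nu%:R) nu n%:R g ->
  ~ rT E mu eps (fun x => f x - g x).
have H n f0 mu del : rapidly_approximable f0 -> 0 < del -> exists f mu' eps,
    [/\ 0 < eps, rapidly_approximable f, rT E mu del (fun x => f x - f0 x) & far n f mu' eps].
  move=> hf0 del0; apply: contrapT => nex2; apply: nex; exists n, f0, mu, del; split => // f hf hd mu' eps eps0.
  apply: contrapT => nex3; apply: nex2; exists f, mu', eps; split => // g g1 g2 g3.
  by apply: nex3; exists g.
pose ok (n : nat) (s : ('rV[R]_N -> R) * nat * R) := rapidly_approximable s.1.1 /\ 0 < s.2.
pose nxt (n : nat) (s s' : ('rV[R]_N -> R) * nat * R) := [/\ rT E s.1.2 s.2 (fun x => s'.1.1 x - s.1.1 x),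
  (maxn s.1.2 n.+1 <= s'.1.2)%N, s'.2 <= s.2 / 2 & far n s'.1.1 s'.1.2 (3 * s'.2)].
have [|n [[f mu] del] [/= hf del0]|u [_ uok unxt]] := @choice_seq _ ok nxt (fun=> 0, 0%N, 1).
- by split => //= mu; exists 0; exact: gauge_le0.
- have [f' [mu' [eps [eps0 hf' hd hfar]]]] := H n f mu del hf del0.
  exists (f', maxn (maxn mu n.+1) mu', Num.min (del / 2) (eps / 3)).
    by split => //=; rewrite lt_min !divr_gt0.
  split => //=; [exact: leq_maxl|by rewrite ge_min lexx|].
  move=> g g1 g2 g3; apply: (hfar g g1 g2); apply: (gauge_le_order (leq_maxr (maxn mu n.+1) mu')).
  by apply: gauge_le_weaken g3; rewrite mulrC -ler_pdivlMr// ge_min lexx orbT.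
pose f n := (u n).1.1; pose mu n := (u n).1.2; pose del n := (u n).2.
have mu_mono m n : (m <= n)%N -> (mu m <= mu n)%N.
  apply: (@homo_leq _ (mu : nat -> nat) leq) => [//|? ? ?|j]; first exact: leq_trans.
  by case: (unxt j) => _; rewrite geq_max => /andP[].
have del_geo n j : del (n + j)%N <= del n / 2 ^+ j.
  elim: j => [|j ih]; first by rewrite addn0 expr0 divr1.
  rewrite addnS; case: (unxt (n + j)%N) => _ _ /le_trans h _; apply: h.
  by rewrite exprSr invfM mulrA ler_wpM2r.
have step n j : rT E (mu n) (del n / 2 ^+ j) (fun x => f (n + j).+1 x - f (n + j)%N x).
  case: (unxt (n + j)%N) => h _ _ _; apply: gauge_le_weaken (del_geo n j) _.
  by apply: gauge_le_order h; apply: mu_mono; exact: leq_addr.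
have [F HF] : exists F, forall x eps, E x -> 0 < eps ->
    exists J, forall j, (J <= j)%N -> `|F x - f j x| <= eps.
  apply: geometric_limit => x Ex; exists 0%N, (del 0%N) => j _.
  by case: (step 0%N j) => _ /(_ x Ex) + _; rewrite add0n.
have lim n : rT E (mu n) (3 * del n) (fun x => F x - f n x).
  have := @gauge_le_limit R N k d E (mu n) (del n) (fun j => f (n + j)%N) F _ _ 0%N.
  rewrite addn0 expr0 divr1; apply => [j|x eps Ex eps0]; first by rewrite addnS; exact: step.
  have [J HJ] := HF x eps Ex eps0; exists J => j Jj; apply: HJ.
  by rewrite (leq_trans Jj)// leq_addl.
have FX : rapidly_approximable F.
  move=> m; have [b fb] := (uok m).1 m.
  case: m fb => [|m] fb; first by exists (3 * del 0%N + b); apply: gauge_le_eq (gauge_leD (gauge_le_order (leq0n _) (lim 0%N)) fb) => x _; rewrite subrK.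
  have mm : (m.+1 <= mu m.+1)%N.
    by case: (unxt m) => _; rewrite geq_max => /andP[].
  exists (3 * del m.+1 + b).
  by apply: gauge_le_eq (gauge_leD (gauge_le_order mm (lim m.+1)) fb) => x _; rewrite subrK.
have [G hG GF] := lift_ex FX.
have /CV_P/(_ nu%:R nu)[a Ga] := hG.
have a0 : 0 <= a by case: Ga.
pose n := Num.bound a.
case: (unxt n) => _ _ _ /(_ G hG); apply.
  by apply: gauge_le_weaken Ga; rewrite ltW// archi_boundP.
have := gauge_leZ (-1) (lim n.+1); rewrite normrN normr1 mul1r.
by apply: gauge_le_eq => x /GF ->; rewrite mulN1r opprB.
Qed.

(** Taking differences moves the ball to the origin, and homogeneity removes
    its radius. *)
Lemma dense_lift nu : exists (mu : nat) (C : R), 0 < C /\ forall f a, rapidly_approximable f -> 0 < a -> rT E mu a f -> forall mu' eps, 0 < eps ->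
  exists g, [/\ CV k d g, rT (box 0 nu%:R) nu (C * a) g & rT E mu' eps (fun x => f x - g x)].
Proof.
have [n [f0 [mu [del [del0 hf0 H]]]]] := somewhere_dense nu.
exists mu, ((n + n).+1%:R / del); split; first by rewrite divr_gt0.
move=> f a hf a0 fa mu' eps eps0.
pose t := del / a; have t0 : 0 < t by rewrite divr_gt0.
have ep : 0 < eps * t / 2 by rewrite divr_gt0// mulr_gt0.
have [||g1 [g11 g12 g13]] := H (fun x => f0 x + t * f x) _ _ mu' _ ep.
- move=> m; have [b0 fb0] := hf0 m; have [b fb] := hf m.
  by eexists; apply: gauge_leD fb0 (gauge_leZ t fb).
- have := gauge_leZ t fa; rewrite gtr0_norm// divfK ?gt_eqF//.
  by apply: gauge_le_eq => x _; ring.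
have [//||g2 [g21 g22 g23]] := H f0 _ _ mu' _ ep.
  by apply: gauge_le_eq (gauge_le0 _ _ _ _ (ltW del0)) => x _; rewrite subrr.
exists (fun x => t^-1 * (g1 x - g2 x)); split.
- by apply: CV_scale; exact: CV_sub.
- have := gauge_leZ t^-1 (gauge_leB g12 g22).
  rewrite gtr0_norm ?invr_gt0// -natrD; apply: gauge_le_weaken.
  have -> : t^-1 * (n + n)%:R = (n + n)%:R / del * a by rewrite /t; field; rewrite !gt_eqF.
  by rewrite ler_wpM2r ?(ltW a0)// ler_wpM2r ?invr_ge0 ?(ltW del0)// ler_nat.
have := gauge_leZ t^-1 (gauge_leB g13 g23).
rewrite gtr0_norm ?invr_gt0// (_ : t^-1 * _ = eps); last by field; rewrite gt_eqF.
by apply: gauge_le_eq => x _; field; rewrite gt_eqF.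
Qed.

(** The open mapping theorem. Successive approximation turns approximate lifts
    into an exact one; at the j-th step the lift is controlled for the gauge of
    order nu + j, so that the sum of the lifts converges for all the gauges. *)
Lemma controlled_lift nu : exists (mu : nat) (C : R), 0 < C /\
  forall f a, rapidly_approximable f -> rT E mu a f ->
  exists g, [/\ CV k d g, forall x, E x -> g x = f x & rT (box 0 nu%:R) nu (C * a) g].
Proof.
have /choice[mu /choice[C HC]] := fun j => dense_lift (nu + j).
have C0 j : 0 < C j by case: (HC j).
exists (mu 0%N), (3 * (C 0%N + C 0%N)); split; first by rewrite mulr_gt0// addr_gt0.
move=> f a hf fa; have := fa => -[]; rewrite le_eqVlt => /orP[/eqP<- f0 _|a0 _ _].
  exists (fun=> 0); split => [|x Ex|].
  - by apply/CV_P => h m; exists 0; exact: gauge_le0.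
  - by have := f0 x Ex; rewrite normr_le0 => /eqP.
  - by rewrite mulr0; exact: gauge_le0.
pose D j := C 0%N + C j; have D0 j : 0 < D j by rewrite addr_gt0.
pose b j := a / 2 ^+ j * (D 0%N / D j).
have b0 j : 0 < b j by rewrite mulr_gt0 ?divr_gt0 ?exprn_gt0.
pose ok (j : nat) (G : 'rV[R]_N -> R) := CV k d G /\ rT E (mu j) (b j) (fun x => f x - G x).
pose nxt (j : nat) (G G' : 'rV[R]_N -> R) :=
  rT (box 0 (nu + j)%:R) (nu + j) (D 0%N * a / 2 ^+ j) (fun x => G' x - G x).
have [||u [u0 uok unxt]] := @choice_seq _ ok nxt (fun=> 0).
- split; first by apply/CV_P => h m; exists 0; exact: gauge_le0.
  rewrite /b expr0 divr1 divff ?gt_eqF// mulr1.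
  by apply: gauge_le_eq fa => x _; rewrite subr0.
- move=> j G [hG Gb]; have [_ H] := HC j.
  have [|g [g1 g2 g3]] := H (fun x => f x - G x) (b j) _ (b0 j) Gb (mu j.+1) (b j.+1) (b0 _).
    by apply: rapidly_approximableB => //; exact: CV_rapidly_approximable hE hG.
  exists (fun x => G x + g x); first split.
  + exact: CV_add.
  + by apply: gauge_le_eq g3 => x _; ring.
  have : rT (box 0 (nu + j)%:R) (nu + j) (C j * b j) (fun x => G x + g x - G x).
    by apply: gauge_le_eq g2 => x _; ring.
  apply: gauge_le_weaken; rewrite /b.
  have -> : C j * (a / 2 ^+ j * (D 0%N / D j)) = D 0%N * a / 2 ^+ j * (C j / D j) by ring.
  apply: ler_piMr; first by rewrite divr_ge0 ?mulr_ge0 ?exprn_ge0// ltW.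
  by rewrite ler_pdivrMr// mul1r lerDr ltW.
have step i j : rT (box 0 (nu + i)%:R) (nu + i) (D 0%N * a / 2 ^+ i / 2 ^+ j)
    (fun x => u (i + j).+1 x - u (i + j)%N x).
  have := unxt (i + j)%N; rewrite /nxt exprD invfM mulrA => h.
  have ij : (nu + i <= nu + (i + j))%N by rewrite leq_add2l leq_addr.
  apply: (gauge_le_order ij); apply: gauge_le_subset h => x hx m.
  by apply: le_trans (hx m) _; rewrite ler_nat.
have inbox (h : R) : exists i : nat, box 0 h `<=` (box 0 (nu + i)%:R : set 'rV[R]_N).
  exists (Num.bound `|h|) => x hx m; apply: le_trans (hx m) _.
  rewrite (le_trans (ler_norm _))// (le_trans (ltW (archi_boundP (normr_ge0 h))))//.
  by rewrite ler_nat leq_addl.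
have inbox1 (x : 'rV[R]_N) : exists i : nat, box 0 (nu + i)%:R x.
  have [i Hi] := inbox (\sum_m `|x 0 m|); exists i; apply: Hi => m.
  by rewrite mxE subr0 (bigD1 m)//= lerDl sumr_ge0.
have [g Hg] : exists g, forall x eps, setT x -> 0 < eps ->
    exists J, forall j, (J <= j)%N -> `|g x - u j x| <= eps.
  apply: geometric_limit => x _; have [i xi] := inbox1 x.
  exists i, (D 0%N * a) => j ij; rewrite -(subnKC ij).
  by case: (step i (j - i)%N) => _ /(_ x xi); rewrite exprD invfM mulrA.
have lim i : rT (box 0 (nu + i)%:R) (nu + i) (3 * (D 0%N * a / 2 ^+ i)) (fun x => g x - u i x).
  have := @gauge_le_limit R N k d (box 0 (nu + i)%:R) (nu + i) (D 0%N * a / 2 ^+ i) (fun j => u (i + j)%N) g _ _ 0%N.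
  rewrite addn0 expr0 divr1 => HH; apply: HH => [j|x eps _ eps0]; first by rewrite addnS; exact: step.
  have [J HJ] := Hg x eps I eps0; exists J => j Jj; apply: HJ.
  by rewrite (leq_trans Jj)// leq_addl.
exists g; split.
- apply/CV_P => h m; have [i Hi] := inbox h.
  have [/CV_P/(_ h m)[c uc] _] := uok (maxn i m).
  eexists; apply: gauge_le_eq (gauge_leD (gauge_le_order _ (gauge_le_subset _ (lim (maxn i m)))) uc).
  + by move=> x _; rewrite subrK.
  + by rewrite (leq_trans (leq_maxr i m))// leq_addl.
  + move=> x /Hi hx j; apply: le_trans (hx j) _; rewrite ler_nat leq_add2l leq_maxl//.
- move=> x Ex; apply/eqP; rewrite -subr_eq0 -normr_le0; apply/ler_addgt0Pr => eps eps0; rewrite add0r.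
  have e20 : 0 < eps / 2 by rewrite divr_gt0.
  have [J HJ] := Hg x _ I e20; have [n n0 hn] := small_quotient (2 * a) e20.
  pose m := maxn J n.
  have -> : g x - f x = (g x - u m x) - (f x - u m x) by ring.
  have [_ [_ /(_ x Ex) fu _]] := uok m.
  rewrite (le_trans (ler_normB _ _))// (splitr eps) lerD ?HJ ?leq_maxl//.
  apply: (le_trans fu); apply: le_trans hn.
  have -> : b m = 2 * a / 2 ^+ m * (C 0%N / D m) by rewrite /b [D 0%N]/D; ring.
  apply: (@le_trans _ _ (2 * a / 2 ^+ m)).
    apply: ler_piMr; first by rewrite divr_ge0 ?mulr_ge0 ?exprn_ge0// ltW.
    by rewrite ler_pdivrMr// mul1r lerDl ltW.
  rewrite ler_wpM2l ?mulr_ge0 ?(ltW a0)// lef_pV2 ?posrE ?exprn_gt0 ?ltr0n//.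
  by rewrite -natrX ler_nat (leq_trans (leq_maxr J n))// ltnW// ltn_expl.
have := lim 0%N; rewrite addn0 expr0 divr1 mulrA; apply: gauge_le_eq => x _.
by rewrite u0 subr0.
Qed.

End OpenMapping.

(** * Extending rapidly approximable functions *)

Section RealSeries.
Variable R : realType.

Lemma sum_inv_sq n m : (0 < n)%N -> (n <= m)%N ->
  \sum_(n <= j < m) 1 / j.+1%:R ^+ 2 <= 1 / n%:R :> R.
Proof.
move=> n0 nm; suff main p : \sum_(n <= j < n + p) 1 / j.+1%:R ^+ 2 <= 1 / n%:R - 1 / (n + p)%:R :> R.
  by rewrite -(subnKC nm); apply: le_trans (main _) _; rewrite gerBl divr_ge0.
elim: p => [|p ih]; first by rewrite addn0 big_geq// subrr.
rewrite addnS big_nat_recr/= ?leq_addr//.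
have np : 0 < (n + p)%:R :> R by rewrite ltr0n addn_gt0 n0.
apply: le_trans (lerD ih (lexx _)) _.
rewrite -addrA lerD2l -lerBrDl opprK addrC -[(n + p).+1%:R]natr1.
move: (n + p)%:R np => t np.
have t1 : 0 < t + 1 by rewrite addr_gt0.
have -> : 1 / t - 1 / (t + 1) = 1 / (t * (t + 1)) by field; rewrite !lt0r_neq0.
rewrite !mul1r lef_pV2 ?posrE ?exprn_gt0 ?mulr_gt0// ?ltr_wpDl// ?(ltW np)//.
by rewrite expr2 ler_wpM2r ?lerDl// addr_ge0// ltW.
Qed.

Lemma series_le (u : nat -> R) C n m : (forall j, `|u j| <= C / j.+1%:R ^+ 2) -> (0 < n)%N -> (n <= m)%N ->
  `|\sum_(0 <= j < m) u j - \sum_(0 <= j < n) u j| <= C / n%:R.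
Proof.
move=> H n0 nm; rewrite (@big_cat_nat _ _ _ n)//= addrAC subrr add0r.
have C0 : 0 <= C by have := le_trans (normr_ge0 _) (H 0%N); rewrite expr1n divr1.
apply: (le_trans (ler_norm_sum _ _ _)).
apply: (@le_trans _ _ (\sum_(n <= j < m) C * (1 / j.+1%:R ^+ 2))).
  by apply: ler_sum => j _; rewrite mulrA mulr1.
by rewrite -mulr_sumr -[_ / _]/(C * n%:R^-1) ler_wpM2l// -[n%:R^-1]mul1r sum_inv_sq.
Qed.

Lemma series_bound (u : nat -> R) C m : (forall j, `|u j| <= C / j.+1%:R ^+ 2) ->
  `|\sum_(0 <= j < m) u j| <= 2 * C.
Proof.
move=> H; have u0 := H 0%N; move: u0; rewrite expr1n divr1 => u0.
have C0 : 0 <= C := le_trans (normr_ge0 _) u0.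
case: m => [|m]; first by rewrite big_geq// normr0 mulr_ge0.
have := series_le H (ltn0Sn 0) (ltn0Sn m); rewrite divr1 big_nat1 => h.
rewrite -(subrK (u 0%N) (\sum_(0 <= j < _) _)) (le_trans (ler_normD _ _))//.
by rewrite mulr_natl mulr2n lerD.
Qed.

Lemma series_limit (u : nat -> R) C : (forall j, `|u j| <= C / j.+1%:R ^+ 2) ->
  exists l, forall n, (0 < n)%N -> `|\sum_(0 <= j < n) u j - l| <= C / n%:R.
Proof.
move=> H; apply: (@cauchy_lim R (fun n => \sum_(0 <= j < n) u j) (fun n => C / n%:R) 1%N) => [n m|eps].
  exact: series_le.
by move=> /(small_quotient C)[n n0 hn]; exists n.
Qed.

(** By Markov's inequality the derivative is controlled on the same interval,
    and by induction on the degree so are its coefficients; the constant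
    coefficient is then read off the value at t0. *)
Lemma coef_bound d (rho : R) : 0 <= rho -> exists2 C, 0 <= C &
  forall (p : {poly R}) h t0 A, (size p <= d)%N -> 0 < h -> h <= 1 -> `|t0| <= rho -> 0 <= A ->
  (forall t, `|t - t0| <= h -> `|p.[t]| <= A) -> forall i, `|p`_i| <= C * (A / h ^+ d).
Proof.
move=> rho0; elim: d => [|d [C C0 ih]].
  exists 0 => // p h t0 A; rewrite leqn0 size_poly_eq0 => /eqP -> *.
  by rewrite coef0 normr0 mul0r.
pose B := C * (2 * d%:R ^+ 3); pose S := \sum_(i < d) rho ^+ i.+1.
have B0 : 0 <= B by rewrite !mulr_ge0.
have S0 : 0 <= S by apply: sumr_ge0 => i _; rewrite exprn_ge0.
exists (1 + B * (1 + S)); first by rewrite addr_ge0 ?mulr_ge0 ?addr_ge0.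
move=> p h t0 A sp h0 h1 t0r A0 pA.
have hd0 : 0 < h ^+ d.+1 by rewrite exprn_gt0.
have Ah0 : 0 <= A / h ^+ d.+1 by rewrite divr_ge0// ltW.
have high i : `|p`_i.+1| <= B * (A / h ^+ d.+1).
  have sp' : (size (p^`() : {poly R}) <= d)%N.
    have [->|p0] := eqVneq p 0; first by rewrite deriv0 size_poly0.
    by rewrite -ltnS (leq_trans (lt_size_deriv p0)).
  have A'0 : 0 <= 2 * d%:R ^+ 3 / h * A by rewrite mulr_ge0// divr_ge0 ?mulr_ge0// ltW.
  have := ih _ h t0 _ sp' h0 h1 t0r A'0 (markov_poly h0 sp pA) i.
  rewrite (coef_deriv (p : {poly R})) -[X in `|X| <= _]mulr_natr normrM normr_nat => hi.
  have -> : B * (A / h ^+ d.+1) = C * (2 * d%:R ^+ 3 / h * A / h ^+ d).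
    by rewrite /B [h ^+ d.+1]exprS; field; rewrite !gt_eqF ?exprn_gt0.
  by apply: le_trans hi; rewrite ler_peMr// ler1n.
have BA0 : 0 <= B * (A / h ^+ d.+1) by rewrite mulr_ge0.
case=> [|i]; last first.
  by apply: le_trans (high i) _; rewrite ler_wpM2r// mulrDr mulr1 ler_wpDl ?ler01// lerDl mulr_ge0.
have := horner_coef_wide t0 sp; rewrite big_ord_recl expr0 mulr1 /= => e.
have -> : p`_0 = p.[t0] - \sum_(i < d) p`_i.+1 * t0 ^+ i.+1 by rewrite e addrK.
rewrite (le_trans (ler_normB _ _))//.
have -> : (1 + B * (1 + S)) * (A / h ^+ d.+1) =
    A / h ^+ d.+1 + B * (A / h ^+ d.+1) + S * (B * (A / h ^+ d.+1)) by ring.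
apply: lerD.
  rewrite ler_wpDr//; apply: (le_trans (pA t0 _)); first by rewrite subrr normr0 ltW.
  by rewrite ler_peMr// invf_ge1// exprn_ile1// ltW.
apply: (le_trans (ler_norm_sum _ _ _)); rewrite mulr_suml; apply: ler_sum => i _.
rewrite normrM mulrC ler_pM// normrX lerXn2r ?nnegrE//.
Qed.

End RealSeries.

Section SmoothSeries.
Variables (R : realType) (m : nat).
Implicit Types g : 'rV[R]_m -> R.

Lemma smooth_nat_sum (h : nat -> 'rV[R]_m -> R) n : (forall j, smooth (h j)) ->
  smooth (fun y => \sum_(0 <= j < n) h j y).
Proof. by move=> sh; exact: smooth_sum. Qed.

(** Jackson's theorem is applied to the partial sums instead of the limit: their
    derivatives are bounded uniformly, and the remainder is as small as wanted. *)
Lemma smooth_series (h : nat -> 'rV[R]_m -> R) :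
  (forall j, smooth (h j)) ->
  (forall mu, exists C, forall j s y, (size s <= mu)%N -> `|partials s (h j) y| <= C / j.+1%:R ^+ 2) ->
  exists g C, [/\ 0 <= C, forall y n, (0 < n)%N -> `|\sum_(0 <= j < n) h j y - g y| <= C / n%:R,
    forall y, `|g y| <= 3 * C &
    forall rho nu, 0 < rho -> exists2 a, 0 <= a & forall l, (0 < l)%N -> exists2 G : mpoly m R, (degp G <= l)%N &
      forall y, box 0 rho y -> `|g y - evalp G y| <= a / l%:R ^+ nu].
Proof.
move=> sh hC; have [C HC] := hC 0%N.
have hb y j : `|h j y| <= C / j.+1%:R ^+ 2 by exact: (HC j [::] y).
have C0 : 0 <= C.
  by have := le_trans (normr_ge0 _) (hb 0 0%N); rewrite expr1n divr1.
have /choice[g Hg] := fun y => series_limit (hb y).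
exists g, C; split => //.
  move=> y; have := Hg y 1%N isT; rewrite divr1 => h1; have h2 := series_bound 1 (hb y).
  rewrite -(subrK (\sum_(0 <= j < 1) h j y) (g y)) (le_trans (ler_normD _ _))//.
  by rewrite distrC (_ : 3 * C = C + 2 * C) ?lerD//; ring.
move=> rho nu rho0; have [K [mu [K0 HK]]] := @jackson R m rho rho0 nu.
have [B HB] := hC mu.
have B0 : 0 <= B.
  by have := le_trans (normr_ge0 _) (HB 0%N [::] 0 isT); rewrite expr1n divr1.
exists (K * (2 * B) + 1); first by rewrite addr_ge0 ?mulr_ge0.
move=> l l0; have lp : 0 < 1 / l%:R ^+ nu :> R by rewrite divr_gt0 ?exprn_gt0 ?ltr0n.
have [J J0 HJ] := small_quotient C lp.
pose S y := \sum_(0 <= j < J) h j y.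
have bS : bounded_partials rho m mu (2 * B) S.
  move=> s _ _ ss x _; rewrite /S partials_sum//.
  by apply: series_bound => j; exact: HB.
have [G dG GE] := HK S (2 * B) (smooth_nat_sum J sh) bS l l0.
exists G => // y /GE hy.
have -> : g y - evalp G y = (g y - S y) + (S y - evalp G y) by ring.
rewrite mulrDl addrC (le_trans (ler_normD _ _))// lerD//.
by rewrite distrC (le_trans (Hg y J J0)).
Qed.

End SmoothSeries.

Section Extension.
Variables (R : realType) (N : nat) (k : 'I_N) (d : nat).
Local Notation rT := (gauge_le k d).
Local Notation T := (tensor_poly_le k d).

(** A single sequence is good for all the orders nu at once, as P l is chosen
    for the order nu <= l whose estimate is the best. *)
Lemma near_best (E : set 'rV[R]_N) f : rapidly_approximable k d E f ->
  exists (P : nat -> mpoly N R) (e : nat -> R),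
  [/\ forall l, T l (P l), forall l, (0 < l)%N -> 0 <= e l,
   forall l x, (0 < l)%N -> E x -> `|f x - evalp (P l) x| <= e l &
   forall nu, exists2 C, 0 <= C & forall l, (0 < l)%N -> e l <= C / l%:R ^+ nu].
Proof.
move=> /choice[a Ha].
have a0 nu : 0 <= a nu by case: (Ha nu).
have argmin (l m : nat) : exists2 n : nat, (n <= m)%N & forall nu, (nu <= m)%N -> a n / l%:R ^+ n <= a nu / l%:R ^+ nu.
  elim: m => [|m [n nm Hn]]; first by exists 0%N => // nu; rewrite leqn0 => /eqP ->.
  have [h|h] := leP (a n / l%:R ^+ n) (a m.+1 / l%:R ^+ m.+1).
    exists n; first exact: leqW.
    by move=> nu; rewrite leq_eqVlt ltnS => /orP[/eqP->|/Hn].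
  exists m.+1 => // nu; rewrite leq_eqVlt ltnS => /orP[/eqP->//|/Hn].
  exact/le_trans/ltW.
have /choice[Pe HPe] : forall l : nat, exists Pe : mpoly N R * R, T l Pe.1 /\ ((0 < l)%N -> [/\ 0 <= Pe.2,
    forall x, E x -> `|f x - evalp Pe.1 x| <= Pe.2 & forall nu, (nu <= l)%N -> Pe.2 <= a nu / l%:R ^+ nu]).
  move=> l; have [l0|l0] := ltnP 0 l; last by exists (0, 0); split => //=; exact: tensor_le0.
  have [n nl Hn] := argmin l l; have [_ _ /(_ l l0)[P hP PE]] := Ha n.
  by exists (P, a n / l%:R ^+ n); split => // _; split => //=; rewrite divr_ge0 ?exprn_ge0.
exists (fun l => (Pe l).1), (fun l => (Pe l).2); split.
- by move=> l; case: (HPe l).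
- by move=> l l0; case: (HPe l) => _ /(_ l0)[].
- by move=> l x l0; case: (HPe l) => _ /(_ l0)[_ + _]; exact.
move=> nu; exists (a nu + a 0%N * nu%:R ^+ nu); first by rewrite addr_ge0 ?mulr_ge0.
move=> l l0; case: (HPe l) => _ /(_ l0)[_ _ H].
have [nl|ln] := leqP nu l.
  by apply: le_trans (H _ nl) _; rewrite ler_wpM2r ?invr_ge0 ?exprn_ge0// lerDl mulr_ge0.
apply: le_trans (H 0%N (leq0n _)) _; rewrite expr0 divr1 mulrDl ler_wpDl ?divr_ge0 ?exprn_ge0//.
rewrite ler_pdivlMr ?exprn_gt0 ?ltr0n// ler_wpM2l//.
by rewrite lerXn2r ?nnegrE// ler_nat ltnW.
Qed.

Lemma CV_tensor (g : 'I_d -> 'rV[R]_N.-1 -> R) :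
  (forall i h, exists A, forall y, box 0 h y -> `|g i y| <= A) ->
  (forall i h nu, exists2 a, 0 <= a & forall l, (0 < l)%N -> exists2 G : mpoly N.-1 R, (degp G <= l)%N &
      forall y, box 0 h y -> `|g i y - evalp G y| <= a / l%:R ^+ nu) ->
  CV k d (fun x => \sum_(i < d) g i (col' k x) * x 0 k ^+ i).
Proof.
move=> gb ga; apply/CV_P => h nu.
have col_box x : box 0 h x -> box 0 h (col' k x) by move=> hx j; have := hx (lift k j); rewrite !mxE.
have hk x : box 0 h x -> `|x 0 k| <= `|h|.
  by move=> /(_ k); rewrite mxE subr0 => /le_trans; apply; exact: ler_norm.
have /choice[A HA] := fun i => gb i h.
have /choice[a Ha] : forall i, exists a, 0 <= a /\ forall l, (0 < l)%N -> exists2 G : mpoly N.-1 R, (degp G <= l)%N &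
      forall y, box 0 h y -> `|g i y - evalp G y| <= a / l%:R ^+ nu.
  by move=> i; have [b b0 hb] := ga i h nu; exists b.
pose b := \sum_(i < d) (`|A i| + a i) * `|h| ^+ i.
have a0 i : 0 <= a i by case: (Ha i).
exists b; split.
- by apply: sumr_ge0 => i _; rewrite mulr_ge0 ?exprn_ge0// addr_ge0.
- move=> x hx; apply: (le_trans (ler_norm_sum _ _ _)); apply: ler_sum => i _.
  rewrite normrM normrX ler_pM ?exprn_ge0// ?lerXn2r ?nnegrE ?hk//.
  rewrite ler_wpDr//; apply: (le_trans (HA i _ (col_box _ hx))); exact: ler_norm.
move=> l l0.
have /choice[G HG] : forall i, exists G : mpoly N.-1 R, (degp G <= l)%N /\
      forall y, box 0 h y -> `|g i y - evalp G y| <= a i / l%:R ^+ nu.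
  by move=> i; case: (Ha i) => _ /(_ l l0)[G h1 h2]; exists G.
exists (\sum_(i < d) injy k (G i) * xk k ^+ i); first by exists G => // i; case: (HG i).
move=> x hx; rewrite evalp_sum -sumrB mulr_suml.
apply: (le_trans (ler_norm_sum _ _ _)); apply: ler_sum => i _.
rewrite evalpM evalp_injy evalpXn evalpX -mulrBl normrM normrX mulrAC.
rewrite ler_pM ?exprn_ge0// ?lerXn2r ?nnegrE ?hk//.
case: (HG i) => _ /(_ _ (col_box _ hx)) /le_trans; apply.
by rewrite ler_wpM2r ?invr_ge0 ?exprn_ge0// lerDr.
Qed.

(** The inverse of the map from x to its k-th coordinate and col' k x. *)
Definition insc (t : R) (y : 'rV[R]_N.-1) : 'rV[R]_N :=
  \row_j if unlift k j is Some j' then y 0 j' else t.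

Lemma insc_k t y : insc t y 0 k = t.
Proof. by rewrite mxE unlift_none. Qed.

Lemma col'_insc t y : col' k (insc t y) = y.
Proof. by apply/rowP => j; rewrite !mxE liftK. Qed.

Lemma box_insc (z : 'rV[R]_N) h t y : `|t - z 0 k| <= h -> box (col' k z) h y -> box z h (insc t y).
Proof.
move=> tz yz j; rewrite mxE; case: unliftP => [j' ->|->//].
by have := yz j'; rewrite mxE.
Qed.

(** On the line over y parallel to the k-th axis, the polynomial has degree less
    than d, and it is bounded on an interval of length 2 h around z_k. *)
Lemma coordinate_bound (rho : R) : 0 <= rho -> exists2 C, 0 <= C & forall (G : 'I_d -> mpoly N.-1 R) (z : 'rV[R]_N) h A,
  0 < h -> h <= 1 -> 0 <= A -> `|z 0 k| <= rho ->
  (forall x, box z h x -> `|evalp (\sum_(i < d) injy k (G i) * xk k ^+ i) x| <= A) ->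
  forall i y, box (col' k z) h y -> `|evalp (G i) y| <= C * (A / h ^+ d).
Proof.
move=> rho0; have [C C0 HC] := coef_bound d rho0; exists C => // G z h A h0 h1 A0 zr H i y hy.
pose p := \poly_(i < d) oapp (fun i' : 'I_d => evalp (G i') y) 0 (insub i).
have pE t : p.[t] = evalp (\sum_(i < d) injy k (G i) * xk k ^+ i) (insc t y).
  rewrite horner_poly evalp_sum; apply: eq_bigr => j _.
  by rewrite valK/= evalpM evalp_injy evalpXn evalpX insc_k col'_insc.
have := HC p h (z 0 k) A (size_poly _ _) h0 h1 zr A0 _ i.
rewrite coef_poly ltn_ord valK/=; apply => t tz; rewrite pE; apply: H.
exact: box_insc.
Qed.

Lemma tail_telescope (P : nat -> mpoly N R) n x :
  evalp (P n.+1) x = evalp (P 1%N) x + \sum_(0 <= j < n) evalp (P j.+2 - P j.+1) x.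
Proof.
elim: n => [|n ih]; first by rewrite big_geq// addr0.
by rewrite big_nat_recr//= addrA -ih evalpB addrC subrK.
Qed.

(** The extension is the series of the differences of successive near-best
    approximants. By the hypothesis these are small up to a distance of E that is a
    negative power of the degree, so that their coefficients, which are polynomials in
    y, are small near the projection of E and can be cut off there. As x_k is left
    untouched, the sum is a polynomial of degree less than d in x_k. *)
Lemma bernstein_extension (E : set 'rV[R]_N) (rho : nat) (M : R) (c r : nat) :
  E `<=` box 0 rho%:R -> 0 <= M -> (0 < c)%N ->
  (forall n P b, (0 < n)%N -> tensor_poly k d P -> (degp P <= n)%N ->
    (forall x, E x -> `|evalp P x| <= b) ->
    forall z x, E z -> box z (1 / (c * n ^ r)%:R) x -> `|evalp P x| <= M * b) ->
  forall f, rapidly_approximable k d E f -> exists2 g, CV k d g & forall x, E x -> g x = f x.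
Proof.
move=> hE M0 c0 HM f /near_best[P [e [hP e0 Pe He]]].
pose Rj j := P j.+2 - P j.+1; pose b j := e j.+2 + e j.+1.
have b0 j : 0 <= b j by rewrite addr_ge0 ?e0.
have Rb j x : E x -> `|evalp (Rj j) x| <= b j.
  move=> Ex; rewrite /Rj evalpB.
  have -> : evalp (P j.+2) x - evalp (P j.+1) x = (f x - evalp (P j.+1) x) - (f x - evalp (P j.+2) x) by ring.
  by rewrite (le_trans (ler_normB _ _))// addrC lerD ?Pe.
have hR j : T j.+2 (Rj j) by apply: tensor_leB => //; exact: tensor_poly_le_mono (hP _).
have /choice[G HG] : forall j, exists G : 'I_d -> mpoly N.-1 R,
    (forall i, (degp (G i) <= j.+2)%N) /\ Rj j = \sum_(i < d) injy k (G i) * xk k ^+ i.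
  by move=> j; have [G G1 G2] := hR j; exists G.
pose n j := (j.+2 + d)%N; pose D j := (c * n j ^ r)%N.
have D0 j : (0 < D j)%N by rewrite muln_gt0 c0 expn_gt0.
have Dp j : 0 < (D j)%:R :> R by rewrite ltr0n.
have rho0 : 0 <= rho%:R :> R by [].
have [C C0 HC] := coordinate_bound rho0.
pose F := [set col' k z | z in E].
have hF : F `<=` box 0 rho%:R.
  by move=> _ [z Ez <-] j; have := hE z Ez (lift k j); rewrite !mxE.
pose A j := C * (M * b j * (D j)%:R ^+ d).
have A0 j : 0 <= A j by rewrite mulr_ge0// mulr_ge0 ?exprn_ge0// mulr_ge0.
have Gb j i y0 y : F y0 -> box y0 (2 / (2 * D j)%:R) y -> `|evalp (G j i) y| <= A j.
  move=> [z Ez <-]; have -> : 2 / (2 * D j)%:R = 1 / (D j)%:R :> R.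
    by rewrite natrM; field; rewrite lt0r_neq0.
  have zk : `|z 0 k| <= rho%:R by have := hE z Ez k; rewrite mxE subr0.
  have h0 : 0 < 1 / (D j)%:R :> R by rewrite divr_gt0.
  have h1 : 1 / (D j)%:R <= 1 :> R by rewrite ler_pdivrMr// mul1r ler1n.
  have Mb0 : 0 <= M * b j by rewrite mulr_ge0.
  have := HC (G j) z (1 / (D j)%:R) (M * b j) h0 h1 Mb0 zk _ i y.
  rewrite mul1r exprVn invrK; apply => x zx.
  case: (HG j) => _ <-.
  apply: (HM (n j) (Rj j) (b j) _ _ _ (Rb j) z x Ez) => //.
  - exact: tensor_poly_leW (hR j).
  - exact: tensor_le_degp (hR j).
  - by rewrite mul1r.
have [C' C'0 HC'] := @cutoff R N.-1 rho.
have /choice[ht Hht] : forall ji : nat * 'I_d, exists h, [/\ smooth h, forall y, F y -> h y = evalp (G ji.1 ji.2) y &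
    forall mu s y, (size s <= mu)%N -> `|partials s h y| <=
      C' mu * (ji.1.+2 * (2 * D ji.1))%:R ^+ (N.-1 + N.-1 * mu + 3 * mu) * A ji.1].
  move=> [j i] /=; apply: (HC' F (2 * D j)%N j.+2 (A j) (G j i)) => //.
  - by rewrite muln_gt0/= D0.
  - by case: (HG j).
  - by move=> y0 y; exact: Gb.
pose h i j := ht (j, i).
have sh i j : smooth (h i j) by case: (Hht (j, i)).
have hh i j y : F y -> h i j y = evalp (G j i) y by case: (Hht (j, i)) => _ + _; apply.
have hb i mu : exists K, forall j s y, (size s <= mu)%N -> `|partials s (h i j) y| <= K / j.+1%:R ^+ 2.
  pose p := (N.-1 + N.-1 * mu + 3 * mu)%N; pose nu := (r.+1 * (p + d) + 2)%N.
  have [K K0 HK] := He nu; pose q := (d + 2)%N; pose X0 := (c * q ^ r.+1 * 2)%N.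
  exists (C' mu * (C * (M * (2 * K) * X0%:R ^+ (p + d)))) => j s y ss.
  have W0 : 0 < j.+1%:R :> R by rewrite ltr0n.
  have nW : (n j <= q * j.+1)%N by rewrite /n /q; nia.
  have jW : (j.+2 <= q * j.+1)%N by rewrite /q; nia.
  have nr : (n j ^ r <= q ^ r * j.+1 ^ r)%N.
    by rewrite -expnMn; case: (posnP r) => [->//|r0]; rewrite leq_exp2r.
  pose X := (X0 * j.+1 ^ r.+1)%N.
  have jX : (j.+2 * (2 * D j) <= X)%N.
    have -> : X = ((q * j.+1) * (2 * (c * (q ^ r * j.+1 ^ r))))%N by rewrite /X /X0 !expnS; nia.
    by rewrite leq_mul// leq_mul2l/= leq_mul2l nr orbT.
  have DX : (D j <= X)%N by apply: leq_trans jX; nia.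
  case: (Hht (j, i)) => _ _ /(_ mu s y ss) /le_trans; apply.
  have bW : b j <= 2 * K / j.+1%:R ^+ nu.
    have eW m : (j < m)%N -> e m <= K / j.+1%:R ^+ nu.
      move=> jm; apply: le_trans (HK m (leq_ltn_trans (leq0n j) jm)) _.
      rewrite ler_wpM2l// lef_pV2 ?posrE ?exprn_gt0 ?ltr0n//; last exact: leq_ltn_trans jm.
      by rewrite lerXn2r ?nnegrE// ler_nat.
    by rewrite -mulrA mulr_natl mulr2n lerD// eW// ltnW.
  have XE : X%:R ^+ p * X%:R ^+ d = X0%:R ^+ (p + d) * j.+1%:R ^+ (r.+1 * (p + d)) :> R.
    by rewrite -exprD natrM exprMn natrX -exprM.
  have -> : C' mu * (C * (M * (2 * K) * X0%:R ^+ (p + d))) / j.+1%:R ^+ 2 =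
      C' mu * X%:R ^+ p * (C * (M * (2 * K / j.+1%:R ^+ nu) * X%:R ^+ d)).
    have -> : C' mu * X%:R ^+ p * (C * (M * (2 * K / j.+1%:R ^+ nu) * X%:R ^+ d)) =
      C' mu * (C * (M * (2 * K / j.+1%:R ^+ nu) * (X%:R ^+ p * X%:R ^+ d))) by ring.
    rewrite XE [j.+1%:R ^+ nu]exprD; field.
    by rewrite nat1r expf_neq0 ?pnatr_eq0.
  have Mb : 0 <= M * b j by rewrite mulr_ge0.
  apply: ler_pM => //; first by rewrite mulr_ge0// exprn_ge0.
    by rewrite ler_wpM2l// lerXn2r ?nnegrE// ler_nat.
  rewrite /A ler_wpM2l// ler_pM ?exprn_ge0//; first by rewrite ler_wpM2l.
  by rewrite lerXn2r ?nnegrE// ler_nat.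
have /choice[g /choice[Cg Hg]] := fun i => smooth_series (sh i) (hb i).
exists (fun x => evalp (P 1%N) x + \sum_(i < d) g i (col' k x) * x 0 k ^+ i).
  apply: CV_add; first exact: CV_evalp (tensor_poly_leW (hP _)).
  apply: CV_tensor => [i t|i t nu].
    by exists (3 * Cg i) => y _; case: (Hg i).
  have t0 : 0 < `|t| + 1 by rewrite ltr_wpDl.
  case: (Hg i) => _ _ _ /(_ _ nu t0)[a a0 Ha]; exists a => // l /Ha[G' dG GE].
  exists G' => // y yt; apply: GE => j; rewrite (le_trans (yt j))//.
  by rewrite (le_trans (ler_norm _))// lerDl.
move=> x Ex; apply/eqP; rewrite -subr_eq0 -normr_le0; apply/ler_addgt0Pr => eps eps0; rewrite add0r.
have [K K0 HK] := He 1%N.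
pose L := \sum_(i < d) Cg i * `|x 0 k| ^+ i + K.
have [m m0 hm] := small_quotient L eps0; apply: le_trans hm.
have -> : evalp (P 1%N) x + \sum_(i < d) g i (col' k x) * x 0 k ^+ i - f x =
   (evalp (P m.+1) x - f x) - \sum_(i < d) (\sum_(0 <= j < m) h i j (col' k x) - g i (col' k x)) * x 0 k ^+ i.
  rewrite (tail_telescope P m) (_ : \sum_(0 <= j < m) _ = \sum_(i < d) (\sum_(0 <= j < m) h i j (col' k x)) * x 0 k ^+ i).
    have -> : \sum_(i < d) (\sum_(0 <= j < m) h i j (col' k x) - g i (col' k x)) * x 0 k ^+ i =
      \sum_(i < d) (\sum_(0 <= j < m) h i j (col' k x)) * x 0 k ^+ i - \sum_(i < d) g i (col' k x) * x 0 k ^+ i.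
      by rewrite -sumrB; apply: eq_bigr => i _; rewrite mulrBl.
    ring.
  under [RHS]eq_bigr do rewrite mulr_suml.
  rewrite exchange_big/=; apply: eq_bigr => j _; case: (HG j) => _; rewrite /Rj => ->.
  rewrite evalp_sum; apply: eq_bigr => i _.
  by rewrite evalpM evalp_injy evalpXn evalpX hh//; exists x.
rewrite (le_trans (ler_normB _ _))// addrC /L mulrDl lerD//.
  apply: (le_trans (ler_norm_sum _ _ _)); rewrite mulr_suml; apply: ler_sum => i _.
  rewrite normrM normrX mulrAC ler_wpM2r ?exprn_ge0//.
  by case: (Hg i) => _ + _ _; apply.
rewrite distrC (le_trans (Pe _ _ _ Ex))// (le_trans (HK _ _))// expr1 ler_wpM2l//.
by rewrite lef_pV2 ?posrE ?ltr0n// ler_nat.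
Qed.

End Extension.

(** * Taylor's formula and neighbourhoods of E *)

Section SortedPartials.
Variables (R : realType) (N : nat).
Local Notation ordleq := (fun i j : 'I_N => (i <= j)%N).

Definition multilist (alpha : {ffun 'I_N -> nat}) : seq 'I_N :=
  flatten [seq nseq (alpha i) i | i <- enum 'I_N].

Lemma size_multilist alpha : size (multilist alpha) = absm alpha.
Proof.
rewrite size_flatten /shape -map_comp sumnE big_map /absm big_enum/=.
by apply: eq_bigr => i _; rewrite size_nseq.
Qed.

Lemma count_multilist alpha j : count_mem j (multilist alpha) = alpha j.
Proof.
rewrite count_flatten -map_comp sumnE big_map big_enum/= (bigD1 j)//= count_nseq/= eqxx mul1n.
by rewrite big1 ?addn0// => i ij; rewrite count_nseq/= (negbTE ij) mul0n.
Qed.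

Lemma sorted_multilist alpha : sorted ordleq (multilist alpha).
Proof.
have tr : transitive ordleq by move=> j i l; exact: leq_trans.
rewrite sorted_pairwise// /multilist.
have : pairwise (fun i j : 'I_N => (i < j)%N) (enum 'I_N).
  rewrite -sorted_pairwise; last by move=> j i l; exact: ltn_trans.
  by have := iota_ltn_sorted 0 N; rewrite -val_enum_ord sorted_map.
elim: (enum 'I_N) => [//|i l ih] /= /andP[il hl].
rewrite pairwise_cat ih// andbT; apply/andP; split.
  apply/allrelP => a b; rewrite mem_nseq => /andP[_ /eqP->] /flatten_mapP[c cl].
  by rewrite mem_nseq => /andP[_ /eqP->]; apply: ltnW; exact: (allP il).
elim: (alpha i) => [//|n ihn] /=; rewrite ihn andbT.
by apply/allP => a; rewrite mem_nseq => /andP[_ /eqP->].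
Qed.

(** A sorted list is determined by its multiplicities: the partial derivatives
    along sorted lists are the D^alpha. *)
Lemma sorted_Dalpha s : sorted ordleq s -> exists2 alpha, absm alpha = size s &
  forall f : 'rV[R]_N -> R, partials s f = Dalpha alpha f.
Proof.
move=> ss; pose alpha := [ffun i => count_mem i s] : {ffun 'I_N -> nat}.
have e : multilist alpha = s.
  apply: (@sorted_eq _ ordleq) => //.
  - by move=> j i l; exact: leq_trans.
  - by move=> i j /anti_leq /ord_inj.
  - exact: sorted_multilist.
  by apply/allP => j _ /=; rewrite count_multilist ffunE.
exists alpha; first by rewrite -size_multilist e.
by move=> f; rewrite /Dalpha -/(multilist alpha) e.
Qed.

End SortedPartials.

Section Taylor.
Variables (R : realType) (N : nat).
Local Notation ordleq := (fun i j : 'I_N => (i <= j)%N).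

Lemma pow4_fact n : (4 ^ n <= 4 ^ 4 * n`!)%N.
Proof.
elim: n => [|n ih]; first by rewrite muln1 leq_pexp2l.
have [n3|n3] := leqP 3 n; first by rewrite expnS factS mulnCA leq_mul.
by apply: (@leq_trans (4 ^ 4)%N); [rewrite leq_pexp2l// ltnW|rewrite leq_pmulr// fact_gt0].
Qed.

Lemma sum_pow2_fact : exists2 C : R, 0 < C & forall n, \sum_(m < n) 2 ^+ m / m`!%:R <= C.
Proof.
pose K : R := (4 ^ 4)%N%:R; have K0 : 0 < K by rewrite ltr0n expn_gt0.
have HK m : 4 ^+ m <= K * m`!%:R by rewrite -natrX -natrM ler_nat pow4_fact.
move: K K0 HK => K K0 HK; exists (2 * K) => [|n]; first by rewrite mulr_gt0.
apply: (@le_trans _ _ (\sum_(m < n) K / 2 ^+ m)).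
  apply: ler_sum => m _; rewrite ler_pdivrMr ?ltr0n ?fact_gt0// mulrAC ler_pdivlMr ?exprn_gt0//.
  by apply: le_trans (HK m); rewrite -exprMn -natrM.
suff -> : \sum_(m < n) K / 2 ^+ m = 2 * K - 2 * K / 2 ^+ n.
  by rewrite gerBl divr_ge0 ?exprn_ge0// mulr_ge0// ltW.
elim: n => [|n ih]; first by rewrite big_ord0 expr0 divr1 subrr.
by rewrite big_ord_recr/= ih exprS; field; rewrite expf_neq0.
Qed.

Lemma linep_derivn x (i : 'I_N) (P : mpoly N R) m : (linep x i P)^`(m) = linep x i (mderivs (nseq m i) P).
Proof. by elim: m => [//|m ih]; rewrite derivnS ih deriv_linep. Qed.

(** Taylor's formula in one coordinate after the other, in increasing order:
    then only derivatives along sorted lists appear at z. *)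
Lemma taylor_box : exists2 C : R, 0 < C & forall (P : mpoly N R) z (A L : R), 0 < L ->
  (forall s, sorted ordleq s -> `|evalp (mderivs s P) z| <= A * L ^+ size s) ->
  forall x, box z (2 / L) x -> `|evalp P x| <= C * A.
Proof.
have [C C0 HC] := sum_pow2_fact; exists (C ^+ N); first exact: exprn_gt0.
move=> P z A L L0 H.
have A0 : 0 <= A by have := le_trans (normr_ge0 _) (H [::] isT); rewrite mulr1.
have main j : (j <= N)%N -> forall s, sorted ordleq s -> all (fun i : 'I_N => (j <= i)%N) s ->
    forall x, box z (2 / L) x -> (forall i : 'I_N, (j <= i)%N -> x 0 i = z 0 i) ->
    `|evalp (mderivs s P) x| <= C ^+ j * A * L ^+ size s.
  elim: j => [|j ih] jN s ss sj x xz xj.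
    rewrite expr0 mul1r (_ : x = z) ?H//.
    by apply/rowP => i; rewrite xj.
  pose o := Ordinal jN; pose p := linep x o (mderivs s P).
  have -> : evalp (mderivs s P) x = p.[z 0 o + (x 0 o - z 0 o)].
    by rewrite addrC subrK /p linepE setc_id.
  rewrite nderiv_taylor; last by rewrite /GRing.comm mulrC.
  apply: (le_trans (ler_norm_sum _ _ _)).
  pose B := C ^+ j * A * L ^+ size s.
  have B0 : 0 <= B by rewrite !mulr_ge0 ?exprn_ge0 ?(ltW L0) ?(ltW C0).
  apply: (@le_trans _ _ (\sum_(m < size p) B * (2 ^+ m / m`!%:R))); last first.
    rewrite -mulr_sumr (le_trans (ler_wpM2l B0 (HC _)))// /B exprS.
    by rewrite (_ : _ * C = C * C ^+ j * A * L ^+ size s)//; ring.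
  apply: ler_sum => m _; rewrite normrM normrX.
  have m0 : 0 < m`!%:R :> R by rewrite ltr0n fact_gt0.
  have hm : `|p^`N(m).[z 0 o]| <= B * L ^+ m / m`!%:R.
    rewrite ler_pdivlMr// -[X in _ * X]ger0_norm// -normrM mulr_natr -hornerMn -nderivn_def.
    rewrite linep_derivn linepE /mderivs -foldr_cat.
    apply: (le_trans (ih (ltnW jN) (nseq m o ++ s) _ _ _ _ _)).
    - rewrite sorted_pairwise; last by move=> ? ? ?; exact: leq_trans.
      rewrite pairwise_cat; apply/and3P; split.
      + apply/allrelP => a b; rewrite mem_nseq => /andP[_ /eqP->] bs.
        by apply: ltnW; exact: (allP sj).
      + elim: (nat_of_ord m) => [//|n ihn] /=; rewrite ihn andbT.
        by apply/allP => a; rewrite mem_nseq => /andP[_ /eqP->].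
      + by rewrite -sorted_pairwise// => ? ? ?; exact: leq_trans.
    - rewrite all_cat all_nseq/= leqnn orbT/=; apply: sub_all sj => i; exact: ltnW.
    - by apply: box_setc => //; rewrite subrr normr0 divr_ge0// ltW.
    - move=> i; rewrite leq_eqVlt setcE => /orP[/eqP ij|ij].
        by have -> : i = o by [apply: val_inj]; rewrite eqxx.
      by case: eqP => [->//|_]; exact: xj.
    by rewrite size_cat size_nseq /B exprD [L ^+ m * _]mulrC mulrA.
  have hx : `|x 0 o - z 0 o| ^+ m <= (2 / L) ^+ m by rewrite lerXn2r ?nnegrE ?divr_ge0// ltW.
  apply: (le_trans (ler_pM (normr_ge0 _) (exprn_ge0 _ (normr_ge0 _)) hm hx)).
  rewrite exprMn exprVn le_eqVlt; apply/orP; left; apply/eqP.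
  by field; rewrite expf_neq0 ?lt0r_neq0.
move=> x xz; have := main N (leqnn N) [::] isT isT x xz.
rewrite mulr1; apply => i; by rewrite leqNgt ltn_ord.
Qed.

Lemma eucl_norm_ge (x : 'rV[R]_N) i : `|x 0 i| <= eucl_norm x.
Proof.
rewrite -sqrtr_sqr ler_sqrt ?sumr_ge0// => [|j _]; last exact: sqr_ge0.
by rewrite (bigD1 i)//= lerDl sumr_ge0// => j _; exact: sqr_ge0.
Qed.

Lemma eucl_norm_le (x : 'rV[R]_N) h : 0 <= h -> (forall i, `|x 0 i| <= h) -> eucl_norm x <= N%:R * h.
Proof.
move=> h0 H; rewrite /eucl_norm -(ger0_norm (mulr_ge0 (ler0n R N) h0)) -sqrtr_sqr ler_sqrt ?sqr_ge0//.
apply: (@le_trans _ _ (\sum_(i < N) h ^+ 2)).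
  by apply: ler_sum => i _; rewrite -real_normK ?num_real// lerXn2r ?nnegrE.
rewrite sumr_const card_ord -[leLHS]mulr_natl exprMn ler_wpM2r ?sqr_ge0//.
by rewrite -natrX ler_nat; case: N => // n; rewrite leq_pmulr.
Qed.

Lemma eucl_dist_box (x : 'rV[R]_N) E (h : R) : 0 < h -> (eucl_dist x E <= h%:E)%E ->
  exists2 z, E z & box z (2 * h) x.
Proof.
move=> h0 hE; have : (eucl_dist x E < (2 * h)%:E)%E.
  by rewrite (le_lt_trans hE)// lte_fin ltr_pMl// ltr1n.
move=> /ereal_inf_lt[_ [z Ez <-]]; rewrite lte_fin => hz; exists z => // i.
by have := eucl_norm_ge (x - z) i; rewrite !mxE => /le_trans; apply; exact: ltW.
Qed.

Lemma box_eucl_dist (x z : 'rV[R]_N) (E : set 'rV[R]_N) (h : R) : 0 <= h -> E z -> box z h x ->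
  (eucl_dist x E <= (N%:R * h)%:E)%E.
Proof.
move=> h0 Ez xz; apply: ge_ereal_inf; exists (eucl_norm (x - z))%:E; first by exists z.
by rewrite lee_fin; apply: eucl_norm_le => // i; have := xz i; rewrite !mxE.
Qed.

End Taylor.

Section Implications.
Variables (R : realType) (N : nat) (k : 'I_N) (d : nat) (E : set 'rV[R]_N) (rho : nat).
Hypothesis hE : E `<=` box 0 rho%:R.
Local Notation T := (tensor_poly_le k d).

Lemma supnorm_evalp (P : mpoly N R) : exists2 b, 0 <= b & supnorm (sigL E (evalp P)) = b%:E.
Proof.
have [b b0 hb] := evalp_bounded P rho%:R.
by apply: (@supnorm_fin R N E (evalp P) b b0) => x /hE; exact: hb.
Qed.

Lemma markov_nbhd : exists2 C : R, 0 < C & forall M r : R, 0 < M -> 0 < r ->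
  (forall P, tensor_poly k d P -> forall alpha : {ffun 'I_N -> nat},
     (supnorm (sigL E (Dalpha alpha (evalp P))) <=
      (M * (degp P)%:R `^ (r * (absm alpha)%:R))%:E * supnorm (sigL E (evalp P)))%E) ->
  forall n : nat, (1 <= n)%N ->
       forall P, tensor_poly k d P -> (degp P <= n)%N ->
       forall x : 'rV[R]_N, (eucl_dist x E <= ((n%:R `^ r)^-1)%:E)%E ->
         (`|evalp P x|%:E <= (C * M)%:E * supnorm (sigL E (evalp P)))%E.
Proof.
have [C C0 HC] := taylor_box R N; exists C => // M r M0 r0 H n n1 P hP dP x xE.
have [b b0 hb] := supnorm_evalp P.
have n0 : 0 < n%:R :> R by rewrite ltr0n.
have L0 : 0 < n%:R `^ r :> R by rewrite powR_gt0.
have Li : 0 < (n%:R `^ r)^-1 :> R by rewrite invr_gt0.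
have [z Ez xz] := eucl_dist_box Li xE.
rewrite hb -EFinM lee_fin -mulrA; apply: (HC _ _ _ _ L0 _ _ xz) => s ss.
have [alpha sa ea] := sorted_Dalpha R ss.
have := H P hP alpha; rewrite hb -EFinM => /supnorm_sigL[_ /(_ z Ez)].
rewrite -ea partials_evalp => /le_trans; apply.
rewrite mulrAC ler_wpM2l ?mulr_ge0 ?(ltW M0)// sa.
rewrite -powR_mulrn ?powR_ge0// -powRrM ge0_ler_powR ?nnegrE// ?ler_nat//.
by rewrite mulr_ge0// ltW.
Qed.

Lemma nbhd_extension (M r : R) : (0 < N)%N -> 0 < M -> 0 < r ->
  (forall n : nat, (1 <= n)%N ->
       forall P, tensor_poly k d P -> (degp P <= n)%N ->
       forall x : 'rV[R]_N, (eucl_dist x E <= ((n%:R `^ r)^-1)%:E)%E ->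
         (`|evalp P x|%:E <= M%:E * supnorm (sigL E (evalp P)))%E) ->
  forall f, rapidly_approximable k d E f -> exists2 g, CV k d g & forall x, E x -> g x = f x.
Proof.
move=> N0 M0 r0 H; pose r' := Num.bound r.
apply: (@bernstein_extension R N k d E rho M N r' hE (ltW M0) N0) => n P b n0 hP dP Pb z x Ez xz.
have [b' b'0 hb] := supnorm_evalp P.
have b'b : b' <= b.
  rewrite -lee_fin -hb; apply/supnorm_sigL; split => //.
  exact: le_trans (normr_ge0 _) (Pb z Ez).
have np : 0 < n%:R :> R by rewrite ltr0n.
have Np : 0 < N%:R :> R by rewrite ltr0n.
have := H n n0 P hP dP x; rewrite hb -EFinM lee_fin => HH.
apply: le_trans (HH _) _; last by rewrite ler_wpM2l// ltW.
have h0 : 0 <= 1 / (N * n ^ r')%:R :> R by rewrite divr_ge0.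
apply: le_trans (box_eucl_dist h0 Ez xz) _; rewrite lee_fin.
have -> : N%:R * (1 / (N * n ^ r')%:R) = (n%:R ^+ r')^-1 :> R.
  by rewrite natrM natrX; field; rewrite expf_neq0 ?lt0r_neq0.
rewrite lef_pV2 ?posrE ?exprn_gt0 ?powR_gt0// -powR_mulrn ?ler0n//.
by rewrite ler_powR ?ler1n// ltW// archi_boundP// ltW.
Qed.

Lemma sigL_eqP (f g : 'rV[R]_N -> R) : sigL E f = sigL E g <-> forall x, E x -> f x = g x.
Proof.
split=> [e x Ex|e]; first by have := congr1 (@^~ (SigSub (mem_set Ex))) e.
by apply/funext => x; apply: e; exact: set_valP.
Qed.

Lemma rapidly_approximable_distances f : rapidly_decreasing (fun l => distK (sigL E f) (T l)) <-> rapidly_approximable k d E f.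
Proof. exact: rapid_distances hE. Qed.

Lemma extension_distances :
  (forall f, rapidly_approximable k d E f -> exists2 g, CV k d g & forall x, E x -> g x = f x) <->
  (forall f : E -> R, rapidly_decreasing (fun l => distK f (T l)) ->
       exists2 g : 'rV[R]_N -> R, CV k d g & sigL E g = f).
Proof.
split=> H f.
  rewrite -(valLK 0 f) => /rapidly_approximable_distances/H[g hg gf]; exists g => //.
  exact/sigL_eqP.
by move=> /rapidly_approximable_distances/H[g hg /sigL_eqP gf]; exists g.
Qed.

End Implications.

(** * The seminorms of J on E *)

Section Boxes.
Variables (R : realType) (N : nat).

Lemma compact_box0 (h : R) : compact (box 0 h : set 'rV[R]_N).
Proof.
have -> : box 0 h = [set v : 'rV[R]_N | forall i, `[- h, h]%classic (v ord0 i)].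
  apply/seteqP; split => v hv i; have := hv i; rewrite /= mxE subr0 ler_norml in_itv//=.
apply: (@rV_compact _ _ (fun=> `[- h, h]%classic)) => _; exact: segment_compact.
Qed.

Lemma continuous_bounded_box (f : 'rV[R]_N -> R) h : continuous f ->
  exists B, forall x, box 0 h x -> `|f x| <= B.
Proof.
move=> cf; have := continuous_compact (continuous_subspaceT cf) (compact_box0 (h := h)).
move=> /compact_bounded[M [_ HM]]; exists (M + 1) => x hx.
by apply: (HM (M + 1)); [rewrite ltrDl|exists x].
Qed.

End Boxes.

Section Seminorms.
Variables (R : realType) (N : nat) (k : 'I_N) (d : nat) (E : set 'rV[R]_N) (rho : nat).
Hypothesis hE : E `<=` box 0 rho%:R.
Local Notation T := (tensor_poly_le k d).
Local Notation rT := (gauge_le k d).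
Local Notation J := (J_seminorms k d E).

Lemma J_upper p : J p -> exists nu, forall f a, rT E nu a f -> (p (sigL E f) <= a%:E)%E.
Proof.
case=> [[->|->]|[nu nu0 <-]].
- by exists 0%N => f a [a0 fa _]; apply/supnorm_sigL.
- exists 0%N => f a [a0 fa _]; apply: distK_le => //; exists 0; first exact: tensor_le0.
  by move=> x /fa; rewrite evalp0 subr0.
exists nu => f a [a0 _ fl]; apply: ge_ereal_sup => _ [l l0 <-].
have lp : 0 < l%:R ^+ nu :> R by rewrite exprn_gt0 ?ltr0n.
have al0 : 0 <= a / l%:R ^+ nu by rewrite divr_ge0// ltW.
apply: (@le_trans _ _ ((l%:R ^+ nu)%:E * (a / l%:R ^+ nu)%:E)%E).
  apply: lee_wpmul2l; first by rewrite lee_fin ltW.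
  exact: distK_le (fl l l0).
by rewrite -EFinM mulrC divfK ?lt0r_neq0.
Qed.

Lemma J_lower nu : exists2 s : seq ((E -> R) -> \bar R), (forall p, p \in s -> J p) &
  forall f a, (forall p, p \in s -> (p (sigL E f) < a%:E)%E) -> rT E nu a f.
Proof.
pose q := fun f : E -> R => ereal_sup [set ((l%:R ^+ nu.+1)%:E * distK f (T l))%E | l in [set l | (0 < l)%N]].
exists [:: @supnorm R N E; q] => [p|f a H].
  rewrite !inE => /orP[/eqP->|/eqP->]; first by left; left.
  by right; exists nu.+1.
have /ltW/supnorm_sigL[a0 fa] : (supnorm (sigL E f) < a%:E)%E by apply: H; rewrite inE eqxx.
have qa : (q (sigL E f) < a%:E)%E by apply: H; rewrite !inE eqxx orbT.
apply: (gauge_le_order (leqnSn nu)); split => // l l0; apply: distK_lt.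
have lp : 0 < l%:R ^+ nu.+1 :> R by rewrite exprn_gt0 ?ltr0n.
have : ((l%:R ^+ nu.+1)%:E * distK (sigL E f) (T l) < a%:E)%E.
  by apply: le_lt_trans qa; apply: ereal_sup_ubound; exists l.
have := distK_ge0 k d (sigL E f) l; case: (distK _ _) => [r _|_|//].
  by rewrite -EFinM !lte_fin ltr_pdivlMr// mulrC.
by rewrite gt0_muley ?lte_fin.
Qed.

Variable Q : 'I_d -> mpoly N.-1 R.
Hypotheses (hd : (1 <= d)%N) (hEV : E `<=` variety k Q).

(** Jackson's theorem, transported to V by the reduction. *)
Lemma reduction_gauge nu : exists (mu : nat) (C : R), 0 <= C /\
  forall f A, smooth f -> bounded_partials rho.+1%:R N mu A f -> rT E nu (C * A) f.
Proof.
have rho0 : 0 < rho.+1%:R :> R by [].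
have [C [mu [C0 H]]] := @jackson R N rho.+1%:R rho0 nu.
pose q := degQ Q.
have q0 : (0 < q)%N by [].
have hE1 x : E x -> box 0 rho.+1%:R x.
  by move=> /hE xr i; rewrite (le_trans (xr i))// ler_nat.
exists mu, (C * (2 * q)%:R ^+ nu + q.+1%:R ^+ nu); split.
  by rewrite addr_ge0 ?mulr_ge0 ?exprn_ge0.
move=> f A sf fA.
have bA x : box 0 rho.+1%:R x -> `|f x| <= A by exact: (fA [::]).
have A0 : 0 <= A.
  by apply: le_trans (normr_ge0 _) (bA 0 _) => i; rewrite subrr normr0.
rewrite mulrDl [q.+1%:R ^+ nu * A]mulrC.
apply: gauge_le_eventually => //.
- by rewrite !mulr_ge0 ?exprn_ge0.
- by move=> x /hE1/bA.
move=> l ql l0; pose n := (l %/ q)%N.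
have n0 : (0 < n)%N by rewrite divn_gt0.
have [P dP PE] := H f A sf fA n n0.
have [P' hP' PP'] := @varfun_evalp R N k d Q hd n P dP.
exists P'; first by apply: tensor_poly_le_mono hP'; exact: leq_divM.
move=> x Ex; rewrite -PP'; last exact: hEV.
apply: (le_trans (PE x (hE1 x Ex))).
have -> : C * (2 * q)%:R ^+ nu * A / l%:R ^+ nu = C * A * ((2 * q)%:R / l%:R) ^+ nu.
  by rewrite expr_div_n; ring.
rewrite ler_wpM2l ?mulr_ge0// -exprVn lerXn2r ?nnegrE ?divr_ge0 ?invr_ge0//.
rewrite -[leLHS]mul1r ler_pdivrMr ?ltr0n// mulrAC ler_pdivlMr ?ltr0n// mul1r -natrM ler_nat.
have := ltn_ceil l q0; rewrite -/n => ln.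
by nia.
Qed.

Lemma smooth_rapidly_approximable f : smooth f -> rapidly_approximable k d E f.
Proof.
move=> sf nu; have [mu [C [C0 H]]] := reduction_gauge nu.
have /choice[b Hb] : forall s, exists b, forall x, box 0 rho.+1%:R x -> `|partials s f x| <= b.
  by move=> s; apply: continuous_bounded_box; case: (sf s).
have [A HA] := lists_bounded mu b.
exists (C * A); apply: H => // s _ _ ss x hx.
exact: le_trans (Hb s x hx) (HA s ss).
Qed.

Hypothesis lift_ex : forall f, rapidly_approximable k d E f -> exists2 g, CV k d g & forall x, E x -> g x = f x.

Lemma CV_on_Cinf : CV_on k d E = Cinf_on E.
Proof.
apply/seteqP; split => _ [f hf <-]; first by exists f => //; exact: CV_smooth hf.
have [g hg gf] := lift_ex (smooth_rapidly_approximable hf).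
by exists g => //; apply/sigL_eqP.
Qed.

End Seminorms.

(** * Completeness of J *)

Section Completeness.
Variables (R : realType) (N : nat) (k : 'I_N) (d : nat) (E : set 'rV[R]_N) (rho : nat).
Hypothesis hE : E `<=` box 0 rho%:R.
Local Notation T := (tensor_poly_le k d).
Local Notation rT := (gauge_le k d).
Local Notation J := (J_seminorms k d E).

Definition toCV_on g (hg : CV k d g) : CV_on k d E := SigSub (mem_set (ex_intro2 _ _ g hg erefl)).

Lemma CV_onP (h : CV_on k d E) : exists2 g, CV k d g & sigL E g = \val h.
Proof. by have := set_valP h. Qed.

(** A Cauchy filter contains sets that are small for the gauge of order j; a
    sequence chosen in them has a limit that is rapidly approximable on E, hence
    is the restriction of an element of CV. *)
Lemma J_complete :
  (forall f, rapidly_approximable k d E f -> exists2 g, CV k d g & forall x, E x -> g x = f x) ->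
  seminorm_complete (CV_on k d E) J.
Proof.
move=> lift_ex F PF cF.
have H nu e : 0 < e -> exists2 C, F C & forall h h', C h -> C h' ->
    forall g g', sigL E g = \val h -> sigL E g' = \val h' -> rT E nu e (fun x => g x - g' x).
  move=> e0; have [s sJ Hs] := J_lower k d E nu.
  have [C FC HC] : exists2 C, F C & forall h h', C h -> C h' -> forall p, p \in s -> (pdist p h h' < e%:E)%E.
    elim: s sJ {Hs} => [|p s ih] sJ; first by exists setT => //; exact: filterT.
    have [|C FC HC] := ih; first by move=> q qs; apply: sJ; rewrite inE qs orbT.
    have Jp : J p by apply: sJ; rewrite inE eqxx.
    have [[A B] [/= FA FB] AB] := cF p Jp e e0.
    exists (C `&` (A `&` B)); first exact: filterI FC (filterI FA FB).
    move=> h h' [Ch [Ah _]] [Ch' [_ Bh']] q; rewrite inE => /orP[/eqP->|qs]; last exact: HC.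
    exact: (AB (h, h')).
  exists C => // h h' Ch Ch' g g' gh gh'; apply: Hs => p ps.
  by have := HC h h' Ch Ch' p ps; rewrite /pdist -gh -gh'.
have p2 j : 0 < 1 / 2 ^+ j :> R by rewrite divr_gt0 ?exprn_gt0.
have /choice[C HC] : forall j, exists C, F C /\ forall h h', C h -> C h' ->
    forall g g', sigL E g = \val h -> sigL E g' = \val h' -> rT E j (1 / 2 ^+ j) (fun x => g x - g' x).
  by move=> j; have [C FC hC] := H j _ (p2 j); exists C.
pose D j h := forall i, (i <= j)%N -> C i h.
have FD j : F (D j).
  elim: j => [|j ih].
    by apply: filterS (proj1 (HC 0%N)) => h Ch i; rewrite leqn0 => /eqP->.
  apply: filterS (filterI ih (proj1 (HC j.+1))) => h [Dh Ch] i.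
  by rewrite leq_eqVlt => /orP[/eqP->//|]; exact: Dh.
have /choice[u Du] : forall j, exists h, D j h by move=> j; exact: filter_ex (FD j).
have /choice[g Hg] : forall j, exists g, CV k d g /\ sigL E g = \val (u j).
  by move=> j; have [g g1 g2] := CV_onP (u j); exists g.
have step n j : rT E n (1 / 2 ^+ n / 2 ^+ j) (fun x => g (n + j).+1 x - g (n + j)%N x).
  have h1 : C (n + j)%N (u (n + j).+1) by apply: Du; rewrite leqnSn.
  have h2 : C (n + j)%N (u (n + j)%N) by exact: Du.
  have := (HC (n + j)%N).2 _ _ h1 h2 _ _ (Hg _).2 (Hg _).2.
  by rewrite exprD invfM mulrA; apply: gauge_le_order; exact: leq_addr.
have [f Hf] : exists f, forall x eps, E x -> 0 < eps ->
    exists J, forall j, (J <= j)%N -> `|f x - g j x| <= eps.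
  apply: geometric_limit => x Ex; exists 0%N, 1 => j _.
  by case: (step 0%N j) => _ /(_ x Ex) + _; rewrite add0n expr0 divr1.
have lim n : rT E n (3 * (1 / 2 ^+ n)) (fun x => f x - g n x).
  have := @gauge_le_limit R N k d E n (1 / 2 ^+ n) (fun j => g (n + j)%N) f _ _ 0%N.
  rewrite addn0 expr0 divr1; apply => [j|x eps Ex eps0]; first by rewrite addnS; exact: step.
  have [J' HJ'] := Hf x eps Ex eps0; exists J' => j Jj; apply: HJ'.
  by rewrite (leq_trans Jj)// leq_addl.
have fX : rapidly_approximable k d E f.
  move=> n; have [b gb] := CV_rapidly_approximable hE (Hg n).1 n.
  exists (3 * (1 / 2 ^+ n) + b).
  by apply: gauge_le_eq (gauge_leD (lim n) gb) => x _; rewrite subrK.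
have [G hG Gf] := lift_ex f fX.
exists (toCV_on hG) => A; rewrite nbhsE => -[B [oB BL] BA]; apply: filterS BA _.
have [s sJ [e e0 He]] := oB _ BL.
suff : F [set h | forall p, p \in s -> (pdist p h (toCV_on hG) < e%:E)%E] by exact: filterS.
elim: s sJ {He} => [|p s ih] sJ; first by apply: filterS filterT.
have Fs := ih (fun q qs => sJ q (mem_behead (s := p :: s) qs)).
have [nu Hnu] := J_upper (sJ p (mem_head p s)).
have [n0 n00 hn0] := small_quotient 5 e0; pose n := maxn nu n0.
apply: filterS (filterI Fs (FD n)) => h [hs Dh] q; rewrite inE => /orP[/eqP->|]; last exact: hs.
have [gh _ ghE] := CV_onP h.
have r1 := (HC n).2 _ _ (Dh n (leqnn n)) (Du n n (leqnn n)) _ _ ghE (Hg n).2.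
have r2 : rT E n (4 * (1 / 2 ^+ n)) (fun x => gh x - G x).
  rewrite (_ : 4 * (1 / 2 ^+ n) = 1 / 2 ^+ n + 3 * (1 / 2 ^+ n)); last by ring.
  by apply: gauge_le_eq (gauge_leB r1 (lim n)) => x Ex; rewrite Gf//; ring.
have := Hnu _ _ (gauge_le_order (leq_maxl nu n0) r2).
rewrite /pdist -ghE => /le_lt_trans; apply; rewrite lte_fin.
apply: lt_le_trans hn0; rewrite mul1r.
have n1 : 0 < n0%:R :> R by rewrite ltr0n.
have n2 : n0%:R <= 2 ^+ n :> R.
  by rewrite -natrX ler_nat (leq_trans (leq_maxr nu n0))// ltnW// ltn_expl.
rewrite ltr_pdivrMr ?exprn_gt0// mulrAC ltr_pdivlMr//.
apply: (@lt_le_trans _ _ (5 * n0%:R)); last by rewrite ler_wpM2l.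
by rewrite ltr_pM2r// ltr_nat.
Qed.

(** The near-best approximants of f converge to f in the topology J. *)
Lemma complete_extension :
  seminorm_complete (CV_on k d E) J ->
  forall f, rapidly_approximable k d E f -> exists2 g, CV k d g & forall x, E x -> g x = f x.
Proof.
move=> cJ f /near_best[P [e [hP e0 Pe He]]].
have gauge nu : exists2 K, 0 <= K & forall l, (0 < l)%N -> rT E nu (K / l%:R) (fun x => f x - evalp (P l) x).
  have [K K0 HK] := He nu.+1; exists K => // l l0.
  have lp : 0 < l%:R :> R by rewrite ltr0n.
  have eK (m l' : nat) : (0 < l')%N -> (l' <= m)%N -> (l <= m)%N -> e m <= K / l%:R / l'%:R ^+ nu.
    move=> l'0 l'm lm; apply: le_trans (HK m (leq_trans l0 lm)) _.
    have m0 : (0 < m)%N := leq_trans l0 lm.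
    rewrite -mulrA -invfM ler_wpM2l// exprS lef_pV2 ?posrE ?mulr_gt0 ?exprn_gt0 ?ltr0n//.
    by rewrite ler_pM ?exprn_ge0// ?lerXn2r ?nnegrE// ler_nat.
  split; first by rewrite divr_ge0.
    move=> x Ex; apply: le_trans (Pe l x l0 Ex) _.
    by have := eK l 1%N isT l0 (leqnn l); rewrite expr1n divr1.
  move=> l' l'0; have [ll'|l'l] := leqP l l'.
    exists (P l' - P l); first by apply: tensor_leB => //; exact: tensor_poly_le_mono (hP l).
    move=> x Ex; rewrite evalpB opprB addrA subrK; apply: le_trans (Pe l' x l'0 Ex) _.
    exact: eK.
  exists 0; first exact: tensor_le0.
  move=> x Ex; rewrite evalp0 subr0; apply: le_trans (Pe l x l0 Ex) _.
  by apply: eK => //; exact: ltnW.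
pose u l : CV_on k d E := toCV_on (CV_evalp (tensor_poly_leW (hP l))).
have cu p : J p -> forall eps : R, 0 < eps -> exists n0, forall m n, (n0 <= m)%N -> (n0 <= n)%N ->
    (p (\val (u m) - \val (u n))%R < eps%:E)%E.
  move=> /J_upper[nu Hnu] eps eps0; have [K K0 HK] := gauge nu.
  have [n0 n00 hn0] := small_quotient (2 * K) (divr_gt0 eps0 (ltr0Sn R 1)).
  exists n0 => m n n0m n0n.
  have m0 := leq_trans n00 n0m; have n1 := leq_trans n00 n0n.
  have r : rT E nu (K / n%:R + K / m%:R) (fun x => evalp (P m) x - evalp (P n) x).
    by apply: gauge_le_eq (gauge_leB (HK n n1) (HK m m0)) => x _; ring.
  apply: (le_lt_trans (Hnu _ _ r)); rewrite lte_fin.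
  apply: (@le_lt_trans _ _ (eps / 2)); last by rewrite ltr_pdivrMr// ltr_pMr// ltr1n.
  apply: le_trans hn0; rewrite mulr_natl mulr2n mulrDl.
  by rewrite lerD// ler_wpM2l// lef_pV2 ?posrE ?ltr0n// ler_nat.
have [|L uL] := cJ (u @ \oo) _.
  move=> p Jp eps eps0; have [n0 Hn0] := cu p Jp eps eps0.
  exists (u @` [set n | (n0 <= n)%N], u @` [set n | (n0 <= n)%N]) => /=.
    by split; exists n0 => // n hn; exists n.
  by move=> [h h'] /= [[m hm <-] [n hn <-]]; exact: Hn0.
have [G hG GL] := CV_onP L; exists G => // x Ex.
apply/eqP; rewrite -subr_eq0 -normr_le0; apply/ler_addgt0Pr => eps eps0; rewrite add0r.
pose U : set (seminormed (CV_on k d E) J) := [set h | (supnorm (\val h - \val L)%R < (eps / 2)%:E)%E].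
have e2 : 0 < eps / 2 by rewrite divr_gt0.
have sup_real (h : E -> R) (a : R) : (supnorm h < a%:E)%E -> exists2 c, c < a & (supnorm h <= c%:E)%E.
  by have := supnorm_ge0 h; case: (supnorm h) => // c _; rewrite lte_fin => ca; exists c.
have oU : seminorm_open U.
  move=> h /sup_real[c ca hc]; exists [:: @supnorm R N E].
    by move=> p; rewrite inE => /eqP->; left; left.
  exists (eps / 2 - c); first by rewrite subr_gt0.
  move=> h' /(_ _ (mem_head _ _)) /sup_real[c' ca' hc'].
  apply: (@le_lt_trans _ _ (c' + c)%:E); last by rewrite lte_fin -ltrBrDr.
  move: hc hc' => /supnorm_leP[c0 hc] /supnorm_leP[c'0 hc'].
  apply/supnorm_leP; split; first exact: addr_ge0.
  move=> y; apply: le_trans (lerD (hc' y) (hc y)).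
  apply: le_trans (ler_normD _ _); rewrite (_ : _ + _ = (\val h' - \val L) y)//.
  exact: subrKA.
have UL : U L by apply: (@le_lt_trans _ _ 0%:E) => //; apply/supnorm_leP; split => // y; rewrite (_ : _ y = 0) ?normr0//; exact: subrr.
have [n0 _ Hn0] : \forall n \near \oo, U (u n).
  by apply: (uL U); apply: open_nbhs_nbhs; split.
have [K K0 HK] := He 1%N.
have [n1 n10 hn1] := small_quotient K e2.
pose n := maxn n0 n1.
have ngt0 : (0 < n)%N by rewrite (leq_trans n10)// leq_maxr.
have /ltW : U (u n) := Hn0 n (leq_maxl _ _).
rewrite -GL (_ : (_ - _)%R = sigL E (fun y => evalp (P n) y - G y))// => /supnorm_sigL[_ /(_ x Ex) hx].
have -> : G x - f x = - (f x - evalp (P n) x) - (evalp (P n) x - G x) by ring.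
rewrite (le_trans (ler_normB _ _))// normrN (splitr eps) lerD//.
apply: le_trans (Pe n x ngt0 Ex) _; apply: le_trans (HK n ngt0) _; apply: le_trans hn1.
by rewrite expr1 ler_wpM2l// lef_pV2 ?posrE ?ltr0n// ler_nat leq_maxr.
Qed.

End Completeness.

(** * Comparison of J and Q, and Markov's inequality on E *)

Section Comparison.
Variables (R : realType) (V : zmodType) (A : set V).

Lemma seminorm_open_le (S1 S2 : set (V -> \bar R)) :
  (forall p, S1 p -> forall e : R, 0 < e -> exists2 s : seq (V -> \bar R), (forall q, q \in s -> S2 q) &
     exists2 del : R, 0 < del & forall f g : A, (forall q, q \in s -> (q (\val f - \val g)%R < del%:E)%E) ->
       (p (\val f - \val g)%R < e%:E)%E) ->
  forall U : set A, @seminorm_open R V A S1 U -> @seminorm_open R V A S2 U.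
Proof.
move=> H U oU f /oU[s sS [e e0 He]].
suff [s' s'S [del del0 Hd]] : exists2 s' : seq (V -> \bar R), (forall q, q \in s' -> S2 q) &
    exists2 del : R, 0 < del & forall f g : A, (forall q, q \in s' -> (q (\val f - \val g)%R < del%:E)%E) ->
      forall p, p \in s -> (p (\val f - \val g)%R < e%:E)%E.
  by exists s' => //; exists del => // g Hg; apply: He => p; exact: Hd.
elim: s sS {He} => [|p s ih] sS; first by exists [::] => //; exists 1.
have [|s1 s1S [d1 d10 H1]] := ih; first by move=> q qs; apply: sS; rewrite inE qs orbT.
have [|s2 s2S [d2 d20 H2]] := H p _ e e0; first by apply: sS; rewrite inE eqxx.
exists (s1 ++ s2); first by move=> q; rewrite mem_cat => /orP[/s1S|/s2S].
exists (Num.min d1 d2); first by rewrite lt_min d10.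
move=> g h gh q; rewrite inE => /orP[/eqP->|].
  apply: H2 => q' q's; apply: lt_le_trans (gh q' _) _; first by rewrite mem_cat q's orbT.
  by rewrite lee_fin ge_min lexx orbT.
apply: H1 => q' q's; apply: lt_le_trans (gh q' _) _; first by rewrite mem_cat q's.
by rewrite lee_fin ge_min lexx.
Qed.

End Comparison.

Section Topologies.
Variables (R : realType) (N : nat) (k : 'I_N) (d : nat) (E : set 'rV[R]_N) (rho : nat).
Hypothesis hE : E `<=` box 0 rho%:R.
Local Notation T := (tensor_poly_le k d).
Local Notation rT := (gauge_le k d).
Local Notation J := (J_seminorms k d E).
Local Notation QS := (Q_seminorms k d E).
Local Notation A := (CV_on k d E).

Lemma Cnorm_bound K nu g (a : R) : (Cnorm K nu g <= a%:E)%E ->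
  forall alpha, (absm alpha <= nu)%N -> forall x : 'rV[R]_N, K x -> `|Dalpha alpha g x| <= a.
Proof.
move=> H alpha an; have /supnorm_sigL[_] : (supnorm (sigL K (Dalpha alpha g)) <= a%:E)%E; last exact.
by apply: le_trans H; apply: ereal_sup_ubound; exists alpha.
Qed.

Lemma Cnorm_le K nu g (a : R) : 0 <= a ->
  (forall alpha, (absm alpha <= nu)%N -> forall x : 'rV[R]_N, K x -> `|Dalpha alpha g x| <= a) ->
  (Cnorm K nu g <= a%:E)%E.
Proof.
move=> a0 H; apply: ge_ereal_sup => _ [alpha an <-]; apply/supnorm_sigL; split => // x.
exact: H.
Qed.

Lemma q_seminorm_lt K nu (h : E -> R) (a : R) : (q_seminorm k d K nu h < a%:E)%E ->
  exists g, [/\ CV k d g, sigL E g = h &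
    forall s, sorted (fun i j : 'I_N => (i <= j)%N) s -> (size s <= nu)%N ->
      forall x : 'rV[R]_N, K x -> `|partials s g x| <= a].
Proof.
move=> /ereal_inf_lt[_ [g [hg gh] <-]] /ltW Hg; exists g; split => // s ss sn x Kx.
have [alpha sa ->] := sorted_Dalpha R ss.
by apply: (Cnorm_bound Hg) => //; rewrite sa.
Qed.

(** By Jackson's theorem on V, a seminorm of J is dominated by finitely many
    derivatives of any extension. *)
Lemma J_open_Q (Q : 'I_d -> mpoly N.-1 R) : (1 <= d)%N -> E `<=` variety k Q ->
  forall U : set A, @seminorm_open R _ A J U -> @seminorm_open R _ A QS U.
Proof.
move=> hd hEV; apply: seminorm_open_le => p /J_upper[nu Hnu] e e0.
have [mu [C [C0 H]]] := reduction_gauge hE hd hEV nu.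
exists [:: @q_seminorm R N k d E (box 0 rho.+1%:R) mu].
  move=> q; rewrite inE => /eqP->; exists (box 0 rho.+1%:R); first exact: compact_box0.
  by exists mu.
have C1 : 0 < C + 1 by rewrite ltr_wpDl.
exists (e / (C + 1)) => [|f g /(_ _ (mem_head _ _)) /q_seminorm_lt[h [hh <- Hh]]].
  by rewrite divr_gt0.
have r := H h _ (CV_smooth hh) (fun s ss _ sn x hx => Hh s ss sn x hx).
apply: le_lt_trans (Hnu _ _ r) _.
by rewrite lte_fin mulrCA gtr_pMr// ltr_pdivrMr// mul1r ltrDl.
Qed.

Lemma CV_partials_bound h nu : exists2 n : nat, True & exists2 C : R, 0 < C & forall g a,
  rT (box 0 n%:R) n a g -> forall s x, (size s <= nu)%N -> box 0 h%:R x -> `|partials s g x| <= C * a.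
Proof.
have h0 : 0 <= h%:R :> R by [].
have HH : forall s : seq 'I_N, exists C : R, 0 < C /\ forall g a, rT (box 0 (h%:R + (size s)%:R)) (6 * size s) a g ->
    forall x, box 0 h%:R x -> `|partials s g x| <= C * a.
  by move=> s; have [C C0 HC] := gauge_le_partials k d s h0; exists C.
have [C HC] := choice HH.
have [B HB] := lists_bounded nu C.
have C0 s : 0 < C s by case: (HC s).
have B0 : 0 < B by apply: lt_le_trans (C0 [::]) (HB [::] isT).
exists (h + 6 * nu)%N => //; exists B => // g a ga s x sn hx.
have a0 : 0 <= a by case: ga.
have [_ H] := HC s.
apply: le_trans (H g a _ x hx) _; last by rewrite ler_wpM2r// HB.
apply: gauge_le_subset (gauge_le_order _ ga); last by rewrite (leq_trans _ (leq_addl _ _))// leq_mul2l.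
move=> y hy i; apply: le_trans (hy i) _; rewrite -natrD ler_nat leq_add2l.
by rewrite (leq_trans sn)// leq_pmull.
Qed.

(** By the open mapping theorem there are extensions with controlled gauges, and
    their derivatives are controlled by Bernstein's theorem. *)
Lemma Q_open_J :
  (forall f, rapidly_approximable k d E f -> exists2 g, CV k d g & forall x, E x -> g x = f x) ->
  forall U : set A, @seminorm_open R _ A QS U -> @seminorm_open R _ A J U.
Proof.
move=> lift_ex; apply: seminorm_open_le => _ [K cK [nu ->]] e e0.
have [h Kh] := compact_box cK.
have [n _ [C C0 HC]] := CV_partials_bound h nu.
have [mu [C' [C'0 H]]] := controlled_lift hE lift_ex n.
have [s sJ Hs] := J_lower k d E mu.
have CC0 : 0 < C * C' by rewrite mulr_gt0.
pose del := e / 2 / (C * C').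
have del0 : 0 < del by rewrite !divr_gt0.
exists s => //; exists del => // f f' Hff.
have [g hg gf] := CV_onP f; have [g' hg' gf'] := CV_onP f'.
have r : rT E mu del (fun x => g x - g' x).
  by apply: Hs => p ps; have := Hff p ps; rewrite -gf -gf'.
have rX : rapidly_approximable k d E (fun x => g x - g' x) by exact: CV_rapidly_approximable hE (CV_sub hg hg').
have [G [hG GE Ga]] := H _ _ rX r.
apply: (@le_lt_trans _ _ (e / 2)%:E); last by rewrite lte_fin ltr_pdivrMr// ltr_pMr// ltr1n.
apply: ge_ereal_inf; exists (Cnorm K nu G).
  by exists G => //; split => //; rewrite -gf -gf'; exact: (proj2 (sigL_eqP E G _) GE).
apply: Cnorm_le => [|alpha an x Kx]; first by rewrite divr_ge0// ltW.
have -> : e / 2 = C * (C' * del) by rewrite /del; field; rewrite !lt0r_neq0.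
by apply: (HC _ _ Ga); [rewrite size_multilist|exact: Kh].
Qed.

Hypothesis hdet : CV_determining k d E.
Hypothesis cE : compact E.
Hypothesis QJ : forall U : set A, @seminorm_open R _ A QS U -> @seminorm_open R _ A J U.

Lemma J_upper_list (s : seq ((E -> R) -> \bar R)) : (forall p, p \in s -> J p) ->
  exists nu, forall p, p \in s -> forall f a, rT E nu a f -> (p (sigL E f) <= a%:E)%E.
Proof.
elim: s => [|p s ih] sJ; first by exists 0%N.
have [|nu Hnu] := ih; first by move=> q qs; apply: sJ; rewrite inE qs orbT.
have [mu Hmu] := J_upper (sJ p (mem_head p s)).
exists (maxn nu mu) => q; rewrite inE => /orP[/eqP->|qs] f a fa.
  by apply: Hmu; exact: gauge_le_order (leq_maxr nu mu) fa.
by apply: (Hnu q qs); exact: gauge_le_order (leq_maxl nu mu) fa.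
Qed.

Lemma CV_zero : CV k d (fun _ : 'rV[R]_N => 0 : R).
Proof. by apply/CV_P => h nu; exists 0; exact: gauge_le0. Qed.

(** The functions that have an extension with small first derivatives on E form
    an open set for Q, hence for J. *)
Lemma unit_ball_lift : exists nu e, 0 < e /\ forall f, CV k d f -> rT E nu e f ->
  exists g, [/\ CV k d g, forall x, E x -> g x = f x & forall i x, E x -> `|partials [:: i] g x| <= 1].
Proof.
pose U : set A := [set h | exists g c, [/\ CV k d g, sigL E g = \val h, c < 1 &
  forall i x, E x -> `|partials [:: i] g x| <= c]].
have oU : @seminorm_open R _ A QS U.
  move=> h [g [c [hg gh c1 Hc]]]; exists [:: @q_seminorm R N k d E E 1].
    by move=> p; rewrite inE => /eqP->; exists E => //; exists 1%N.
  have e0 : 0 < (1 - c) / 2 by rewrite divr_gt0// subr_gt0.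
  exists ((1 - c) / 2) => // h' /(_ _ (mem_head _ _)) /q_seminorm_lt[g' [hg' gh' Hg']].
  exists (fun x => g x + g' x), (c + (1 - c) / 2); split; first exact: CV_add.
  - rewrite (_ : sigL E _ = sigL E g + sigL E g')// gh gh'; exact: subrKC.
  - by lra.
  move=> i x Ex; rewrite (partialsD _ (CV_smooth hg) (CV_smooth hg')).
  apply: le_trans (ler_normD _ _) _; apply: lerD; first exact: Hc.
  exact: (Hg' [:: i]).
have U0 : U (toCV_on E CV_zero).
  exists (fun=> 0), 0; split => // [|i x Ex]; first exact: CV_zero.
  by rewrite partials_cst/= normr0.
have [s sJ [e e0 He]] := QJ oU U0.
have [nu Hnu] := J_upper_list sJ.
exists nu, (e / 2); split; first by rewrite divr_gt0.
move=> f hf fr.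
have [p ps|g [c [hg gf c1 Hc]]] := He (toCV_on E hf).
  rewrite /pdist (_ : (_ - _)%R = sigL E f); last by apply/funext => x; exact: subr0.
  apply: le_lt_trans (Hnu p ps f _ fr) _.
  by rewrite lte_fin ltr_pdivrMr// ltr_pMr// ltr1n.
exists g; split => // [|i x Ex]; first exact/sigL_eqP.
by apply: le_trans (Hc i x Ex) _; exact: ltW.
Qed.

(** As E is determining, the small extension of a multiple of P has on E the
    same derivatives as that multiple. *)
Lemma markov_step : exists (nu : nat) (C : R), 0 < C /\ forall n (P : mpoly N R) b, (0 < n)%N ->
  tensor_poly k d P -> (degp P <= n)%N -> 0 <= b -> (forall x, E x -> `|evalp P x| <= b) ->
  forall i x, E x -> `|evalp (mderiv i P) x| <= C * n%:R ^+ nu * b.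
Proof.
have [nu [e [e0 H]]] := unit_ball_lift.
exists nu, e^-1; split; first by rewrite invr_gt0.
have same f g : CV k d f -> CV k d g -> (forall x, E x -> g x = f x) -> forall i x, E x ->
    partials [:: i] f x = partials [:: i] g x.
  move=> hf hg gf i x Ex.
  have hfg := CV_sub hf hg.
  have fE : f = (fun y => g y + (f y - g y)) by apply/funext => y; ring.
  rewrite fE (partialsD _ (CV_smooth hg) (CV_smooth hfg)).
  have [alpha _ ea] := @sorted_Dalpha R N [:: i] isT.
  by rewrite (ea (fun y => f y - g y)) (hdet hfg) ?addr0// => y Ey; rewrite gf ?subrr.
move=> n P b n0 hP dP; rewrite le_eqVlt => /orP[/eqP<- Pb i x Ex|b0 Pb i x Ex].
  rewrite mulr0 normr_le0; apply/eqP.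
  have P0 y : E y -> 0 = evalp P y by move=> /Pb; rewrite normr_le0 => /eqP.
  by have := same _ _ (CV_evalp hP) CV_zero P0 i x Ex; rewrite (partials_cst [:: i]) /= derive_evalp_at.
have np : 0 < n%:R ^+ nu :> R by rewrite exprn_gt0 ?ltr0n.
pose t := e / (n%:R ^+ nu * b); have t0 : 0 < t by rewrite divr_gt0 ?mulr_gt0.
have hT : T n (t *: P) by apply/tensor_leZ/(tensor_poly_le_mono dP)/tensor_poly_degp.
have [|g [hg gP Hg]] := H _ (CV_evalp (tensor_poly_leW hT)).
  have -> : e = n%:R ^+ nu * (t * b) by rewrite /t; field; rewrite !lt0r_neq0.
  apply: gauge_le_poly => //; first by rewrite mulr_ge0// ltW.
  by move=> y Ey; rewrite evalpZ normrM gtr0_norm// ler_wpM2l ?Pb// ltW.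
have := Hg i x Ex; rewrite -(same _ _ (CV_evalp (tensor_poly_leW hT)) hg gP i x Ex).
rewrite partials_evalp /= linearZ/= evalpZ normrM gtr0_norm// => h1.
have -> : e^-1 * n%:R ^+ nu * b = 1 / t by rewrite /t; field; rewrite !lt0r_neq0.
by rewrite ler_pdivlMr// mulrC.
Qed.

Lemma markov_inequality : exists M r : R, [/\ 0 < M, 0 < r &
       forall P, tensor_poly k d P -> forall alpha : {ffun 'I_N -> nat},
         (supnorm (sigL E (Dalpha alpha (evalp P))) <=
          (M * (degp P)%:R `^ (r * (absm alpha)%:R))%:E *
          supnorm (sigL E (evalp P)))%E].
Proof.
have [nu [C [C0 H]]] := markov_step.
pose c := Num.bound C; exists (1 + C), (nu + c).+1%:R; split => //; first by rewrite addr_gt0.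
move=> P hP alpha; have [b b0 hb] := supnorm_evalp hE P.
have /supnorm_sigL[_ Pb] : (supnorm (sigL E (evalp P)) <= b%:E)%E by rewrite hb.
rewrite hb -EFinM; apply/supnorm_sigL.
have M1 : 1 <= 1 + C by rewrite lerDl ltW.
split; first by rewrite mulr_ge0// mulr_ge0 ?powR_ge0// addr_ge0// ltW.
move=> x Ex; rewrite /Dalpha -/(multilist alpha) partials_evalp -size_multilist.
have iter s n : (0 < n)%N -> (degp P <= n)%N -> forall y, E y ->
    `|evalp (mderivs s P) y| <= (C * n%:R ^+ nu) ^+ size s * b.
  move=> n0 dP; elim: s => [|i s ih] y Ey; first by rewrite mul1r Pb.
  rewrite /= exprS -mulrA; apply: (H n (mderivs s P)) => //.
  - exact: tensor_mderivs.
  - exact: degp_mderivs_le.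
  - by rewrite mulr_ge0// exprn_ge0// mulr_ge0 ?exprn_ge0// ltW.
case: (multilist alpha) => [|i s].
  by rewrite /= mulr0 powRr0 mulr1 (le_trans (Pb x Ex))// ler_peMl.
rewrite -natrM powR_mulrn//.
have [n0|n1] := leqP (degp P) 0.
  rewrite /= mderiv_degp0 ?evalp0 ?normr0; last exact: degp_mderivs_le.
  by rewrite mulr_ge0// mulr_ge0 ?exprn_ge0// addr_ge0// ltW.
(* The constant C to the power |alpha| is absorbed by the power of the degree
   only from degree 2 on; in degree 1 the second derivatives vanish. *)
have [n1'|n2] := leqP (degp P) 1.
  have -> : degp P = 1%N by apply/eqP; rewrite eqn_leq n1'.
  rewrite expr1n mulr1; case: s => [|j s].
    have := iter [:: i] 1%N isT n1' x Ex; rewrite expr1n mulr1 expr1 => /le_trans; apply.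
    by rewrite ler_wpM2r// lerDr.
  rewrite /= mderiv_degp0 ?evalp0 ?normr0; last first.
    by have := degp_mderivs (j :: s) n1'; rewrite /= subSS sub0n.
  by rewrite mulr_ge0// addr_ge0// ltW.
apply: le_trans (iter (i :: s) (degp P) n1 (leqnn _) x Ex) _.
rewrite ler_wpM2r// -[leLHS]mul1r ler_pM//.
  by rewrite exprn_ge0// mulr_ge0 ?exprn_ge0// ltW.
rewrite exprM lerXn2r ?nnegrE ?exprn_ge0//; first by rewrite mulr_ge0 ?exprn_ge0// ltW.
apply: (@le_trans _ _ ((degp P)%:R ^+ (nu + c))); last by rewrite ler_weXn2l// ler1n.
rewrite addnC exprD ler_wpM2r ?exprn_ge0//.
apply: (@le_trans _ _ c%:R); first by rewrite ltW// archi_boundP// ltW.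
have c0 : (0 < c)%N by rewrite -(ltr0n R) (lt_trans C0)// archi_boundP// ltW.
by rewrite -natrX ler_nat ltnW// (leq_trans (ltn_expl c (ltnSn 1)))// leq_exp2r.
Qed.

End Topologies.

(** * The equivalence *)

Theorem theorem4p1 (R : realType) (N : nat) (hN : (2 <= N)%N) (k : 'I_N)
    (d : nat) (hd : (1 <= d)%N) (Q : 'I_d -> mpoly N.-1 R)
    (E : set 'rV[R]_N) (hE : compact E) (hEV : E `<=` variety k Q)
    (hdet : CV_determining k d E) :
  [<->
    (exists M r : R, [/\ 0 < M, 0 < r &
       forall P, tensor_poly k d P -> forall alpha : {ffun 'I_N -> nat},
         (supnorm (sigL E (Dalpha alpha (evalp P))) <=
          (M * (degp P)%:R `^ (r * (absm alpha)%:R))%:E *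
          supnorm (sigL E (evalp P)))%E]);
    (exists M r : R, [/\ 0 < M, 0 < r &
       forall n : nat, (1 <= n)%N ->
       forall P, tensor_poly k d P -> (degp P <= n)%N ->
       forall x : 'rV[R]_N, (eucl_dist x E <= ((n%:R `^ r)^-1)%:E)%E ->
         (`|evalp P x|%:E <= M%:E * supnorm (sigL E (evalp P)))%E]);
    (forall f : E -> R,
       rapidly_decreasing (fun l => distK f (tensor_poly_le k d l)) ->
       exists2 g : 'rV[R]_N -> R, CV k d g & sigL E g = f);
    (seminorm_complete (CV_on k d E) (J_seminorms k d E) /\
     CV_on k d E = Cinf_on E);
    (forall U : set (CV_on k d E),
       @open (CV_tauJ k d E) U <-> @open (CV_tauQ k d E) U)
  ].
Proof.
have [rho hrho] := compact_box hE.
have ext := extension_distances k d hrho.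
tfae.
- move=> [M [r [M0 r0 H]]]; have [C C0 HC] := markov_nbhd k d hrho.
  exists (C * M), r; split => //; first exact: mulr_gt0.
  exact: HC M0 r0 H.
- move=> [M [r [M0 r0 H]]]; apply/ext.
  move=> f fX; exact (nbhd_extension hrho (ltnW hN) M0 r0 H fX).
- move=> /ext lift; split; first exact: (J_complete hrho lift).
  exact: (CV_on_Cinf hrho hd hEV lift).
- move=> [cJ _] U; split; first exact: (J_open_Q hrho hd hEV).
  have lift f : rapidly_approximable k d E f -> exists2 g, CV k d g & forall x, E x -> g x = f x.
    by move=> fX; exact (complete_extension cJ fX).
  exact: (Q_open_J hrho lift).
- move=> JQ; apply: (markov_inequality hrho hdet hE) => U QU.
  exact: (proj2 (JQ U) QU).
Qed.
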